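(* Any Eisenstein root lattice is an (orthogonal) direct sum of copies of the following 4 lattices (with the form induced from the standard Hermitian inner product on $\mathbb C^n$): $$A_2^{\mathcal E}=\theta\mathcal E,\qquad D_4^{\mathcal E}=\{(x,x,y)\in\mathcal E^3: x\equiv y \ (\mathrm{mod}\ \theta)\},$$ $$E_6^{\mathcal E}=\{(x,y,z)\in\mathcal E^3: x\equiv y\equiv z\ (\mathrm{mod}\ \theta)\},$$ $$E_8^{\mathcal E}=\{(x_1,\dots,x_4)\in\mathcal E^4:\pi(x_1,\dots,x_4)\in\mathcal C_4\},$$ where $\pi:\mathcal E^4\to\mathcal E^4/\theta\mathcal E^4=\mathbb F_3^4$ is reduction and $\mathcal C_4\subseteq\mathbb F_3^4$ is the tetracode, the span of $(0,1,1,1)$ and $(1,0,1,-1)$. These lattices have the following properties. For $L$ one of them, let $R$ be the group generated by the triflections in the roots of $L$. Then $\operatorname{Aut}L$ is the direct product of $R$ and a cyclic group $C$ of scalars, and: - $L=A_2^{\mathcal E}$: $R\cong\mathbb Z/3$, $C\cong\mathbb Z/2$, $|\operatorname{Aut}L|=6$, $\theta L'/L\cong\mathbb F_3^1$, and every nonzero element of $\theta L'/L$ has minimal representatives of norm $1$. - $L=D_4^{\mathcal E}$: $R\cong \mathrm{SL}_2(3)$, $C\cong\mathbb Z/3$, $|\operatorname{Aut}L|=72$, $\theta L'/L\cong\mathbb F_4^1$, and every nonzero element of $\theta L'/L$ has minimal representatives of norm $3/2$. - $L=E_6^{\mathcal E}$: $R\cong 3^{1+2}{:}\mathrm{SL}_2(3)$,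 $C\cong\mathbb Z/2$, $|\operatorname{Aut}L|=1296$, $\theta L'/L\cong\mathbb F_3^1$, and every nonzero element of $\theta L'/L$ has minimal representatives of norm $2$. - $L=E_8^{\mathcal E}$: $R\cong 3\times\mathrm{Sp}_4(3)$, $C=1$, $|\operatorname{Aut}L|=155520$, and $\theta L'/L=0$. Here $\theta L'/L$ is described as a vector space over $\mathcal E/\theta\mathcal E=\mathbb F_3$ or $\mathcal E/2\mathcal E=\mathbb F_4$.
   Context: Let $\omega$ be a primitive cube root of unity, $\mathcal E=\mathbb Z[\omega]$, $\theta=\omega-\bar\omega=\sqrt{-3}$. An $\mathcal E$-lattice is a free $\mathcal E$-module of finite rank with an $\mathcal E$-valued Hermitian form $\langle\cdot|\cdot\rangle$, linear in the first and antilinear in the second argument. The norm of $x$ is $|x|^2=\langle x|x\rangle$. For $L$ nondegenerate, $L'=\{v\in L\otimes\mathbb C:\langle L|v\rangle\subseteq\mathcal E\}$ and $\theta L'=\theta\cdot(L')$. $\operatorname{Aut}L$ is the group of $\mathcal E$-linear isometries of $L$. If $L\subseteq\theta L'$, a root of $L$ is a vector $r\in L$ with $|r|^2=3$. The triflections in $r$ are the $\omega$-reflection $x\mapsto x+(\omega-1)\frac{\langle x|r\rangle}{|r|^2}r$ and its inverse; these are isometries of $L$. An Eisenstein root lattice is a positive-definite $\mathcal E$-lattice $L$ satisfying $L\subseteq\theta L'$ and spanned by its roots. Group notation (ATLAS): $A{:}B$ is a split extension (semidirect product) with normal subgroup $A$ and complement $B$; $3^{1+2}$ is an extraspecial group of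 order 27; in $3\times\mathrm{Sp}_4(3)$ the symbol $3$ denotes a cyclic group of order 3. ''Minimal representatives'' of a coset means elements of the coset of smallest norm. *)

(* Defs.v *)
From mathcomp Require Import all_boot all_order all_algebra all_fingroup all_solvable.
From mathcomp Require Import boolp classical_sets functions reals.
From mathcomp Require Import complex.

Set Implicit Arguments.
Unset Strict Implicit.
Unset Printing Implicit Defensive.

Import Order.TTheory GRing.Theory Num.Theory Num.Def.

Local Open Scope ring_scope.

Section EisensteinIntegers.
Context {C : numClosedFieldType}.
Variable w : C.

Definition eis_theta : C := w - w^*.

(* The ring of Eisenstein integers Z[w], as a subset of C. *)
Definition eis : set C :=
  fun z => exists a b : int, z = a%:~R + b%:~R * w.

Definition eis_dvd (p z : C) : Prop := exists2 e, eis e & z = p * e.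

(* [red] restricts to a surjective ring morphism Z[w] -> F of kernel pZ[w], so
   that it identifies Z[w]/pZ[w] with F; its values off Z[w] are irrelevant. *)
Definition residue_map (p : C) (F : finFieldType) (red : C -> F) : Prop :=
  [/\ red 1 = 1,
      forall a b, eis a -> eis b -> red (a + b) = red a + red b,
      forall a b, eis a -> eis b -> red (a * b) = red a * red b,
      forall a, eis a -> (red a = 0 <-> eis_dvd p a)
    & forall c, exists2 a, eis a & red a = c].

End EisensteinIntegers.

(* Z[w]-lattices are represented as subsets L of a complex vector space V
   equipped with a Hermitian form: L is the Z[w]-span of a C-free family, so
   that L (x) C is identified with the C-span of L in V (which may be smaller
   than V). *)
Section Lattices.
Context {C : numClosedFieldType}.
Variable w : C.

Definition span_over {V : vectType C} (A : set C) (S : set V) : set V :=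
  fun x => exists n (a : 'I_n -> C) (v : 'I_n -> V),
    [/\ forall i, A (a i), forall i, S (v i) & x = \sum_i a i *: v i].

Section OneLattice.
Context {V : vectType C} (h : {hermitian_sym V for conjC}) (L : set V).

Definition eis_lattice : Prop :=
  (exists2 b : seq V, free b & L = span_over (eis w) [set` b]%classic) /\
  (forall x y, L x -> L y -> eis w (h x y)).

Definition dual_lattice : set V :=
  fun v => span_over setT L v /\ forall x, L x -> eis w (h x v).

Definition theta_dual : set V :=
  fun v => exists2 u, dual_lattice u & v = eis_theta w *: u.

Definition lattice_root : set V := fun r => L r /\ h r r = 3.

Definition eis_root_lattice : Prop :=
  [/\ eis_lattice,
      forall x, L x -> x != 0 -> 0 < h x x,
      (L `<=` theta_dual)%classic
    & L = span_over (eis w) lattice_root].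

Definition omega_reflection (r x : V) : V :=
  x + ((w - 1) * (h x r / h r r)) *: r.

(* theta L' / L is isomorphic to F^d, where F = Z[w]/pZ[w] has q elements;
   phi is the composite theta L' -> theta L' / L -> F^d. *)
Definition discriminant_space (p : C) (q d : nat) : Prop :=
  (L `<=` theta_dual)%classic /\
  exists (F : finFieldType) (red : C -> F) (phi : V -> 'rV[F]_d),
  [/\ #|F| = q,
      residue_map w p red,
      forall x y, theta_dual x -> theta_dual y -> phi (x + y) = phi x + phi y,
      forall a x, eis w a -> theta_dual x -> phi (a *: x) = red a *: phi x
    & (forall x, theta_dual x -> (phi x = 0 <-> L x)) /\
      (forall c, exists2 x, theta_dual x & phi x = c)].

Definition minimal_representative (v u : V) : Prop :=
  L (u - v) /\ forall u', L (u' - v) -> h u u <= h u' u'.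

Definition discriminant_norm (c : C) : Prop :=
  forall v, theta_dual v -> ~ L v ->
  exists2 u, minimal_representative v u & h u u = c.

End OneLattice.

(* Only the restriction of f to L is relevant. *)
Definition lattice_isometry {V W : vectType C}
    (h : {hermitian_sym V for conjC}) (L : set V)
    (k : {hermitian_sym W for conjC}) (M : set W) (f : V -> W) : Prop :=
  [/\ set_bij L M f,
      forall x y, L x -> L y -> f (x + y) = f x + f y,
      forall a x, eis w a -> L x -> f (a *: x) = a *: f x
    & forall x y, L x -> L y -> k (f x) (f y) = h x y].

Section Automorphisms.
Context {V : vectType C} (h : {hermitian_sym V for conjC}) (L : set V).
Context {gT : finGroupType} (rho : gT -> V -> V).

(* rho is an isomorphism from the finite group gT onto Aut L. *)
Definition aut_isomorphism : Prop :=
  [/\ forall g, lattice_isometry h L h L (rho g),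
      forall g g' x, L x -> rho (g * g')%g x = rho g (rho g' x)
    & forall f, lattice_isometry h L h L f ->
        exists! g, forall x, L x -> rho g x = f x].

Definition is_omega_reflection (g : gT) : Prop :=
  exists2 r, lattice_root h L r & forall x, L x -> rho g x = omega_reflection h r x.

Definition triflection_group : {set gT} :=
  <<[set g | `[< is_omega_reflection g \/ is_omega_reflection g^-1%g >]]>>%g.

Definition scalar_group (S : {set gT}) : Prop :=
  forall g, g \in S -> exists u : C, forall x, L x -> rho g x = u *: x.

Definition aut_structure (S : {group gT}) : Prop :=
  [/\ aut_isomorphism, scalar_group S, cyclic S
    & (triflection_group \x S)%g = [set: gT]].

End Automorphisms.

Definition seq_row n (s : seq C) : 'rV[C]_n := \row_(i < n) s`_i.

Definition A2_lattice : set 'rV[C]_1 :=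
  fun v => exists2 e, eis w e & v = seq_row 1 [:: eis_theta w * e].

Definition D4_lattice : set 'rV[C]_3 :=
  fun v => exists x y, [/\ eis w x, eis w y, eis_dvd w (eis_theta w) (x - y)
                         & v = seq_row 3 [:: x; x; y]].

Definition E6_lattice : set 'rV[C]_3 :=
  fun v => exists x y z,
    [/\ eis w x /\ eis w y /\ eis w z, eis_dvd w (eis_theta w) (x - y),
        eis_dvd w (eis_theta w) (y - z) & v = seq_row 3 [:: x; y; z]].

(* The tetracode is the row space of this matrix. *)
Definition tetracode : 'M['F_3]_(2, 4) :=
  \matrix_(i < 2, j < 4)
    (nth [::] [:: [:: 0; 1; 1; 1]; [:: 1; 0; 1; -1]] i)`_j.

(* pi(v) = c, where F_3 is identified with Z[w]/theta Z[w] by means of the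
   representatives 0, 1, 2. *)
Definition reduces_to n (v : 'rV[C]_n) (c : 'rV['F_3]_n) : Prop :=
  forall i, eis_dvd w (eis_theta w) (v 0 i - (c 0 i : nat)%:R).

Definition E8_lattice : set 'rV[C]_4 :=
  fun v => (forall i, eis w (v 0 i)) /\
    exists2 c : 'rV['F_3]_4, (c <= tetracode)%MS & reduces_to v c.

End Lattices.

Inductive root_type := A2 | D4 | E6 | E8.

Definition std_dim (t : root_type) : nat :=
  match t with A2 => 1 | D4 => 3 | E6 => 3 | E8 => 4 end.

Definition std_lattice {C : numClosedFieldType} (w : C) (t : root_type) :
    set 'rV[C]_(std_dim t) :=
  match t with
  | A2 => A2_lattice w
  | D4 => D4_lattice w
  | E6 => E6_lattice w
  | E8 => E8_lattice w
  end.

Arguments std_lattice {C} w t _.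

Definition std_form {C : numClosedFieldType} n :
  {hermitian_sym 'rV[C]_n for conjC} := @dotmx C n.

Definition orthogonal_sum_of_std {C : numClosedFieldType} (w : C)
    {V : vectType C} (h : {hermitian_sym V for conjC}) (L : set V) : Prop :=
  exists n (t : 'I_n -> root_type) (M : 'I_n -> set V),
  [/\ forall i, exists f,
        lattice_isometry w (std_form _) (std_lattice w (t i)) h (M i) f,
      forall i j x y, i != j -> M i x -> M j y -> h x y = 0,
      forall u : 'I_n -> V, (forall i, M i (u i)) -> L (\sum_i u i)
    & forall x, L x -> exists! u : {ffun 'I_n -> V},
        (forall i, M i (u i)) /\ x = \sum_i u i].

Definition SL2_3 : {set {'GL_2['F_3]}} := [set g | \det (val g) == 1].

Definition Sp4_3 : {set {'GL_4['F_3]}} :=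
  let J : 'M['F_3]_(2 + 2) := block_mx 0 1%:M (- 1%:M) 0 in
  [set g | (val g : 'M_(2 + 2)) *m J *m (val g : 'M_(2 + 2))^T == J].

(* R = 3^{1+2} : SL_2(3). *)
Definition is_3_1_2_SL2_3 {gT : finGroupType} (R : {set gT}) : Prop :=
  exists P H : {group gT},
  [/\ (P ><| H = R)%g, extraspecial P, #|P| = 27%N & H \isog SL2_3].

(* Main.v *)
(** A chain is a sequence of roots b_0, ..., b_n with <b_i | b_(i+1)> = theta and
    all other products zero.  Its Gram determinants are 3, 6, 9, 9, 0 for
    n = 0, ..., 4, so a chain in a definite lattice has at most four roots, and
    the four standard lattices are the lattices of these chains.

    If M is the lattice of a chain, theta M' / M is E / d, generated by one glue
    vector p with every nonzero class represented by a unit times p.  A root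
    whose projection to M falls in M lies in M or is orthogonal to M; otherwise
    a unit multiple of it, translated by M, extends the chain.  Hence a root
    lattice splits off the lattice of a maximal chain, and one concludes by
    induction on the rank.

    Aut M is the unitary group of the Gram matrix.  Reduction mod theta maps it
    to the isometries of an alternating form over F_3; the kernel is <omega>,
    since two congruent vectors of norm 3 differ by a cube root of unity.  The
    image is everything, since the isometries are generated by the reductions of
    the triflections and -1.  A power of the Coxeter element is scalar, which
    puts the missing scalars in the reflection group R, and R is the kernel of
    the action on theta M' / M. *)

Require Import Defs.
From HB Require Import structures.
From mathcomp Require Import all_boot all_order all_algebra all_fingroup all_solvable.
From mathcomp Require Import all_field.
From mathcomp Require Import boolp classical_sets functions reals.
From mathcomp Require Import complex.
From mathcomp Require Import ring zify.

Set Implicit Arguments.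
Unset Strict Implicit.
Unset Printing Implicit Defensive.

Import Order.TTheory GRing.Theory Num.Theory Num.Def.

Local Open Scope ring_scope.

(** * Eisenstein integers *)

(** Dividing the Gram matrix by theta leaves a tridiagonal matrix with entries 1, -1 and - theta,
    which makes sense over any ring with a root of w^2 + w + 1. One matrix thus serves over
    Z[omega], over the complex field, over F_3 with w = 1, where theta is 0 and the form is
    alternating, and over F_7 with w = 2. Its off-diagonal entries are units, so elimination runs
    over all these rings and leaves only the last coordinate; this is why the discriminant group is
    cyclic.

    Aut M consists of matrices over an infinite ring and has to be produced as a finite group. It is
    embedded in GL_k(F_7): 7 is the least norm of a prime that separates the six units, since -1 = 1
    modulo 2 and omega = 1 modulo theta. Its order comes from reduction modulo theta, where
    generation is checked by evaluating a table of Schreier words: each basis vector in turn is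
    brought home by a word that fixes the earlier ones, and the numbers of vectors in the stages
    multiply to the order. *)

Record eisint := Eisint { eis_re : int; eis_im : int }.

Definition eisint_pair (x : eisint) := (eis_re x, eis_im x).
Definition pair_eisint (p : int * int) := Eisint p.1 p.2.
Lemma eisint_pairK : cancel eisint_pair pair_eisint. Proof. by case. Qed.

HB.instance Definition _ := Choice.copy eisint (can_type eisint_pairK).

Definition eis_add x y := Eisint (eis_re x + eis_re y) (eis_im x + eis_im y).
Definition eis_opp x := Eisint (- eis_re x) (- eis_im x).
Definition eis_mul x y :=
  Eisint (eis_re x * eis_re y - eis_im x * eis_im y)
         (eis_re x * eis_im y + eis_im x * eis_re y - eis_im x * eis_im y).

Fact eis_addA : associative eis_add.
Proof. by move=> [a b] [c d] [e f]; congr Eisint; rewrite /= addrA. Qed.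
Fact eis_addC : commutative eis_add.
Proof. by move=> [a b] [c d]; congr Eisint; rewrite /= addrC. Qed.
Fact eis_add0 : left_id (Eisint 0 0) eis_add.
Proof. by move=> [a b]; congr Eisint; rewrite /= add0r. Qed.
Fact eis_addN : left_inverse (Eisint 0 0) eis_opp eis_add.
Proof. by move=> [a b]; congr Eisint; rewrite /= addNr. Qed.
HB.instance Definition _ :=
  GRing.isZmodule.Build eisint eis_addA eis_addC eis_add0 eis_addN.

Fact eis_mulA : associative eis_mul.
Proof. by move=> [a b] [c d] [e f]; congr Eisint; rewrite /=; ring. Qed.
Fact eis_mulC : commutative eis_mul.
Proof. by move=> [a b] [c d]; congr Eisint; rewrite /=; ring. Qed.
Fact eis_mul1 : left_id (Eisint 1 0) eis_mul.
Proof. by move=> [a b]; congr Eisint; rewrite /=; ring. Qed.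
Fact eis_mulD : left_distributive eis_mul eis_add.
Proof. by move=> [a b] [c d] [e f]; congr Eisint; rewrite /=; ring. Qed.
Fact eis_1neq0 : Eisint 1 0 != 0. Proof. by []. Qed.
HB.instance Definition _ :=
  GRing.Zmodule_isComNzRing.Build eisint eis_mulA eis_mulC eis_mul1 eis_mulD eis_1neq0.

Definition eis_conj (x : eisint) := Eisint (eis_re x - eis_im x) (- eis_im x).
Fact eis_conj_additive : zmod_morphism eis_conj.
Proof. by move=> [a b] [c d]; congr Eisint; rewrite /=; ring. Qed.
Fact eis_conj_multiplicative : monoid_morphism eis_conj.
Proof. by split=> // [[a b] [c d]]; congr Eisint; rewrite /=; ring. Qed.
HB.instance Definition _ :=
  GRing.isZmodMorphism.Build eisint eisint eis_conj eis_conj_additive.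
HB.instance Definition _ :=
  GRing.isMonoidMorphism.Build eisint eisint eis_conj eis_conj_multiplicative.

Lemma eis_conjK : involutive eis_conj.
Proof. by move=> [a b]; congr Eisint; rewrite /=; ring. Qed.

Definition omega := Eisint 0 1.

Definition eis_norm (x : eisint) : int :=
  eis_re x ^+ 2 - eis_re x * eis_im x + eis_im x ^+ 2.

Lemma eis_normE x : Eisint (eis_norm x) 0 = x * eis_conj x.
Proof. by case: x => a b; congr Eisint; rewrite /= /eis_norm /=; ring. Qed.

Lemma eis_normM x y : eis_norm (x * y) = eis_norm x * eis_norm y.
Proof. by case: x y => [a b] [c d]; rewrite /eis_norm /=; ring. Qed.

Definition cube_root_eq (K : comNzRingType) (w : K) := w ^+ 2 + w + 1 = 0.

Section Evaluation.
Variables (K : comNzRingType) (w : K).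
Hypothesis w_root : cube_root_eq w.

(** The proof that w is a root is an argument, so that the term itself carries what its ring
    morphism structure rests on. *)
Definition eis_ev of cube_root_eq w := fun x : eisint =>
  (eis_re x)%:~R + (eis_im x)%:~R * w : K.
Local Notation ev := (eis_ev w_root).

Fact eis_ev_additive : zmod_morphism ev.
Proof. by move=> [a b] [c d]; rewrite /eis_ev /= !rmorphB /=; ring. Qed.
Fact eis_ev_multiplicative : monoid_morphism ev.
Proof.
split; first by rewrite /eis_ev /= mul0r addr0.
move=> [a b] [c d]; rewrite /eis_ev /= !rmorphB !rmorphD !rmorphM /=.
apply/eqP; rewrite -subr_eq0; apply/eqP.
transitivity (- (b%:~R * d%:~R * (w ^+ 2 + w + 1)) : K); first by ring.
by rewrite w_root mulr0 oppr0.
Qed.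
HB.instance Definition _ :=
  GRing.isZmodMorphism.Build eisint K ev eis_ev_additive.
HB.instance Definition _ :=
  GRing.isMonoidMorphism.Build eisint K ev eis_ev_multiplicative.

Lemma eis_ev_omega : ev omega = w.
Proof. by rewrite /eis_ev add0r mul1r. Qed.
End Evaluation.

Lemma omega_root : cube_root_eq omega. Proof. by []. Qed.

(** This is w - w^2 when w^2 + w + 1 = 0, written without conjugation so that it can be formed in
    F_3 and F_7 as well. *)
Definition theta_of (K : comNzRingType) (w : K) : K := 2 * w + 1.

(** * Gram matrices of chains *)

Section ChainMatrix.
Variables (K : comNzRingType) (w : K).
Local Notation theta := (theta_of w).

(** The default 0 makes the missing neighbour beyond the last vertex of a chain contribute
    nothing. *)
Definition entry k (x : 'rV[K]_k) (i : nat) : K := oapp (x 0) 0 (insub i).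

Lemma entry_ord k (x : 'rV[K]_k) (i : 'I_k) : entry x i = x 0 i.
Proof. by rewrite /entry valK. Qed.

Lemma entry_row k (f : nat -> K) i : (i < k)%N -> entry (\row_(j < k) f j) i = f i.
Proof. by move=> lti; rewrite /entry insubT /= mxE. Qed.

Lemma entry_out k (x : 'rV[K]_k) i : (k <= i)%N -> entry x i = 0.
Proof. by move=> gei; rewrite /entry insubN // -leqNgt. Qed.

Lemma sum_entry k (x : 'rV[K]_k) m : \sum_(i < k) x 0 i * (i == m :> nat)%:R = entry x m.
Proof.
have [ltm|gem] := ltnP m k.
  rewrite (bigD1 (Ordinal ltm)) //= eqxx mulr1 big1 ?addr0 => [|i neqi].
    by rewrite -entry_ord.
  by rewrite -val_eqE /= in neqi; rewrite (negbTE neqi) mulr0.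
rewrite entry_out // big1 // => i _.
by rewrite ltn_eqF ?mulr0 // (leq_trans (ltn_ord i)).
Qed.

(* The Gram matrix of a chain, divided by theta: a diagonal entry 3 becomes
   3 / theta = - theta, and theta^* / theta = -1. *)
Definition chain_mx k : 'M[K]_k :=
  \matrix_(i, j) ((j == i.+1 :> nat)%:R - (i == j.+1 :> nat)%:R - theta * (i == j)%:R).

Lemma mul_chain_mx k (x : 'rV[K]_k) j :
  (x *m chain_mx k) 0 j =
  (if j : nat is m.+1 then entry x m else 0) - entry x j.+1 - theta * x 0 j.
Proof.
rewrite mxE; under eq_bigr => i _ do rewrite mxE !mulrDr !mulrN.
rewrite !big_split /= !sumrN sum_entry.
congr (_ - _ - _).
  case Dj: (j : nat) => [|m].
    by rewrite big1 // => i _; rewrite mulr0.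
  by rewrite -sum_entry; apply: eq_bigr => i _; rewrite eqSS eq_sym.
under eq_bigr => i _ do rewrite mulrCA.
rewrite -mulr_sumr -entry_ord -sum_entry.
by congr (_ * _).
Qed.

(** The three-term recursion for tridiagonal determinants: [chain_coef n] is the determinant of
    [chain_mx n]. At w = omega the values for n = 0, ..., 5 are 1, - theta, -2, theta, 1, 0. *)
Fixpoint chain_coef n : K :=
  match n with
  | 0 => 1
  | m.+1 => match m with 0 => - theta | p.+1 => chain_coef p - theta * chain_coef m end
  end.

Lemma chain_coefSS n : chain_coef n.+2 = chain_coef n - theta * chain_coef n.+1.
Proof. by []. Qed.

(** Up to the determinant, the last row of the inverse of [chain_mx k]; where the determinant
    vanishes, a generator of the left kernel. *)
Definition chain_row k : 'rV[K]_k := \row_(i < k) chain_coef i.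

Lemma chain_row_mul n :
  chain_row n.+1 *m chain_mx n.+1 = chain_coef n.+1 *: delta_mx 0 ord_max.
Proof.
apply/rowP => j; rewrite mul_chain_mx !mxE eqxx -val_eqE /=.
have [ltj|] := ltnP j n.
  rewrite entry_row // (ltn_eqF ltj) mulr0.
  case: (j : nat) (ltn_ord j) => [|m] ltm /=; first by rewrite mulr1; ring.
  by rewrite entry_row ?(ltnW ltm) //; ring.
rewrite leq_eqVlt ltnNge -ltnS ltn_ord orbF => /eqP <-.
rewrite entry_out // eqxx mulr1 subr0; case: n j => [|n] j /=.
  by rewrite mulr1 sub0r.
by rewrite entry_row.
Qed.

(** Forward substitution: column j of the system x H = a, read as a formula for x_(j+1), starting
    from x_0 = 0. *)
Fixpoint elim_coef (a : nat -> K) n : K :=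
  match n with
  | 0 => 0
  | m.+1 => match m with
    | 0 => - a 0%N
    | p.+1 => elim_coef a p - theta * elim_coef a m - a m
    end
  end.

(** The coefficient of x_(j+1) in column j is -1, so every column but the last can be solved over
    any ring. Hence the cokernel is generated by the last unit vector. *)
Lemma chain_elim n (al : 'rV[K]_n.+1) : exists x be,
  al = x *m chain_mx n.+1 + be *: delta_mx 0 ord_max.
Proof.
pose x : 'rV[K]_n.+1 := \row_(i < n.+1) elim_coef (entry al) i.
exists x, (al 0 ord_max - (x *m chain_mx n.+1) 0 ord_max).
apply/rowP => j; rewrite [RHS]mxE [in X in _ + X]mxE [delta_mx _ _ _ _]mxE eqxx -val_eqE /=.
have [ltj|] := ltnP j n; last first.
  rewrite leq_eqVlt ltnNge -ltnS ltn_ord orbF => /eqP Dj.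
  have -> : j = ord_max by apply: val_inj.
  by rewrite eqxx mulr1 mul_chain_mx addrC subrK.
rewrite (ltn_eqF ltj) mulr0 addr0 mul_chain_mx /x !mxE entry_row // -entry_ord.
case: (j : nat) (ltn_ord j) => [|m] ltm /=; first by ring.
by rewrite entry_row ?(ltnW ltm) //; ring.
Qed.

(** The recursion behind [chain_elim], now homogeneous: the first entry of x determines all the
    others. *)
Lemma chain_mx_ker n (x : 'rV[K]_n.+1) be :
  x *m chain_mx n.+1 = be *: delta_mx 0 ord_max ->
  x = x 0 0 *: chain_row n.+1 /\ be = x 0 0 * chain_coef n.+1.
Proof.
move=> eqx; have Dx : forall i, (i <= n)%N -> entry x i = x 0 0 * chain_coef i.
  suff: forall m, (m <= n)%N -> forall i, (i <= m)%N -> entry x i = x 0 0 * chain_coef i.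
    by move=> H i lei; apply: (H i).
  elim=> [|m IHm] ltm i lei.
    by move: lei; rewrite leqn0 => /eqP ->; rewrite mulr1 -entry_ord.
  move: lei; rewrite leq_eqVlt ltnS => /orP[/eqP->|]; last by apply: IHm => //; exact: ltnW.
  pose j : 'I_n.+1 := Ordinal (ltnW ltm : (m < n.+1)%N).
  have /rowP/(_ j) := eqx; rewrite mul_chain_mx !mxE eqxx -val_eqE (ltn_eqF ltm) mulr0 /=.
  rewrite -entry_ord /= (IHm (ltnW ltm) m (leqnn m)).
  move/(canRL (subrK _))/(canRL (subKr _))->; rewrite add0r.
  case: m ltm j IHm => [|m] ltm j IHm /=; first by ring.
  by rewrite (IHm (ltnW ltm) m (leqnSn m)); ring.
have{}Dx : x = x 0 0 *: chain_row n.+1.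
  by apply/rowP=> j; rewrite -entry_ord Dx ?mxE // -ltnS.
split=> //; move: eqx; rewrite {1}Dx -scalemxAl chain_row_mul scalerA.
by move/rowP/(_ ord_max); rewrite !mxE !eqxx !mulr1.
Qed.

(** The reflection in the i-th chain root on rows of coordinates. The factor w^2 is (w - 1) theta /
    3: theta restores the form from its quotient by theta, and 3 is the norm of the root. *)
Definition triflection_mx k (i : 'I_k) : 'M[K]_k :=
  1%:M + w ^+ 2 *: (chain_mx k *m delta_mx i i).

Lemma mul_triflection_mx k (i : 'I_k) (x : 'rV[K]_k) :
  x *m triflection_mx i = x + (w ^+ 2 * (x *m chain_mx k) 0 i) *: delta_mx 0 i.
Proof.
rewrite mulmxDr mulmx1 -scalemxAr mulmxA -scalerA; congr (_ + _ *: _).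
by rewrite -(mul_delta_mx (0 : 'I_1)) mulmxA -colE [col i _]mx11_scalar mul_scalar_mx mxE.
Qed.
End ChainMatrix.

Lemma chain_mx_unit (K : fieldType) (w : K) n :
  chain_coef w n.+1 != 0 -> chain_mx w n.+1 \in unitmx.
Proof.
move=> nz; rewrite -row_free_unit; apply: inj_row_free => v.
move=> v0; have [Dv /esym/eqP] := chain_mx_ker (etrans v0 (esym (scale0r _))).
by rewrite mulf_eq0 (negbTE nz) orbF => /eqP v00; rewrite Dv v00 scale0r.
Qed.

Section MapChain.
Variables (K1 K2 : comNzRingType) (f : {rmorphism K1 -> K2}).

Lemma map_theta w : f (theta_of w) = theta_of (f w).
Proof. by rewrite rmorphD rmorphM rmorph1 rmorph_nat. Qed.

Lemma map_chain_coef w n : f (chain_coef w n) = chain_coef (f w) n.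
Proof.
suff: f (chain_coef w n) = chain_coef (f w) n /\
      f (chain_coef w n.+1) = chain_coef (f w) n.+1 by case.
elim: n => [|n [IH1 IH2]]; first by rewrite /= rmorph1 rmorphN map_theta.
by split=> //; rewrite !chain_coefSS rmorphB rmorphM IH1 IH2 map_theta.
Qed.

Lemma map_chain_mx w k : map_mx f (chain_mx w k) = chain_mx (f w) k.
Proof.
apply/matrixP=> i j.
by rewrite !mxE !rmorphB rmorphM map_theta !rmorph_nat.
Qed.

Lemma map_triflection_mx w k (i : 'I_k) :
  map_mx f (triflection_mx w i) = triflection_mx (f w) i.
Proof.
by rewrite map_mxD map_mx1 map_mxZ map_mxM map_chain_mx map_delta_mx rmorphXn.
Qed.
End MapChain.

Section TriflectionIsometry.
Variables (K : comNzRingType) (w : K) (k : nat).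
Hypothesis w_root : cube_root_eq w.
Local Notation H := (chain_mx w k).

Lemma cube_root_expr3 : w ^+ 3 = 1.
Proof.
apply/eqP; rewrite -subr_eq0; apply/eqP.
by transitivity ((w - 1) * (w ^+ 2 + w + 1)); [ring | rewrite w_root mulr0].
Qed.

Lemma cube_root_sqr : w ^+ 2 = - (w + 1).
Proof. by apply/eqP; rewrite -addr_eq0 addrA w_root. Qed.

Lemma delta_chain_delta (i : 'I_k) :
  delta_mx i i *m (H *m delta_mx i i) = - theta_of w *: delta_mx i i.
Proof.
rewrite -(mul_delta_mx (0 : 'I_1) i i) -!mulmxA (mulmxA H) -colE.
rewrite (mulmxA (delta_mx 0 i)) -rowE [row i _]mx11_scalar mul_scalar_mx -scalemxAr.
congr (_ *: _); by rewrite !mxE eqxx mulr1 subrr sub0r.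
Qed.

(** The right factor is the inverse triflection, since (w^2 - 1) theta / 3 = - w. *)
Lemma triflection_mxK (i : 'I_k) :
  triflection_mx w i *m (1%:M - w *: (H *m delta_mx i i)) = 1%:M.
Proof.
rewrite mulmxBr mulmx1 -scalemxAr mulmxDl mul1mx -scalemxAl -mulmxA delta_chain_delta.
rewrite -scalemxAr -[RHS]addr0 -[LHS]addrA; congr (_ + _).
rewrite [_ *: (- _ *: _)]scalerA -{2}[H *m _]scale1r -scalerDl scalerA -scalerBl.
rewrite (_ : _ - _ = 0) ?scale0r // /theta_of.
transitivity (w ^+ 2 + w + 1 + (w ^+ 3 - 1) * (2 * w + 1)); first by ring.
by rewrite w_root cube_root_expr3 subrr mul0r addr0.
Qed.

Section Conj.
Variable c : {rmorphism K -> K}.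
Hypothesis cw : c w = w ^+ 2.

Lemma conj_theta : c (theta_of w) = - theta_of w.
Proof.
by rewrite /theta_of rmorphD rmorphM rmorph1 rmorph_nat cw cube_root_sqr; ring.
Qed.

Lemma conj_chain_mx : (map_mx c H)^T = - H.
Proof.
apply/matrixP=> i j; rewrite !mxE !rmorphB rmorphM !rmorph_nat conj_theta [j == i]eq_sym.
by ring.
Qed.

Lemma triflection_unitary (i : 'I_k) :
  triflection_mx w i *m H *m (map_mx c (triflection_mx w i))^T = H.
Proof.
rewrite map_mxD map_mx1 map_mxZ map_mxM map_delta_mx linearD linearZ /= trmx_mul.
rewrite conj_chain_mx trmx1 trmx_delta rmorphXn cw mulmxN scalerN.
have -> : (w ^+ 2) ^+ 2 = w by rewrite -exprM (exprD w 3 1) cube_root_expr3 mul1r.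
rewrite mulmxBr mulmx1 -scalemxAr mulmxDl mul1mx -scalemxAl.
set E := delta_mx i i; rewrite -[LHS]addrA -[RHS]addr0; congr (_ + _).
rewrite mulmxDl -scalemxAl -!mulmxA.
have -> : E *m (H *m (E *m H)) = - theta_of w *: (E *m H).
  by rewrite (mulmxA H) mulmxA delta_chain_delta -scalemxAl.
rewrite -scalemxAr scalerA -{2}[H *m _]scale1r -scalerDl scalerA -scalerBl.
rewrite (_ : _ - _ = 0) ?scale0r // /theta_of.
transitivity (w ^+ 2 + w + 1 + (w ^+ 3 - 1) * (2 * w + 1)); first by ring.
by rewrite w_root cube_root_expr3 subrr mul0r addr0.
Qed.
End Conj.
End TriflectionIsometry.

(** * Isometries over F_3 *)

(* Vectors of F_3^k as lists of representatives 0, 1, 2.  The letters i < k are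
   the reductions of the triflections in the chain roots, any other letter is -1. *)
Definition letter_act k l (s : seq nat) : seq nat :=
  mkseq (fun j =>
    if (l < k)%N then
      if j == l then (nth 0 s j + nth 0 (0 :: s) j + 2 * nth 0 s j.+1) %% 3 else nth 0 s j
    else (2 * nth 0 s j) %% 3)%N k.

(** Minus column i of the product of s with the chain matrix at w = 1. The factor 2 stands for -1,
    and [nth 0 (0 :: s) i] is the entry before i, which is 0 for i = 0. *)
Definition gram_coef (s : seq nat) i : nat :=
  ((nth 0 s i.+1 + 2 * nth 0 (0 :: s) i) %% 3)%N.

(* Necessary conditions for s to be row j of an isometry that fixes the rows
   before j: Gram relations with those rows, independence of them, and, unless
   j is the last row, not being in the radical. *)
Definition row_condition k j (s : seq nat) : bool :=
  [&& all (fun i => gram_coef s i == (j == i.+1)) (iota 0 j),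
      has (fun m => nth 0 s m != 0)%N (iota j (k - j))
    & (j.+1 < k)%N ==> has (fun m => gram_coef s m != 0)%N (iota 0 k)].

Fixpoint all_vectors k : seq (seq nat) :=
  if k is m.+1 then [seq x :: s | x <- iota 0 3, s <- all_vectors m] else [:: [::]].

Definition unit_vector k j : seq nat := mkseq (fun i => nat_of_bool (i == j)) k.

Definition stage_ok k j (tab : seq (seq nat * seq nat)) : bool :=
  all (fun s => row_condition k j s ==> has (fun sw => sw.1 == s) tab) (all_vectors k)
  && all (fun sw =>
       [&& sw.1 \in all_vectors k,
           foldl (fun s l => letter_act k l s) sw.1 sw.2 == unit_vector k j
         & all (fun i => foldl (fun s l => letter_act k l s) (unit_vector k i) sw.2
                         == unit_vector k i) (iota 0 j)]) tab.

(* For each j, the vectors that row j can be once the rows before j are fixed,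
   each with a word that fixes those rows and moves it to the unit vector e_j. *)
Definition schreier_table k : seq (seq (seq nat * seq nat)) :=
  match k with
  | 1 => [::
      [:: ([:: 1], [::]); ([:: 2], [:: 4])]]
  | 2 => [::
      [:: ([:: 1; 0], [::]); ([:: 1; 2], [:: 1]); ([:: 0; 2], [:: 0; 1]); ([:: 1; 1], [:: 1;
        1]); ([:: 2; 2], [:: 0; 0; 1]); ([:: 2; 1], [:: 0; 1; 1]); ([:: 0; 1], [:: 0; 0; 1; 1]);
        ([:: 2; 0], [:: 1; 0; 0; 1])];
      [:: ([:: 0; 1], [::]); ([:: 1; 1], [:: 0]); ([:: 2; 1], [:: 0; 0])]]
  | 3 => [::
      [:: ([:: 1; 0; 0], [::]); ([:: 1; 2; 0], [:: 1]); ([:: 2; 0; 0], [:: 4]); ([:: 0; 2; 0],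
        [:: 0; 1]); ([:: 1; 1; 0], [:: 1; 1]); ([:: 2; 1; 0], [:: 1; 4]); ([:: 1; 2; 1], [:: 2;
        1]); ([:: 2; 2; 0], [:: 0; 0; 1]); ([:: 0; 1; 0], [:: 0; 1; 4]); ([:: 0; 2; 1], [:: 0;
        2; 1]); ([:: 1; 1; 2], [:: 2; 1; 1]); ([:: 2; 1; 2], [:: 2; 1; 4]); ([:: 1; 2; 2], [::
        2; 2; 1]); ([:: 2; 2; 1], [:: 0; 0; 2; 1]); ([:: 0; 1; 2], [:: 0; 2; 1; 4]); ([:: 0; 2;
        2], [:: 0; 2; 2; 1]); ([:: 0; 0; 1], [:: 1; 0; 2; 1]); ([:: 1; 0; 2], [:: 1; 2; 2; 1]);
        ([:: 1; 1; 1], [:: 2; 2; 1; 1]); ([:: 2; 1; 1], [:: 2; 2; 1; 4]); ([:: 2; 2; 2], [:: 0;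
        0; 2; 2; 1]); ([:: 0; 1; 1], [:: 0; 2; 2; 1; 4]); ([:: 0; 0; 2], [:: 1; 0; 2; 1; 4]);
        ([:: 2; 0; 1], [:: 1; 2; 2; 1; 4])];
      [:: ([:: 0; 1; 0], [::]); ([:: 1; 1; 0], [:: 0]); ([:: 0; 1; 2], [:: 2]); ([:: 2; 1; 0],
        [:: 0; 0]); ([:: 1; 1; 2], [:: 0; 2]); ([:: 0; 1; 1], [:: 2; 2]); ([:: 2; 1; 2], [:: 0;
        0; 2]); ([:: 1; 1; 1], [:: 0; 2; 2]); ([:: 2; 1; 1], [:: 0; 0; 2; 2])];
      [:: ([:: 0; 0; 1], [::]); ([:: 1; 0; 2], [:: 0; 0; 1; 0; 0; 1; 4])]]
  | 4 => [::
      [:: ([:: 1; 0; 0; 0], [::]); ([:: 1; 2; 0; 0], [:: 1]); ([:: 0; 2; 0; 0], [:: 0; 1]); ([::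
        1; 1; 0; 0], [:: 1; 1]); ([:: 1; 2; 1; 0], [:: 2; 1]); ([:: 2; 2; 0; 0], [:: 0; 0; 1]);
        ([:: 2; 1; 0; 0], [:: 0; 1; 1]); ([:: 0; 2; 1; 0], [:: 0; 2; 1]); ([:: 1; 1; 2; 0], [::
        2; 1; 1]); ([:: 1; 2; 2; 0], [:: 2; 2; 1]); ([:: 1; 2; 1; 2], [:: 3; 2; 1]); ([:: 0; 1;
        0; 0], [:: 0; 0; 1; 1]); ([:: 2; 2; 1; 0], [:: 0; 0; 2; 1]); ([:: 2; 1; 2; 0], [:: 0; 2;
        1; 1]); ([:: 0; 2; 2; 0], [:: 0; 2; 2; 1]); ([:: 0; 2; 1; 2], [:: 0; 3; 2; 1]); ([:: 2;
        0; 0; 0], [:: 1; 0; 0; 1]); ([:: 0; 0; 1; 0], [:: 1; 0; 2; 1]); ([:: 1; 0; 2; 0], [:: 1;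
        2; 2; 1]); ([:: 1; 1; 1; 0], [:: 2; 2; 1; 1]); ([:: 1; 1; 2; 1], [:: 3; 2; 1; 1]); ([::
        1; 2; 2; 1], [:: 3; 2; 2; 1]); ([:: 1; 2; 1; 1], [:: 3; 3; 2; 1]); ([:: 0; 1; 2; 0], [::
        0; 0; 2; 1; 1]); ([:: 2; 2; 2; 0], [:: 0; 0; 2; 2; 1]); ([:: 2; 2; 1; 2], [:: 0; 0; 3;
        2; 1]); ([:: 2; 1; 1; 0], [:: 0; 2; 2; 1; 1]); ([:: 2; 1; 2; 1], [:: 0; 3; 2; 1; 1]);
        ([:: 0; 2; 2; 1], [:: 0; 3; 2; 2; 1]); ([:: 0; 2; 1; 1], [:: 0; 3; 3; 2; 1]); ([:: 0; 0;
        1; 2], [:: 1; 0; 3; 2; 1]); ([:: 0; 1; 1; 0], [:: 1; 1; 0; 2; 1]); ([:: 1; 0; 2; 1], [::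
        1; 3; 2; 2; 1]); ([:: 1; 2; 0; 1], [:: 2; 3; 3; 2; 1]); ([:: 1; 1; 1; 2], [:: 3; 2; 2;
        1; 1]); ([:: 1; 1; 2; 2], [:: 3; 3; 2; 1; 1]); ([:: 1; 2; 2; 2], [:: 3; 3; 2; 2; 1]);
        ([:: 0; 1; 2; 1], [:: 0; 0; 3; 2; 1; 1]); ([:: 2; 2; 2; 1], [:: 0; 0; 3; 2; 2; 1]); ([::
        2; 2; 1; 1], [:: 0; 0; 3; 3; 2; 1]); ([:: 0; 2; 0; 1], [:: 0; 2; 3; 3; 2; 1]); ([:: 2;
        1; 1; 2], [:: 0; 3; 2; 2; 1; 1]); ([:: 2; 1; 2; 2], [:: 0; 3; 3; 2; 1; 1]); ([:: 0; 2;
        2; 2], [:: 0; 3; 3; 2; 2; 1]); ([:: 0; 0; 2; 0], [:: 1; 0; 0; 2; 1; 1]); ([:: 2; 0; 1;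
        0], [:: 1; 0; 2; 2; 1; 1]); ([:: 0; 0; 1; 1], [:: 1; 0; 3; 3; 2; 1]); ([:: 0; 1; 1; 2],
        [:: 1; 1; 0; 3; 2; 1]); ([:: 1; 1; 0; 1], [:: 1; 2; 3; 3; 2; 1]); ([:: 1; 0; 2; 2], [::
        1; 3; 3; 2; 2; 1]); ([:: 0; 0; 0; 2], [:: 2; 1; 0; 3; 2; 1]); ([:: 1; 0; 0; 1], [:: 2;
        1; 3; 2; 2; 1]); ([:: 1; 1; 0; 2], [:: 2; 3; 3; 2; 1; 1]); ([:: 1; 1; 1; 1], [:: 3; 3;
        2; 2; 1; 1]); ([:: 2; 2; 0; 1], [:: 0; 0; 2; 3; 3; 2; 1]); ([:: 0; 1; 2; 2], [:: 0; 0;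
        3; 3; 2; 1; 1]); ([:: 2; 2; 2; 2], [:: 0; 0; 3; 3; 2; 2; 1]); ([:: 2; 1; 0; 1], [:: 0;
        1; 2; 3; 3; 2; 1]); ([:: 2; 1; 0; 2], [:: 0; 2; 3; 3; 2; 1; 1]); ([:: 2; 1; 1; 1], [::
        0; 3; 3; 2; 2; 1; 1]); ([:: 0; 0; 2; 1], [:: 1; 0; 0; 3; 2; 1; 1]); ([:: 2; 0; 1; 2],
        [:: 1; 0; 3; 2; 2; 1; 1]); ([:: 0; 1; 1; 1], [:: 1; 1; 0; 3; 3; 2; 1]); ([:: 1; 0; 0;
        2], [:: 1; 2; 3; 3; 2; 1; 1]); ([:: 1; 0; 1; 2], [:: 2; 1; 3; 3; 2; 2; 1]); ([:: 0; 0;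
        2; 2], [:: 2; 2; 1; 0; 3; 2; 1]); ([:: 1; 0; 1; 1], [:: 2; 2; 1; 3; 2; 2; 1]); ([:: 0;
        1; 0; 1], [:: 0; 0; 1; 2; 3; 3; 2; 1]); ([:: 0; 1; 0; 2], [:: 0; 0; 2; 3; 3; 2; 1; 1]);
        ([:: 2; 0; 0; 1], [:: 1; 0; 0; 2; 3; 3; 2; 1]); ([:: 2; 2; 0; 2], [:: 1; 0; 2; 3; 3; 2;
        1; 1]); ([:: 2; 0; 1; 1], [:: 1; 0; 3; 3; 2; 2; 1; 1]); ([:: 1; 2; 0; 2], [:: 1; 1; 2;
        3; 3; 2; 1; 1]); ([:: 0; 0; 0; 1], [:: 2; 1; 0; 0; 3; 2; 1; 1]); ([:: 2; 0; 0; 2], [::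
        2; 1; 0; 3; 2; 2; 1; 1]); ([:: 1; 0; 1; 0], [:: 3; 2; 2; 1; 3; 2; 2; 1]); ([:: 0; 2; 0;
        2], [:: 0; 1; 1; 2; 3; 3; 2; 1; 1]); ([:: 2; 0; 2; 1], [:: 2; 1; 0; 3; 3; 2; 2; 1; 1]);
        ([:: 2; 0; 2; 2], [:: 2; 2; 1; 0; 3; 2; 2; 1; 1]); ([:: 2; 0; 2; 0], [:: 3; 2; 2; 1; 0;
        3; 2; 2; 1; 1])];
      [:: ([:: 0; 1; 0; 0], [::]); ([:: 1; 1; 0; 0], [:: 0]); ([:: 0; 1; 2; 0], [:: 2]); ([:: 2;
        1; 0; 0], [:: 0; 0]); ([:: 1; 1; 2; 0], [:: 0; 2]); ([:: 0; 1; 1; 0], [:: 2; 2]); ([::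
        0; 1; 2; 1], [:: 3; 2]); ([:: 2; 1; 2; 0], [:: 0; 0; 2]); ([:: 1; 1; 1; 0], [:: 0; 2;
        2]); ([:: 1; 1; 2; 1], [:: 0; 3; 2]); ([:: 0; 1; 1; 2], [:: 3; 2; 2]); ([:: 0; 1; 2; 2],
        [:: 3; 3; 2]); ([:: 2; 1; 1; 0], [:: 0; 0; 2; 2]); ([:: 2; 1; 2; 1], [:: 0; 0; 3; 2]);
        ([:: 1; 1; 1; 2], [:: 0; 3; 2; 2]); ([:: 1; 1; 2; 2], [:: 0; 3; 3; 2]); ([:: 0; 1; 0;
        2], [:: 2; 3; 3; 2]); ([:: 0; 1; 1; 1], [:: 3; 3; 2; 2]); ([:: 2; 1; 1; 2], [:: 0; 0; 3;
        2; 2]); ([:: 2; 1; 2; 2], [:: 0; 0; 3; 3; 2]); ([:: 1; 1; 0; 2], [:: 0; 2; 3; 3; 2]);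
        ([:: 1; 1; 1; 1], [:: 0; 3; 3; 2; 2]); ([:: 2; 1; 0; 2], [:: 0; 0; 2; 3; 3; 2]); ([:: 2;
        1; 1; 1], [:: 0; 0; 3; 3; 2; 2]); ([:: 1; 1; 0; 1], [:: 1; 0; 0; 1; 2; 2; 1; 0; 0; 1; 3;
        2]); ([:: 2; 1; 0; 1], [:: 1; 0; 0; 1; 2; 3; 3; 2; 1; 0; 0; 1]); ([:: 0; 1; 0; 1], [::
        1; 0; 2; 1; 1; 0; 2; 1; 3; 3; 2; 2])];
      [:: ([:: 0; 0; 1; 0], [::]); ([:: 0; 0; 1; 2], [:: 3]); ([:: 0; 0; 1; 1], [:: 3; 3]); ([::
        1; 0; 2; 1], [:: 2; 1; 0; 3; 2; 1; 1; 0; 2; 1; 3; 2]); ([:: 1; 0; 2; 2], [:: 0; 0; 1; 0;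
        0; 1; 2; 1; 0; 0; 1; 2; 3]); ([:: 2; 0; 0; 2], [:: 0; 0; 1; 2; 2; 1; 0; 0; 1; 2; 2; 1;
        3]); ([:: 2; 0; 0; 1], [:: 0; 0; 1; 0; 0; 1; 2; 1; 0; 0; 1; 2; 3; 3]); ([:: 1; 0; 2; 0],
        [:: 0; 0; 1; 0; 0; 1; 3; 2; 1; 0; 0; 1; 2; 3])];
      [:: ([:: 0; 0; 0; 1], [::]); ([:: 2; 0; 2; 1], [:: 0; 0; 1; 0; 0; 1; 2; 1; 0; 0; 1; 2]);
        ([:: 1; 0; 1; 1], [:: 0; 0; 1; 2; 2; 1; 0; 0; 1; 2; 2; 1])]]
  | _ => [::]
  end.

(** A finite evaluation: every vector of F_3^k that meets the necessary conditions occurs in the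
    table, and every word of the table acts as required. *)
Lemma schreier_table_ok k j :
  (0 < k <= 4)%N -> (j < k)%N -> stage_ok k j (nth [::] (schreier_table k) j).
Proof. by case: k => [|[|[|[|[|k]]]]] //; case: j => [|[|[|[|j]]]]. Qed.

Section Letters.
Variables (K : comNzRingType) (k : nat).
Hypothesis char3 : 3%:R = 0 :> K.

Lemma cube_root1 : cube_root_eq (1 : K).
Proof. by rewrite /cube_root_eq -[RHS]char3; ring. Qed.

Lemma natr_mod3 n : (n %% 3)%N%:R = n%:R :> K.
Proof. by rewrite {2}(divn_eq n 3) natrD natrM char3 mulr0 add0r. Qed.

Lemma two_char3 : 2%:R = -1 :> K.
Proof. by apply/eqP; rewrite -addr_eq0 natr1 char3. Qed.

Lemma theta1 : theta_of (1 : K) = 0.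
Proof. by rewrite -[RHS]char3 /theta_of; ring. Qed.

Definition list_row (s : seq nat) : 'rV[K]_k := \row_(j < k) (nth 0%N s j)%:R.

Definition letter_mx l : 'M[K]_k := oapp (fun i : 'I_k => triflection_mx 1 i) (- 1%:M) (insub l).

Definition word_mx (ls : seq nat) : 'M[K]_k := foldr (fun l => mulmx (letter_mx l)) 1%:M ls.

Lemma word_mx_cat ls ls' : word_mx (ls ++ ls') = word_mx ls *m word_mx ls'.
Proof. by elim: ls => [|l ls IH] /=; rewrite ?mul1mx // IH mulmxA. Qed.

Lemma entry_list_row s j : size s = k -> entry (list_row s) j = (nth 0%N s j)%:R.
Proof.
move=> sz; have [ltj|gej] := ltnP j k; first by rewrite [LHS](entry_row (fun j => (nth 0%N s j)%:R)).
by rewrite entry_out // nth_default // sz.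
Qed.

Lemma list_row_chain s j : size s = k ->
  (list_row s *m chain_mx 1 k) 0 j = - (gram_coef s j)%:R.
Proof.
move=> sz; rewrite mul_chain_mx theta1 mul0r subr0 /gram_coef natr_mod3 natrD natrM.
rewrite (entry_list_row _ sz).
rewrite two_char3.
rewrite mulN1r opprD opprK addrC; congr (_ + _).
by case: (j : nat) => // m; rewrite (entry_list_row _ sz).
Qed.

Lemma size_letter_act l s : size (letter_act k l s) = k.
Proof. exact: size_mkseq. Qed.

Lemma list_row_letter_act l s : size s = k ->
  list_row (letter_act k l s) = list_row s *m letter_mx l.
Proof.
move=> sz; rewrite /letter_mx /letter_act; case: (ltnP l k) => [ltl|gel].
  rewrite insubT /= mul_triflection_mx expr1n mul1r; apply/rowP => j.
  rewrite mxE nth_mkseq // [RHS]mxE [in RHS]mxE [X in _ + X]mxE.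
  rewrite [delta_mx _ _ _ _]mxE eqxx list_row_chain //= -val_eqE /=.
  case: eqP => [->|_]; last by rewrite mulr0 addr0.
  rewrite mulr1 /gram_coef !natr_mod3 !natrD.
  apply/eqP; rewrite -subr_eq0; apply/eqP.
  set x := nth _ _ _; set y := nth _ _ _; set z := nth _ _ _.
  by transitivity (3%:R * (y%:R + z%:R) : K); [ring | rewrite char3 mul0r].
rewrite insubF ?ltnNge ?gel //= mulmxN mulmx1; apply/rowP => j.
rewrite mxE nth_mkseq // !mxE natr_mod3 natrM.
rewrite two_char3.
by rewrite mulN1r.
Qed.

Lemma list_row_word ls s : size s = k ->
  list_row (foldl (fun s l => letter_act k l s) s ls) = list_row s *m word_mx ls.
Proof.
elim: ls s => [|l ls IH] s sz /=; first by rewrite mulmx1.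
by rewrite IH ?size_letter_act // list_row_letter_act // mulmxA.
Qed.

(** The reduction of unitarity modulo theta: conjugation becomes trivial, so the conjugate transpose
    becomes the transpose, and the chain matrix at w = 1 is alternating because theta vanishes. *)
Definition isometry3 (g : 'M[K]_k) := g *m chain_mx 1 k *m g^T = chain_mx 1 k.

Lemma isometry3M g g' : isometry3 g -> isometry3 g' -> isometry3 (g *m g').
Proof.
move=> gH g'H; rewrite /isometry3 trmx_mul -!mulmxA (mulmxA (chain_mx _ _)).
by rewrite (mulmxA g') (mulmxA g') g'H mulmxA.
Qed.

Lemma letter_mx_isometry l : isometry3 (letter_mx l).
Proof.
rewrite /isometry3 /letter_mx; case: insubP => [i _ _|_] /=.
  have := triflection_unitary cube_root1 (c := idfun) _ i.
  by rewrite map_mx_id // => -> //; rewrite expr1n.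
by rewrite mulNmx mul1mx [(- _)^T]linearN /= trmx1 mulmxN mulmx1 opprK.
Qed.

Lemma letter_mx_rinv l : exists g, letter_mx l *m g = 1%:M.
Proof.
rewrite /letter_mx; case: insubP => [i _ _|_] /=.
  by eexists; apply/triflection_mxK/cube_root1.
by exists (- 1%:M); rewrite mulmxN mulmx1 opprK.
Qed.
End Letters.

Lemma char_F3 : 3%:R = 0 :> 'F_3. Proof. exact: pchar_Zp. Qed.

Section IsometryWords.
Variable k : nat.
Hypothesis k_range : (0 < k <= 4)%N.
Local Notation H := (chain_mx (1 : 'F_3) k).

Definition row_list (v : 'rV['F_3]_k) : seq nat := [seq (v 0 i : nat) | i <- enum 'I_k].

Lemma size_row_list v : size (row_list v) = k.
Proof. by rewrite size_map size_enum_ord. Qed.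

Lemma nth_row_list v (i : 'I_k) : nth 0%N (row_list v) i = v 0 i.
Proof. by rewrite (nth_map i) ?size_enum_ord // nth_ord_enum. Qed.

Lemma row_listK v : list_row _ k (row_list v) = v.
Proof. by apply/rowP => i; rewrite mxE nth_row_list natr_Zp. Qed.

Lemma mem_all_vectors (s : seq nat) : all (fun x => x < 3)%N s -> s \in all_vectors (size s).
Proof.
elim: s => [|x s IH] // /andP[ltx alls].
change (x :: s \in [seq y :: t | y <- iota 0 3, t <- all_vectors (size s)]).
by apply/allpairsP; exists (x, s); rewrite mem_iota ltx IH.
Qed.

Lemma row_list_all_vectors v : row_list v \in all_vectors k.
Proof.
have := @mem_all_vectors (row_list v); rewrite size_row_list; apply; apply/allP => x /mapP[i _ ->].
exact: ltn_ord.
Qed.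

Lemma all_vectorsP s : s \in all_vectors k -> size s = k /\ row_list (list_row 'F_3 k s) = s.
Proof.
have mem_all n : {subset all_vectors n <= [pred s | (size s == n) && all (fun x => x < 3)%N s]}.
  elim: n => [|n IH] s'; first by rewrite mem_seq1 => /eqP->.
  change (s' \in [seq y :: t | y <- iota 0 3, t <- all_vectors n] ->
    s' \in [pred s | (size s == n.+1) && all (fun x => x < 3)%N s]).
  case/allpairsP => -[x s1] [x3 /IH]; rewrite mem_iota in x3; rewrite inE => /andP[/eqP sz s3] ->.
  by rewrite inE /= sz eqxx s3 andbT.
move/mem_all; rewrite inE => /andP[/eqP sz /allP s3]; split=> //.
apply: (@eq_from_nth _ 0%N); rewrite ?size_row_list // => i lti.
rewrite (nth_row_list _ (Ordinal lti)) mxE val_Fp_nat // modn_small //.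
by apply/s3/mem_nth; rewrite sz.
Qed.

Lemma unit_vectorE (j : 'I_k) : list_row 'F_3 k (unit_vector k j) = delta_mx 0 j.
Proof. by apply/rowP => i; rewrite !mxE nth_mkseq // eqxx -val_eqE /=; case: (_ == _). Qed.

Lemma row_condition_isometry (g : 'M['F_3]_k) (j : 'I_k) :
    isometry3 g -> (exists g', g *m g' = 1%:M) ->
    (forall i : 'I_k, (i < j)%N -> row i g = delta_mx 0 i) ->
  row_condition k j (row_list (row j g)).
Proof.
move=> gH [g' gg'] fix_g; set s := row_list _.
have sz : size s = k by apply: size_row_list.
have Ds : list_row 'F_3 k s = row j g by apply: row_listK.
have gram i : (gram_coef s i < 3)%N by rewrite ltn_mod.
have gramE i : (row j g *m H) 0 i = - (gram_coef s i)%:R.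
  by rewrite -Ds list_row_chain // char_F3.
have Hij a b : (row a g *m H *m (row b g)^T) 0 0 = H a b.
  rewrite -[in RHS]gH tr_row -row_mul [LHS]mxE [RHS]mxE.
  by apply: eq_bigr => i _; rewrite ![row _ _ _ _]mxE ![col _ _ _ _]mxE.
apply/and3P; split.
- apply/allP => i; rewrite mem_iota /= add0n => lti.
  have ltik : (i < k)%N by apply: ltn_trans lti (ltn_ord j).
  have := Hij j (Ordinal ltik); rewrite (fix_g (Ordinal ltik)) //= trmx_delta -colE mxE gramE /=.
  rewrite mxE /= (theta1 char_F3) mul0r subr0 (ltn_eqF (leqW lti)) sub0r => /oppr_inj/eqP.
  by move: (gram i); case: (gram_coef s i) => [|[|[|]]] //; case: (nat_of_ord j == i.+1).
- apply: contraT; rewrite -all_predC => /allP s0.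
  have v0 (m : 'I_k) : (j <= m)%N -> g j m = 0.
    move=> lejm; apply/eqP; have := s0 m; rewrite mem_iota lejm subnKC ?ltn_ord 1?ltnW //=.
    rewrite negbK nth_row_list mxE => /(_ isT) /eqP h.
    by rewrite -[g j m]natr_Zp h.
  (* Here v = row j of g lies in the span of the e_m with m < j, which g fixes pointwise. Since e_j
     g = v as well, invertibility would force e_j = v. *)
  have vg : row j g *m g = row j g.
    rewrite mulmx_sum_row [RHS]row_sum_delta; apply: eq_bigr => m _.
    have [ltm|lem] := ltnP m j; first by rewrite (fix_g m ltm).
    by rewrite mxE v0 // !scale0r.
  have : (delta_mx 0 j - row j g) *m g = 0 by rewrite mulmxBl vg -rowE subrr.
  move/(congr1 (mulmx^~ g')); rewrite -mulmxA gg' mulmx1 mul0mx => /rowP/(_ j)/eqP.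
  by rewrite !mxE !eqxx v0 // subr0 oner_eq0.
(* A row in the radical would have product 0 with row j + 1, whereas consecutive rows have product
   1. *)
- apply/implyP => ltj; apply: contraT; rewrite -all_predC => /allP s0.
  have vH : row j g *m H = 0.
    apply/rowP => i; rewrite gramE mxE; have := s0 i; rewrite mem_iota ltn_ord /= negbK.
    by move=> /(_ isT)/eqP ->; rewrite oppr0.
  have := Hij j (Ordinal ltj); rewrite vH mul0mx !mxE eqxx (theta1 char_F3) mul0r subr0 /=.
  by rewrite (ltn_eqF (leqW (ltnSn j))) subr0 => /eqP; rewrite eq_sym oner_eq0.
Qed.

(** Sifting through the stabiliser chain: once the rows before j are unit vectors, row j meets
    [row_condition], and its tabulated word sends it to e_j without disturbing them. *)
Lemma isometry_word (g : 'M['F_3]_k) : isometry3 g -> (exists g', g *m g' = 1%:M) ->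
  exists ls, g *m word_mx _ k ls = 1%:M.
Proof.
move=> gH gV.
suff [ls fix_ls] : exists ls, forall i : 'I_k, (i < k)%N ->
    row i (g *m word_mx _ k ls) = delta_mx 0 i.
  by exists ls; apply/row_matrixP => i; rewrite fix_ls // rowE mulmx1.
suff: forall n, (n <= k)%N -> exists ls, forall i : 'I_k, (i < n)%N ->
    row i (g *m word_mx _ k ls) = delta_mx 0 i by apply.
elim=> [|j IHj] ltj; first by exists [::].
have [ls fix_ls] := IHj (ltnW ltj); pose o := Ordinal ltj.
have wH ls' : isometry3 (word_mx 'F_3 k ls').
  elim: ls' => [|l ls' IH] /=; first by rewrite /isometry3 trmx1 mul1mx mulmx1.
  by apply: isometry3M IH; exact: letter_mx_isometry char_F3 l.
have wV ls' : exists g', word_mx 'F_3 k ls' *m g' = 1%:M.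
  elim: ls' => [|l ls' [g1 IH]] /=; first by exists 1%:M; rewrite mulmx1.
  have [g2 lg] := letter_mx_rinv k char_F3 l; exists (g1 *m g2).
  by rewrite mulmxA -(mulmxA (letter_mx _ _ _)) IH mulmx1.
set v := row o (g *m word_mx _ k ls).
have cond_v : row_condition k o (row_list v).
  apply: row_condition_isometry => //; first exact: isometry3M.
  have [g1 gg1] := gV; have [g2 wg2] := wV ls; exists (g2 *m g1).
  by rewrite mulmxA -(mulmxA g) wg2 mulmx1.
have /andP[/allP ok1 /allP ok2] := schreier_table_ok k_range ltj.
have /implyP/(_ cond_v)/hasP[[s w] sw_tab /eqP /= Ds] := ok1 _ (row_list_all_vectors v).
have /and3P[/= _ /eqP /= w_s /allP /= w_fix] := ok2 _ sw_tab.
exists (ls ++ w) => i; rewrite word_mx_cat mulmxA ltnS leq_eqVlt => /orP[/eqP Di|lti].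
  have -> : i = o by apply: val_inj.
  rewrite row_mul -/v -[v]row_listK -Ds -(list_row_word char_F3) ?w_s ?(unit_vectorE o) //.
  by rewrite Ds size_row_list.
rewrite row_mul fix_ls // -unit_vectorE -(list_row_word char_F3) ?size_mkseq //.
by rewrite (eqP (w_fix i _)) // mem_iota.
Qed.
End IsometryWords.

Lemma eis_add_re x y : eis_re (x + y) = eis_re x + eis_re y. Proof. by []. Qed.
Lemma eis_opp_re x : eis_re (- x) = - eis_re x. Proof. by []. Qed.

Lemma eis_norm_ge0 x : 0 <= eis_norm x.
Proof.
case: x => a b; rewrite /eis_norm /=.
suff: 0 <= 4%:Z * (a ^+ 2 - a * b + b ^+ 2) by rewrite pmulr_rge0.
have -> : 4%:Z * (a ^+ 2 - a * b + b ^+ 2) = (2 * a - b) ^+ 2 + 3 * b ^+ 2 by ring.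
by apply: addr_ge0; [exact: sqr_ge0 | apply: mulr_ge0 => //; exact: sqr_ge0].
Qed.

Lemma eis_norm_eq0 x : (eis_norm x == 0) = (x == 0).
Proof.
apply/eqP/eqP => [|->] //; case: x => a b; rewrite /eis_norm /= => n0.
have : (2 * a - b) ^+ 2 + 3 * b ^+ 2 == 0.
  by apply/eqP; transitivity (4%:Z * (a ^+ 2 - a * b + b ^+ 2)); [ring | rewrite n0].
rewrite paddr_eq0; [|exact: sqr_ge0|by apply: mulr_ge0 => //; exact: sqr_ge0].
rewrite sqrf_eq0 [3 * _ == 0]mulf_eq0 sqrf_eq0 => /andP[/eqP ab /eqP b0].
by move: ab; rewrite b0 subr0 => /eqP; rewrite mulf_eq0 /= => /eqP ->.
Qed.

Lemma eis_mulf_eq0 (x y : eisint) : x * y = 0 -> y != 0 -> x = 0.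
Proof.
move=> xy0 ny; apply/eqP; rewrite -eis_norm_eq0.
have /eqP := congr1 eis_norm xy0.
by rewrite eis_normM mulf_eq0 eis_norm_eq0 [eis_norm y == 0]eis_norm_eq0 (negbTE ny) orbF.
Qed.

(** * Unitary matrices *)

Section SkewForm.
Variable k : nat.
Local Notation H := (chain_mx omega k).
Local Notation conjm := (map_mx eis_conj).

(** The Hermitian form divided by theta; as theta is purely imaginary, the quotient is
    skew-Hermitian. *)
Definition skew (x y : 'rV[eisint]_k) : eisint := (x *m H *m (conjm y)^T) 0 0.

Lemma skewDl x x' y : skew (x + x') y = skew x y + skew x' y.
Proof. by rewrite /skew !mulmxDl mxE. Qed.
Lemma skewZl a x y : skew (a *: x) y = a * skew x y.
Proof. by rewrite /skew -!scalemxAl mxE. Qed.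
Lemma skewNl x y : skew (- x) y = - skew x y.
Proof. by rewrite /skew !mulNmx mxE. Qed.

Lemma skew_conj x y : eis_conj (skew x y) = - skew y x.
Proof.
have ch : (conjm H)^T = - H by apply: conj_chain_mx.
have -> : eis_conj (skew x y) = ((conjm (x *m H *m (conjm y)^T))^T) 0 0.
  by rewrite [RHS]mxE [RHS]mxE.
rewrite !map_mxM !trmx_mul ch !map_trmx trmxK -map_mx_comp.
have -> : map_mx (eis_conj \o eis_conj) y = y.
  by apply/matrixP=> i j; rewrite mxE /= eis_conjK.
by rewrite mulNmx mulmxN mulmxA mxE /skew map_trmx.
Qed.

Lemma skewDr x y y' : skew x (y + y') = skew x y + skew x y'.
Proof. by apply: (inv_inj eis_conjK); rewrite rmorphD /= !skew_conj skewDl opprD. Qed.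
Lemma skewNr x y : skew x (- y) = - skew x y.
Proof. by apply: (inv_inj eis_conjK); rewrite rmorphN /= !skew_conj skewNl. Qed.
Lemma skewZr a x y : skew x (a *: y) = eis_conj a * skew x y.
Proof. by apply: (inv_inj eis_conjK); rewrite rmorphM /= !skew_conj skewZl eis_conjK mulrN. Qed.

(** Since [skew x x] changes sign under conjugation, it is an integer a times theta. The norm of x
    is then theta^2 a = - 3 a, a third of which is - a. *)
Definition third_norm x : int := - eis_re (skew x x).

Lemma third_normE x : theta_of omega * skew x x = Eisint (3 * third_norm x) 0.
Proof.
rewrite /third_norm; move: (skew_conj x x); case: (skew x x) => a b.
move/(congr1 eis_re); rewrite eis_opp_re /= => h.
rewrite (_ : theta_of omega = Eisint 1 2) //.
change (Eisint (1 * a - 2 * b) (1 * b + 2 * a - 2 * b) = Eisint (3 * - a) 0).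
by congr Eisint; lia.
Qed.

Lemma third_normZ a x : third_norm (a *: x) = eis_norm a * third_norm x.
Proof.
by rewrite /third_norm skewZl skewZr mulrA -eis_normE /=; ring.
Qed.

Lemma third_norm_parallelogram x y :
  third_norm (x + y) + third_norm (x - y) = 2 * third_norm x + 2 * third_norm y.
Proof.
rewrite /third_norm !(skewDl, skewDr, skewNl, skewNr).
by rewrite !(eis_add_re, eis_opp_re); ring.
Qed.

(** The parallelogram law for cube roots of unity: the cross terms cancel because 1 + omega +
    omega^2 = 0. *)
Lemma third_norm_cube_roots x y :
  third_norm (x - y) + third_norm (x - omega *: y) + third_norm (x - omega ^+ 2 *: y)
  = 3 * third_norm x + 3 * third_norm y.
Proof.
rewrite /third_norm !(skewDl, skewDr, skewNl, skewNr, skewZl, skewZr).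
case: (skew x x) (skew x y) (skew y x) (skew y y) => [a b] [c d] [e f] [g h] /=.
by ring.
Qed.

Definition definite := forall x, third_norm x <= 0 -> x = 0.

Definition unitary (X : 'M[eisint]_k) := X *m H *m (conjm X)^T = H.

Lemma unitary1 : unitary 1%:M.
Proof. by rewrite /unitary map_mx1 trmx1 mul1mx mulmx1. Qed.

Lemma unitaryM X Y : unitary X -> unitary Y -> unitary (X *m Y).
Proof.
move=> uX uY; rewrite /unitary map_mxM trmx_mul -!mulmxA (mulmxA H).
by rewrite (mulmxA Y) (mulmxA Y) uY mulmxA.
Qed.

Lemma unitary_scalar a : eis_norm a = 1 -> unitary a%:M.
Proof.
move=> na; rewrite /unitary map_scalar_mx tr_scalar_mx mul_scalar_mx mul_mx_scalar.
by rewrite scalerA mulrC -eis_normE na scale1r.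
Qed.

Lemma unitary_skew X x y : unitary X -> skew (x *m X) (y *m X) = skew x y.
Proof.
move=> uX; rewrite /skew map_mxM trmx_mul -!mulmxA (mulmxA H).
by rewrite (mulmxA X) (mulmxA X) uX.
Qed.

Lemma unitary_rows X : (forall i j, skew (row i X) (row j X) = H i j) -> unitary X.
Proof.
move=> XH; apply/matrixP => i j; rewrite -XH /skew -row_mul [LHS]mxE [RHS]mxE.
by apply: eq_bigr => m _; rewrite !mxE.
Qed.

Lemma skew_delta i j : skew (delta_mx 0 i) (delta_mx 0 j) = H i j.
Proof. by rewrite /skew map_delta_mx trmx_delta -rowE -colE !mxE. Qed.

Lemma unitary_row X i j : unitary X -> skew (row i X) (row j X) = H i j.
Proof. by move=> uX; rewrite !rowE unitary_skew // skew_delta. Qed.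

Lemma third_norm_delta i : third_norm (delta_mx 0 i) = 1.
Proof. by rewrite /third_norm skew_delta !mxE eqxx subrr sub0r. Qed.

Lemma third_norm_row X i : unitary X -> third_norm (row i X) = 1.
Proof. by move=> uX; rewrite rowE /third_norm unitary_skew //; apply: third_norm_delta. Qed.

Hypothesis defH : definite.

(* The difference is divisible by a prime of norm 7, so that its norm, which
   is at most 12, would be a multiple of 21. *)
Lemma third_norm1_congr7 x y z c : eis_norm c = 7 ->
  third_norm x = 1 -> third_norm y = 1 -> x - y = c *: z -> x = y.
Proof.
move=> nc x1 y1 xyz; apply/eqP; rewrite -subr_eq0 xyz.
have := third_norm_parallelogram x y; rewrite x1 y1 xyz third_normZ nc => eq4.
have [/defH ->|z_gt] := lerP (third_norm z) 0; first by rewrite scaler0.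
have [/defH xy0|xy_gt] := lerP (third_norm (x + y)) 0; last by lia.
by move: eq4; rewrite xy0 /third_norm /skew !mul0mx mxE /=; lia.
Qed.

(** The three differences x - omega^m y are all divisible by theta, so their values of [third_norm]
    are multiples of 3. These add up to 6, so not all of them are positive, and definiteness makes
    one difference vanish. *)
Lemma third_norm1_congr_theta x y z :
  third_norm x = 1 -> third_norm y = 1 -> x - y = theta_of omega *: z ->
  exists2 m, x = omega ^+ m *: y & (m < 3)%N.
Proof.
move=> x1 y1 xyz; have := third_norm_cube_roots x y; rewrite x1 y1.
(* Raising m by one adds a multiple of 1 - omega, which is theta omega^2. *)
have congr m : exists t, x - omega ^+ m *: y = theta_of omega *: t.
  elim: m => [|m [t IHm]]; first by exists z; rewrite scale1r.
  exists (t + omega ^+ m *: (omega ^+ 2 *: y)).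
  rewrite scalerDr -IHm !scalerA mulrCA (_ : _ * omega ^+ 2 = 1 - omega) //.
  by rewrite mulrBr mulr1 -exprSr scalerBl addrA subrK.
have mult3 m : exists2 q, third_norm (x - omega ^+ m *: y) = 3 * q
                        & (q <= 0 -> x = omega ^+ m *: y).
  have [t eqt] := congr m; exists (third_norm t); first by rewrite eqt third_normZ.
  by move/defH=> t0; apply/eqP; rewrite -subr_eq0 eqt t0 scaler0.
have [q0 + h0] := mult3 0%N; have [q1 + h1] := mult3 1%N; have [q2 + h2] := mult3 2.
rewrite scale1r expr1 => -> -> -> eq6.
have [/h0 ?|gt0] := lerP q0 0; first by exists 0%N.
have [/h1 ?|gt1] := lerP q1 0; first by exists 1%N.
have [/h2 ?|gt2] := lerP q2 0; first by exists 2%N.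
by exfalso; move: gt0 gt1 gt2 eq6; clear; lia.
Qed.
End SkewForm.

(** * Explicit chains in the standard lattices *)

Definition chain_len t : nat := match t with A2 => 0 | D4 => 1 | E6 => 2 | E8 => 3 end.

(** Each list of rows is a chain of roots that spans the lattice. Longer coordinate vectors apart,
    it grows by one root from type to type; the signs are chosen to make consecutive products equal
    to theta rather than another associate. *)
Definition std_basis_entries t : seq (seq eisint) :=
  let th := theta_of omega in
  match t with
  | A2 => [:: [:: th]]
  | D4 => [:: [:: 0; 0; th]; [:: 1; 1; 1]]
  | E6 => [:: [:: 0; 0; th]; [:: 1; 1; 1]; [:: - th; 0; 0]]
  | E8 => [:: [:: 0; 0; 0; th]; [:: 0; 1; 1; 1]; [:: 0; - th; 0; 0]; [:: -1; -1; 1; 0]]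
  end.

Definition std_basis t : 'M[eisint]_((chain_len t).+1, std_dim t) :=
  \matrix_(i, j) nth 0 (nth [::] (std_basis_entries t) i) j.

Lemma std_basis_gram t :
  std_basis t *m (map_mx eis_conj (std_basis t))^T
  = theta_of omega *: chain_mx omega (chain_len t).+1.
Proof.
by apply/matrixP=> i j; rewrite !mxE; case: t i j => i j;
  rewrite /= !big_ord_recl big_ord0 !mxE /=;
  case: i => [[|[|[|[|]]]]] // lti; case: j => [[|[|[|[|]]]]] // ltj; vm_compute.
Qed.

Lemma chain_coef_neq0 t : chain_coef omega (chain_len t).+1 != 0.
Proof. by case: t. Qed.

Lemma chain_mx_inj t (x : 'rV[eisint]_(chain_len t).+1) :
  x *m chain_mx omega _ = 0 -> x = 0.
Proof.
move=> x0; have [Dx /esym h0] := chain_mx_ker (etrans x0 (esym (scale0r _))).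
by rewrite Dx (eis_mulf_eq0 h0 (chain_coef_neq0 t)) scale0r.
Qed.

(** Definiteness is pulled back from the standard form: three times [third_norm x] is the sum of the
    norms of the coordinates of x in the explicit basis. *)
Lemma std_definite t : definite (chain_len t).+1.
Proof.
move=> x xneg; pose y := x *m std_basis t.
have Dy : theta_of omega * skew x x = \sum_j Eisint (eis_norm (y 0 j)) 0.
  transitivity ((y *m (map_mx eis_conj y)^T) 0 0).
    rewrite /y map_mxM trmx_mul -mulmxA (mulmxA (std_basis t)) std_basis_gram.
    by rewrite -scalemxAl -scalemxAr mulmxA mxE.
  by rewrite mxE; apply: eq_bigr => j _; rewrite !mxE eis_normE.
have sumE (I : finType) (F : I -> int) : \sum_i Eisint (F i) 0 = Eisint (\sum_i F i) 0.
  by apply: (big_ind2 (fun a b => a = Eisint b 0)) => // a b c d -> ->; congr Eisint.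
move: Dy; rewrite third_normE sumE => /(congr1 eis_re) /= Dn.
have : \sum_j eis_norm (y 0 j) == 0.
  by rewrite eq_le sumr_ge0 ?andbT => [|j _]; rewrite ?eis_norm_ge0 // -Dn; lia.
rewrite psumr_eq0 => [/allP y0|j _]; last exact: eis_norm_ge0.
apply: (@chain_mx_inj t); apply/rowP => j; rewrite [RHS]mxE; apply: (@eis_mulf_eq0 _ (theta_of omega)) => //.
have {}y0 : y = 0.
  apply/rowP => i; rewrite [RHS]mxE; apply/eqP; rewrite -eis_norm_eq0.
  by have := y0 i (mem_index_enum i).
have : y *m (map_mx eis_conj (std_basis t))^T = 0 by rewrite y0 mul0mx.
by rewrite -mulmxA std_basis_gram -scalemxAr => /rowP/(_ j); rewrite mxE mulrC => ->; rewrite mxE.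
Qed.

(** * A finite model of the unitary group *)

Lemma GL_mulE (F : finFieldType) n (g g' : {'GL_n[F]}) :
  val (g * g')%g = (val g *m val g') :> 'M_n.-1.+1.
Proof. by []. Qed.

Lemma unitmx_isometry (F : fieldType) n (X H Y : 'M[F]_n) :
  H \in unitmx -> X *m H *m Y = H -> X \in unitmx.
Proof.
move=> uH /(congr1 (mulmx^~ (invmx H))); rewrite mulmxV // -!mulmxA.
by case/mulmx1_unit.
Qed.

(* There are finitely many unitary matrices over eisint, but they do not come as
   a finType; a model is a finGroupType isomorphic to their group. *)
Record unitary_model k := UnitaryModel {
  model_group :> finGroupType;
  model_mx : model_group -> 'M[eisint]_k;
  model_mxM : forall g g', model_mx (g * g')%g = model_mx g *m model_mx g';
  model_mx_inj : injective model_mx;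
  model_mx_unitary : forall g, unitary (model_mx g);
  model_mx_surj : forall X, unitary X -> exists g, model_mx g = X
}.

Lemma cube_root_F7 : cube_root_eq (2 : 'F_7).
Proof. by apply/eqP. Qed.

(* Reduction at the prime 2 - omega of norm 7 is injective on unitary matrices,
   which realises their group inside GL_k(F_7). *)
Definition red7 m n : 'M[eisint]_(m, n) -> 'M['F_7]_(m, n) := map_mx (eis_ev cube_root_F7).

Lemma eis_ev7_eq0 x : eis_ev cube_root_F7 x = 0 -> exists y, x = Eisint 2 (-1) * y.
Proof.
case: x => a b; rewrite /eis_ev /= => ab0.
have: ((a + b * 2)%:~R == 0 :> 'F_7) by rewrite rmorphD rmorphM /= ab0.
rewrite -(dvdz_pcharf (pchar_Fp _)) // => /dvdzP[q Dq].
(* The quotient is x times 3 + omega, the conjugate of 2 - omega, divided by 7. *)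
exists (Eisint (q * 3 - b) q).
change (Eisint a b = Eisint (2 * (q * 3 - b) - -1 * q) (2 * q + -1 * (q * 3 - b) - -1 * q)).
by congr Eisint; lia.
Qed.

Section Host.
Variable t : root_type.
Local Notation k := (chain_len t).+1.

Lemma red7_unitary_inj (X Y : 'M_k) : unitary X -> unitary Y -> red7 X = red7 Y -> X = Y.
Proof.
move=> uX uY rXY; apply/row_matrixP => i.
have [z Dz] : exists z : 'rV_k, row i X - row i Y = Eisint 2 (-1) *: z.
  have /(_ _)/cid Dc : forall j, exists y, X i j - Y i j = Eisint 2 (-1) * y.
    move=> j; apply: eis_ev7_eq0; rewrite rmorphB /=.
    by move/matrixP/(_ i j): rXY; rewrite !mxE => ->; rewrite subrr.
  exists (\row_j sval (Dc j)); apply/rowP => j; rewrite !mxE; exact: (svalP (Dc j)).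
by apply: (third_norm1_congr7 (@std_definite t)) Dz => //; apply: third_norm_row.
Qed.

Lemma red7_unitmx (X : 'M_k) : unitary X -> red7 X \in unitmx.
Proof.
have Hu : chain_mx (2 : 'F_7) k \in unitmx by apply: chain_mx_unit; case: t.
move/(congr1 (@red7 _ _)); rewrite /red7 !map_mxM map_chain_mx /= eis_ev_omega.
exact: unitmx_isometry.
Qed.

Definition host_set : {set {'GL_k['F_7]}} :=
  [set g : {'GL_k['F_7]} | `[< exists2 X : 'M_k, unitary X & red7 X = val g >]].

Lemma host_group_set : group_set host_set.
Proof.
apply/group_setP; split=> [|g g'].
  by rewrite inE; apply/asboolP; exists 1%:M; [exact: unitary1 | rewrite /red7 map_mx1].
move=> /[1!inE]/asboolP[X uX DX] /[1!inE]/asboolP[Y uY DY]; rewrite inE; apply/asboolP.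
exists (X *m Y); first exact: unitaryM.
by rewrite GL_mulE /red7 map_mxM -/(red7 X) DX -/(red7 Y) DY.
Qed.
Canonical host_group := Group host_group_set.

Fact host_mx_ex (g : subg_of host_group) :
  exists X : 'M_k, unitary X /\ red7 X = val (val g).
Proof.
by have /[1!inE]/asboolP[X uX DX] := valP g; exists X.
Qed.

Definition host_mx (g : subg_of host_group) := sval (cid (host_mx_ex g)).

Lemma host_mxP g : unitary (host_mx g) /\ red7 (host_mx g) = val (val g).
Proof. exact: svalP (cid (host_mx_ex g)). Qed.

Definition host_model : unitary_model k.
Proof.
refine (@UnitaryModel k (subg_of host_group) host_mx _ _ _ _).
- move=> g g'; have [[uX DX] [uY DY]] := (host_mxP g, host_mxP g').
  have [uZ DZ] := host_mxP (g * g')%g.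
  apply: red7_unitary_inj => //; first exact: unitaryM.
  by rewrite DZ GL_mulE /red7 map_mxM -!/(red7 _) DX DY.
- move=> g g' eq_gg'; have [[_ DX] [_ DY]] := (host_mxP g, host_mxP g').
  by apply/val_inj/val_inj; rewrite /= -DX -DY eq_gg'.
- by move=> g; have [] := host_mxP g.
move=> X uX; have gX := red7_unitmx uX.
pose g : {'GL_k['F_7]} := FinRing.Unit gX.
have Gg : g \in host_group by rewrite inE; apply/asboolP; exists X.
exists (Subg Gg); have [uY DY] := host_mxP (Subg Gg).
by apply: red7_unitary_inj.
Defined.
End Host.

(** * Orders of the isometry groups over F_3 *)

Lemma isometry3V (F : fieldType) k (g : 'M[F]_k) :
  isometry3 g -> g \in unitmx -> isometry3 (invmx g).
Proof.
rewrite /isometry3 => gH ug; rewrite -[in LHS]gH trmx_inv -!mulmxA mulmxV ?unitmx_tr //.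
by rewrite mulmx1 mulKmx.
Qed.

Section IsometryCount.
Variable k : nat.
Hypothesis k_range : (0 < k <= 4)%N.

Lemma word_mx_isometry ls : isometry3 (word_mx 'F_3 k ls).
Proof.
elim: ls => [|l ls IH] /=; first by rewrite /isometry3 trmx1 mul1mx mulmx1.
by apply: isometry3M IH; exact: letter_mx_isometry char_F3 l.
Qed.

Lemma word_mx_unit ls : word_mx 'F_3 k ls \in unitmx.
Proof.
elim: ls => [|l ls IH] /=; first exact: unitmx1.
have [g2 lg] := letter_mx_rinv k char_F3 l.
by rewrite unitmx_mul IH andbT; case/mulmx1_unit: lg.
Qed.

Definition fixing_isometries j : {set 'M['F_3]_k} :=
  [set g : 'M['F_3]_k | [&& `[< isometry3 g >], g \in unitmx
    & [forall i : 'I_k, (i < j)%N ==> (row i g == delta_mx 0 i)]]].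

Lemma fixing_isometriesP j g :
  reflect [/\ isometry3 g, g \in unitmx
            & forall i : 'I_k, (i < j)%N -> row i g = delta_mx 0 i]
          (g \in fixing_isometries j).
Proof.
rewrite inE; apply: (iffP and3P) => [[/asboolP gH uG /forallP fix_g]|[gH uG fix_g]].
  by split=> // i lti; apply/eqP/(implyP (fix_g i)).
split=> //; first exact/asboolP.
by apply/forallP => i; apply/implyP => /fix_g->.
Qed.

(** Orbit and stabiliser: the isometries that fix the first j unit vectors are sorted by their row
    j, and the possible rows are exactly the vectors in the table. *)
Lemma card_fixing_isometries_step (j : 'I_k) :
  #|fixing_isometries j| =
  (size (undup (unzip1 (nth [::] (schreier_table k) j))) * #|fixing_isometries j.+1|)%N.
Proof.
set tab := nth _ _ _; pose S := [set v : 'rV['F_3]_k | row_list v \in unzip1 tab].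
have [/allP tab1 /allP tab2] := andP (schreier_table_ok k_range (ltn_ord j)).
have wP sw : sw \in tab -> exists2 v, row_list v = sw.1 &
    v *m word_mx 'F_3 k sw.2 = delta_mx 0 j /\
    forall i : 'I_k, (i < j)%N ->
      delta_mx 0 i *m word_mx 'F_3 k sw.2 = delta_mx 0 i :> 'rV_k.
  move=> sw_tab; have /and3P[vec /eqP w_s /allP w_fix] := tab2 _ sw_tab.
  have [sz Ds] := all_vectorsP vec; exists (list_row _ k sw.1) => //.
  rewrite -(list_row_word char_F3) // w_s unit_vectorE; split=> // i lti.
  suff: list_row 'F_3 k (unit_vector k i) *m word_mx 'F_3 k sw.2
      = list_row 'F_3 k (unit_vector k i) by rewrite unit_vectorE.
  rewrite -(list_row_word char_F3) ?size_mkseq //.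
  by rewrite (eqP (w_fix i _)) // mem_iota.
have rowS g : g \in fixing_isometries j -> row j g \in S.
  case/fixing_isometriesP => gH uG fix_g; rewrite inE.
  have gV : exists g', g *m g' = 1%:M by exists (invmx g); rewrite mulmxV.
  have cond := row_condition_isometry gH gV fix_g.
  have /implyP/(_ cond)/hasP[sw sw_tab /eqP<-] := tab1 _ (row_list_all_vectors (row j g)).
  exact: map_f.
have -> : size (undup (unzip1 tab)) = #|S|.
  rewrite cardE -(size_map (@row_list k)); apply/perm_size/uniq_perm.
  - exact: undup_uniq.
  - by rewrite (map_inj_uniq (can_inj (@row_listK k))) enum_uniq.
  move=> s; rewrite mem_undup; apply/mapP/mapP => [[sw sw_tab ->]|[v Sv ->]].
    by have [v Dv _] := wP _ sw_tab; exists v; rewrite // mem_enum inE Dv map_f.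
  by move: Sv; rewrite mem_enum inE => /mapP.
rewrite -sum1_card (partition_big (row j) (mem S)) //= -sum_nat_const.
apply: eq_bigr => v; rewrite inE => /mapP[sw sw_tab Dv].
have [v' Dv' [vw fix_w]] := wP _ sw_tab.
have{Dv' Dv} Dv : v' = v by rewrite -[v']row_listK Dv' -Dv row_listK.
rewrite {v'}Dv in vw; set W := word_mx _ _ _ in vw fix_w.
(* Right multiplication by the tabulated word carries the isometries with row j equal to v onto
   those that fix e_j too, so all fibres have the size of the next stabiliser. *)
have injW : injective (mulmxr W : 'M_k -> 'M_k).
  by move=> g g' /= /(congr1 (mulmx^~ (invmx W))); rewrite !mulmxK // word_mx_unit.
rewrite sum1_card -(card_imset _ injW); apply: eq_card => g /=.
apply/imsetP/fixing_isometriesP => [[g0]|[gH uG fix_g]].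
  rewrite unfold_in /= => /andP[/fixing_isometriesP[gH uG fix_g] /eqP gj] ->; split.
  - by apply: isometry3M => //; exact: word_mx_isometry.
  - by rewrite unitmx_mul uG word_mx_unit.
  move=> i; rewrite ltnS leq_eqVlt => /orP[/eqP/val_inj->|lti]; first by rewrite row_mul gj.
  by rewrite row_mul fix_g ?fix_w.
have uW := word_mx_unit sw.2.
exists (g *m invmx W); last by rewrite /= mulmxKV.
rewrite unfold_in /=; apply/andP; split; last first.
  by rewrite row_mul fix_g // -vw mulmxK.
apply/fixing_isometriesP; split.
- by apply: isometry3M => //; apply: isometry3V => //; exact: word_mx_isometry.
- by rewrite unitmx_mul uG unitmx_inv.
- by move=> i lti; rewrite row_mul (fix_g i (leqW lti)) -{1}(fix_w i lti) mulmxK.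
Qed.
End IsometryCount.

(** The products of the orbit lengths are 2, 8 * 3, 24 * 9 * 2 and 80 * 27 * 8 * 3 = 51840. The
    third is 9 * 2 * 24, because the form of rank 3 has a radical of dimension 1; the last is the
    order of Sp_4(3), kept as an expression because natural numbers are unary. *)
Lemma card_isometries t :
  #|fixing_isometries (chain_len t).+1 0| =
  match t with A2 => 2 | D4 => 24 | E6 => 432 | E8 => 51 * 1000 + 840 end%N.
Proof.
have full k : (0 < k <= 4)%N -> #|fixing_isometries k k| = 1%N.
  move=> k_range; apply: (etrans _ (cards1 (1%:M : 'M['F_3]_k))); apply: eq_card => g; rewrite finset.in_set1.
  apply/fixing_isometriesP/eqP => [[_ _ fix_g]|->].
    by apply/row_matrixP => i; rewrite fix_g // rowE mulmx1.
  split=> [||i _]; [by rewrite /isometry3 trmx1 mul1mx mulmx1 | exact: unitmx1 |].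
  by rewrite rowE mulmx1.
have step k j (lt_jk : (j < k)%N) (k_range : (0 < k <= 4)%N) :=
  card_fixing_isometries_step k_range (Ordinal lt_jk).
case: t => /=.
- by rewrite (step 1 0)%N // full // muln1; vm_compute.
- by rewrite (step 2 0)%N // (step 2 1)%N // full // muln1; vm_compute.
- by rewrite (step 3 0)%N // (step 3 1)%N // (step 3 2)%N // full // muln1; vm_compute.
rewrite (step 4 0)%N // (step 4 1)%N // (step 4 2)%N // (step 4 3)%N // full // muln1.
Qed.

(** * Reduction modulo theta *)

Definition red3 m n : 'M[eisint]_(m, n) -> 'M['F_3]_(m, n) :=
  map_mx (eis_ev (cube_root1 char_F3)).

Lemma eis_ev3_eq0 x : eis_ev (cube_root1 char_F3) x = 0 <-> exists y, x = theta_of omega * y.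
Proof.
split=> [|[y ->]]; last first.
  by rewrite rmorphM /= map_theta /= eis_ev_omega (theta1 char_F3) mul0r.
case: x => a b; rewrite /eis_ev /= => ab0.
have: ((a + b)%:~R == 0 :> 'F_3) by rewrite rmorphD /= -[X in _ + X]mulr1 ab0.
rewrite -(dvdz_pcharf (pchar_Fp _)) // => /dvdzP[q Dq].
(* As theta^2 = -3, the quotient of x by theta is - theta x / 3. *)
exists (Eisint (2 * q - a) (q - a)); rewrite (_ : theta_of omega = Eisint 1 2) //.
change (Eisint a b = Eisint (1 * (2 * q - a) - 2 * (q - a))
                            (1 * (q - a) + 2 * (2 * q - a) - 2 * (q - a))).
by congr Eisint; lia.
Qed.

(** Conjugation moves a + b omega by - b theta, hence is trivial modulo theta. *)
Lemma eis_ev3_conj x :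
  eis_ev (cube_root1 char_F3) (eis_conj x) = eis_ev (cube_root1 char_F3) x.
Proof.
apply/eqP; rewrite -subr_eq0 -rmorphB; apply/eqP/eis_ev3_eq0.
case: x => a b; exists (Eisint (- b) 0).
have -> : theta_of omega = Eisint 1 2 by [].
change (Eisint (a - b - a) (- b - b) = Eisint (1 * (- b) - 2 * 0) (1 * 0 + 2 * (- b) - 2 * 0)).
by congr Eisint; lia.
Qed.

Lemma red3_unitary k (X : 'M_k) : unitary X -> isometry3 (red3 X).
Proof.
move/(congr1 (@red3 _ _)); rewrite /red3 /isometry3 !map_mxM map_chain_mx /= eis_ev_omega.
move=> eqH; rewrite -[RHS]eqH; congr (_ *m _).
by apply/matrixP => i j; rewrite !mxE /= eis_ev3_conj.
Qed.

Lemma eis_norm_omegaX m : eis_norm (omega ^+ m) = 1.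
Proof. by elim: m => // m IH; rewrite exprS eis_normM IH. Qed.

Section UnitaryKernel.
Variable t : root_type.
Local Notation k := (chain_len t).+1.

(** Row i is congruent to e_i modulo theta and has the same norm, so it is e_i times a power of
    omega. Neighbouring rows must keep their product 1, which makes all the powers equal. *)
Lemma red3_kernel (X : 'M_k) : unitary X -> red3 X = 1%:M ->
  exists2 m, X = (omega ^+ m)%:M & (m < 3)%N.
Proof.
move=> uX rX.
have /(_ _)/cid2 Dm : forall i : 'I_k, exists2 m, row i X = omega ^+ m *: delta_mx 0 i & (m < 3)%N.
  move=> i.
  have /(_ _)/cid Dc : forall j, exists y, X i j - (1%:M : 'M_k) i j = theta_of omega * y.
    move=> j; apply/eis_ev3_eq0; rewrite rmorphB /=.
    move/matrixP/(_ i j): rX; rewrite !mxE => ->.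
    by rewrite [X in _ - X]rmorph_nat subrr.
  apply: (third_norm1_congr_theta (@std_definite t) (z := \row_j sval (Dc j))).
  - exact: third_norm_row.
  - exact: third_norm_delta.
  by apply/rowP => j; rewrite !mxE -(svalP (Dc j)) !mxE eqxx eq_sym.
pose m i := s2val (Dm i); pose o : 'I_k := ord0.
have Dr i : row i X = omega ^+ m i *: delta_mx 0 i := s2valP (Dm i).
have ltm i : (m i < 3)%N := s2valP' (Dm i).
exists (m o) => //.
have eqm : forall n (lt_n : (n < k)%N), m (Ordinal lt_n) = m o.
  elim=> [|n IHn] lt_n; first by congr m; apply: val_inj.
  rewrite -(IHn (ltnW lt_n)); set i := Ordinal (ltnW lt_n); set j := Ordinal lt_n.
  have := unitary_row i j uX; rewrite !Dr skewZl skewZr skew_delta !mxE /= eqxx.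
  rewrite (ltn_eqF (leqW (ltnSn n))) -val_eqE /= (ltn_eqF (ltnSn n)).
  by move: (m i) (m j) (ltm i) (ltm j) => [|[|[|?]]] [|[|[|?]]].
apply/row_matrixP => i; rewrite Dr rowE mul_mx_scalar; congr (omega ^+ _ *: _).
by case: i => n lt_n; apply: eqm.
Qed.
End UnitaryKernel.

Lemma unitmx_rinv (F : fieldType) n (A B : 'M[F]_n) : A *m B = 1%:M -> A \in unitmx.
Proof. by case/mulmx1_unit. Qed.

(** * The reflection group *)

Section ModelGroup.
Variables (t : root_type) (M : unitary_model (chain_len t).+1).
Local Notation k := (chain_len t).+1.
Local Notation mx := (@model_mx k M).

Lemma model_mx1 : mx 1%g = 1%:M.
Proof.
have [g Dg] := model_mx_surj M (unitary1 k); suff -> : 1%g = g by [].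
by apply: (mulgI g); apply: (@model_mx_inj k M); rewrite mulg1 model_mxM Dg mulmx1.
Qed.

Lemma model_mxV g : mx g *m mx g^-1%g = 1%:M.
Proof. by rewrite -model_mxM mulgV model_mx1. Qed.

(** Defined for every matrix; the value 1 off the unitary matrices is a mere default. *)
Definition model_elt (X : 'M[eisint]_k) : M :=
  if pselect (exists g, mx g = X) is left e then sval (cid e) else 1%g.

Lemma model_eltK X : unitary X -> mx (model_elt X) = X.
Proof.
move/model_mx_surj => ex; rewrite /model_elt.
by case: pselect => [e|/(_ (ex M))] //; exact: svalP (cid e).
Qed.

Definition scalar_elt a := model_elt a%:M.
Definition triflection_elt i := model_elt (triflection_mx omega i).

Lemma scalar_eltE a : eis_norm a = 1 -> mx (scalar_elt a) = a%:M.
Proof. by move=> na; rewrite model_eltK //; apply: unitary_scalar. Qed.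

Lemma scalar_eltC a g : eis_norm a = 1 -> commute (scalar_elt a) g.
Proof.
by move=> na; apply: (@model_mx_inj k M); rewrite !model_mxM scalar_eltE // scalar_mxC.
Qed.

Lemma scalar_eltM a b : eis_norm a = 1 -> eis_norm b = 1 ->
  scalar_elt (a * b) = (scalar_elt a * scalar_elt b)%g.
Proof.
move=> na nb; apply: (@model_mx_inj k M).
by rewrite model_mxM !scalar_eltE ?scalar_mxM // eis_normM na nb.
Qed.

Lemma scalar_elt1 : scalar_elt 1 = 1%g.
Proof. by apply: (@model_mx_inj k M); rewrite scalar_eltE // model_mx1. Qed.

Lemma scalar_eltX a m : eis_norm a = 1 -> scalar_elt (a ^+ m) = (scalar_elt a ^+ m)%g.
Proof.
move=> na; have nX n : eis_norm (a ^+ n) = 1.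
  by elim: n => // n IH; rewrite exprS eis_normM na IH.
elim: m => [|m IH]; first by rewrite scalar_elt1 expg0.
by rewrite exprS scalar_eltM // IH expgS.
Qed.

Lemma scalar_elt_inj a b : eis_norm a = 1 -> eis_norm b = 1 ->
  scalar_elt a = scalar_elt b -> a = b.
Proof.
move=> na nb /(congr1 (fun g => mx g 0 0)); rewrite !scalar_eltE // !mxE eqxx.
by rewrite !mulr1n.
Qed.

Lemma triflection_eltE i : mx (triflection_elt i) = triflection_mx omega i.
Proof.
rewrite model_eltK // /unitary.
exact: (triflection_unitary omega_root (c := eis_conj)).
Qed.

(** In terms of [skew], which lacks a factor theta, the coefficient (omega - 1) / 3 of a reflection
    in a vector of norm 3 becomes (omega - 1) theta / 3 = omega^2. *)
Definition is_reflection (g : M) := exists2 r : 'rV_k, third_norm r = 1 &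
  forall x, x *m mx g = x + (omega ^+ 2 * skew x r) *: r.

Lemma triflection_elt_reflection i : is_reflection (triflection_elt i).
Proof.
exists (delta_mx 0 i); first exact: third_norm_delta.
move=> x; rewrite triflection_eltE mul_triflection_mx.
by rewrite /skew map_delta_mx trmx_delta -colE [col _ _ _ _]mxE.
Qed.

Definition reflection_group : {group M} :=
  <<[set g : M | `[< is_reflection g \/ is_reflection g^-1%g >]]>>%G.

Lemma triflection_elt_in i : triflection_elt i \in reflection_group.
Proof.
by apply/mem_gen; rewrite inE; apply/asboolP; left; apply: triflection_elt_reflection.
Qed.

Definition letter_elt l : M :=
  oapp (fun i : 'I_k => triflection_elt i) (scalar_elt (-1)) (insub l).
Definition word_elt ls : M := foldr (fun l g => letter_elt l * g)%g 1%g ls.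

Lemma red3_scalar a : red3 (a%:M : 'M_k) = (eis_ev (cube_root1 char_F3) a)%:M.
Proof. exact: map_scalar_mx. Qed.

Lemma red3_word ls : red3 (mx (word_elt ls)) = word_mx 'F_3 k ls.
Proof.
elim: ls => [|l ls IH] /=; first by rewrite model_mx1 /red3 map_mx1.
rewrite model_mxM /red3 map_mxM -!/(red3 _) IH; congr (_ *m _).
rewrite /letter_elt /letter_mx; case: insub => [i|] /=.
  by rewrite triflection_eltE /red3 map_triflection_mx /= eis_ev_omega.
by rewrite scalar_eltE // red3_scalar rmorphN rmorph1 raddfN.
Qed.

Lemma red3_modelM g g' : red3 (mx (g * g')%g) = red3 (mx g) *m red3 (mx g').
Proof. by rewrite model_mxM /red3 map_mxM. Qed.

Lemma red3_modelV g : red3 (mx g) *m red3 (mx g^-1%g) = 1%:M.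
Proof. by rewrite -red3_modelM mulgV model_mx1 /red3 map_mx1. Qed.

Lemma red3_model_isometry g : isometry3 (red3 (mx g)).
Proof. exact/red3_unitary/model_mx_unitary. Qed.

Lemma red3_model_ker g : red3 (mx g) = 1%:M ->
  exists2 m, g = scalar_elt (omega ^+ m) & (m < 3)%N.
Proof.
move=> rg; have [m Dg ltm] := red3_kernel (model_mx_unitary g) rg.
by exists m => //; apply: (@model_mx_inj k M); rewrite scalar_eltE ?eis_norm_omegaX.
Qed.

Lemma red3_omega m : red3 (mx (scalar_elt (omega ^+ m))) = 1%:M.
Proof.
rewrite scalar_eltE ?eis_norm_omegaX // red3_scalar rmorphXn /=.
by rewrite eis_ev_omega expr1n.
Qed.

Lemma red3_eq g g' : red3 (mx g) = red3 (mx g') ->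
  exists2 m, g = (g' * scalar_elt (omega ^+ m))%g & (m < 3)%N.
Proof.
move=> eqr; have [|m Dm ltm] := @red3_model_ker (g'^-1 * g)%g.
  by rewrite red3_modelM eqr -red3_modelM mulVg model_mx1 /red3 map_mx1.
by exists m; rewrite // -Dm mulKVg.
Qed.

Lemma chain_len_range : (0 < k <= 4)%N. Proof. by case: t. Qed.

Lemma model_word g : exists ls m,
  (g * word_elt ls)%g = scalar_elt (omega ^+ m).
Proof.
have [|ls Dls] := isometry_word chain_len_range (red3_model_isometry g).
  by eexists; apply: red3_modelV.
have [|m Dm _] := @red3_model_ker (g * word_elt ls)%g; first by rewrite red3_modelM red3_word.
by exists ls, m.
Qed.

Lemma red3_surj (X : 'M_k) : isometry3 X -> X \in unitmx -> exists g, red3 (mx g) = X.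
Proof.
move=> isoX uX; have [|ls Dls] := isometry_word chain_len_range isoX.
  by exists (invmx X); rewrite mulmxV.
exists (word_elt ls)^-1%g; have := red3_modelV (word_elt ls); rewrite red3_word => eq1.
by rewrite -[LHS]mul1mx -Dls -mulmxA eq1 mulmx1.
Qed.

(** Reduction modulo theta is onto the isometries over F_3, and its fibres are the cosets of the
    three scalars omega^m. *)
Lemma card_model : #|M| =
  (3 * match t with A2 => 2 | D4 => 24 | E6 => 432 | E8 => 51 * 1000 + 840 end)%N.
Proof.
rewrite -card_isometries -[LHS]sum1_card.
rewrite (partition_big (fun g => red3 (mx g)) (mem (fixing_isometries k 0))) /=; last first.
  move=> g _; apply/fixing_isometriesP; split=> //; first exact: red3_model_isometry.
  exact: unitmx_rinv (red3_modelV g).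
rewrite mulnC -sum_nat_const; apply: eq_bigr => X /fixing_isometriesP[isoX uX _].
have [g Dg] := red3_surj isoX uX.
pose f (m : 'I_3) := (g * scalar_elt (omega ^+ m))%g.
have injf : injective f.
  move=> m m' /mulgI/scalar_elt_inj; rewrite !eis_norm_omegaX => /(_ erefl erefl) eqm.
  by apply: val_inj; case: m m' eqm => [[|[|[|?]]] ?] [[|[|[|?]]] ?].
rewrite sum1_card -[RHS]card_ord -(card_imset _ injf); apply: eq_card => g'.
transitivity (red3 (mx g') == X) => //; apply/eqP/imsetP => [Dg'|[m _ ->]].
  have [|m -> ltm] := @red3_eq g' g; first by rewrite Dg Dg'.
  by exists (Ordinal ltm).
by rewrite /f red3_modelM red3_omega mulmx1.
Qed.
End ModelGroup.

(* The Coxeter element of the reflection group, i.e. the product of the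
   triflections in the chain roots, has a power which is a scalar generating
   the centre of the group. *)
Definition coxeter_exponent t : nat := match t with A2 => 1 | D4 => 3 | E6 => 4 | E8 => 5 end.

(** The four groups have Coxeter numbers 3, 6, 12, 30 and centres of order 3, 2, 3, 6; the exponents
    1, 3, 4, 5 are the quotients. *)
Definition coxeter_scalar t : eisint :=
  match t with A2 | E6 => omega | D4 => -1 | E8 => - omega ^+ 2 end.

(** [triflection_mx] on lists, where it can be evaluated. The coefficient of the entry itself is 1 -
    omega^2 theta = omega. *)
Definition triflection_act k i (s : seq eisint) : seq eisint :=
  mkseq (fun j => if j == i then omega * nth 0 s j
                     + omega ^+ 2 * (nth 0 (0 :: s) j - nth 0 s j.+1) else nth 0 s j) k.

Definition seq_mx_row k (s : seq eisint) : 'rV[eisint]_k := \row_j nth 0 s j.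

Lemma seq_mx_row_triflection k (i : 'I_k) s : size s = k ->
  seq_mx_row k (triflection_act k i s) = seq_mx_row k s *m triflection_mx omega i.
Proof.
move=> sz; have e j : entry (seq_mx_row k s) j = nth 0 s j.
  have [ltj|gej] := ltnP j k; first by rewrite [LHS](entry_row (fun j => nth 0 s j)).
  by rewrite entry_out // nth_default // sz.
rewrite mul_triflection_mx mul_chain_mx; apply/rowP => j.
rewrite mxE nth_mkseq // [RHS]mxE [X in _ = X + _]mxE [X in _ = _ + X]mxE.
rewrite [delta_mx _ _ _ _]mxE eqxx.
rewrite -val_eqE /=; case: eqP => [->|_]; last by rewrite mulr0 addr0.
rewrite mulr1 e mxE.
have -> : (match i : nat with 0 => 0 | m.+1 => entry (seq_mx_row k s) m end) = nth 0 (0 :: s) i.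
  by case: (i : nat).
move: (nth 0 s i) (nth 0 (0 :: s) i) (nth 0 s i.+1) => x y z.
have -> : omega * x = x + omega ^+ 2 * (- (theta_of omega * x)).
  by rewrite mulrN mulrA -{2}[x]mul1r -mulrBl.
by ring.
Qed.

Definition coxeter_mx k : 'M[eisint]_k :=
  foldr (fun i => mulmx (triflection_mx omega i)) 1%:M (enum 'I_k).

Lemma seq_mx_row_coxeter k s : size s = k ->
  seq_mx_row k (foldl (fun s i => triflection_act k i s) s (iota 0 k))
  = seq_mx_row k s *m coxeter_mx k.
Proof.
rewrite -val_enum_ord /coxeter_mx; elim: (enum 'I_k) s => [|i r IH] s sz /=.
  by rewrite mulmx1.
by rewrite IH ?size_mkseq // seq_mx_row_triflection // mulmxA.
Qed.

Lemma coxeter_mx_scalar t :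
  iter (coxeter_exponent t) (mulmx^~ (coxeter_mx (chain_len t).+1)) 1%:M
  = (coxeter_scalar t)%:M.
Proof.
set k := _.+1; pose act s := foldl (fun s i => triflection_act k i s) s (iota 0 k).
have size_act s : size s = k -> size (act s) = k.
  by rewrite /act; elim: (iota 0 k) s => //= i r IH s sz; rewrite IH ?size_mkseq.
have iter_act m s : size s = k ->
    seq_mx_row k (iter m act s) = seq_mx_row k s *m iter m (mulmx^~ (coxeter_mx k)) 1%:M.
  move=> sz; have : size (iter m act s) = k /\ seq_mx_row k (iter m act s)
      = seq_mx_row k s *m iter m (mulmx^~ (coxeter_mx k)) 1%:M; last by case.
  elim: m => [|m [IHsz IH]] /=; first by rewrite mulmx1.
  by rewrite size_act // mulmxA -IH -seq_mx_row_coxeter.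
apply/row_matrixP => i; rewrite rowE [RHS]rowE mul_mx_scalar.
have -> : delta_mx 0 i = seq_mx_row k (mkseq (fun j => (i == j :> nat)%:R) k).
  by apply/rowP => j; rewrite !mxE nth_mkseq // eqxx eq_sym.
rewrite -iter_act ?size_mkseq //.
have -> : coxeter_scalar t *: seq_mx_row k (mkseq (fun j => (i == j :> nat)%:R) k)
   = seq_mx_row k (mkseq (fun j => if i == j :> nat then coxeter_scalar t else 0) k).
  apply/rowP => j; rewrite !mxE !nth_mkseq //.
  by case: (_ == _); rewrite ?mulr1 ?mulr0.
congr seq_mx_row; rewrite /act /k {iter_act size_act act}.
by case: t @k i => k [[|[|[|[|]]]]] // _; vm_compute.
Qed.

(** A generator of a complement to the scalars in the reflection group: together with the Coxeter
    scalar it generates all six units. *)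
Definition centre_scalar t : eisint := match t with A2 | E6 => -1 | D4 => omega | E8 => 1 end.

Definition scalar_order t : nat := match t with A2 | E6 => 2 | D4 => 3 | E8 => 1 end.

Lemma centre_scalar_norm t : eis_norm (centre_scalar t) = 1. Proof. by case: t. Qed.
Lemma coxeter_scalar_norm t : eis_norm (coxeter_scalar t) = 1. Proof. by case: t. Qed.

Lemma centre_generators_omega t :
  exists i j, coxeter_scalar t ^+ i * centre_scalar t ^+ j = omega.
Proof.
by case: t; [exists 1%N, 0%N | exists 0%N, 1%N | exists 1%N, 0%N | exists 2, 0%N].
Qed.

Lemma centre_generators_neg1 t :
  exists i j, coxeter_scalar t ^+ i * centre_scalar t ^+ j = -1.
Proof.
by case: t; [exists 0%N, 1%N | exists 1%N, 0%N | exists 0%N, 1%N | exists 3, 0%N].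
Qed.

(** * The reflection group as a direct factor *)

Section Decomposition.
Variables (t : root_type) (M : unitary_model (chain_len t).+1).
Local Notation k := (chain_len t).+1.
Local Notation mx := (@model_mx k M).
Local Notation d := (chain_coef omega k).
Local Notation R := (reflection_group M).

(* Trivial action on the discriminant group, which is generated by the class of chain_row / d. *)
Definition disc_trivial (g : M) :=
  exists z, chain_row omega k *m mx g - chain_row omega k = d *: z.

Lemma disc_trivial_group : group_set [set g : M | `[< disc_trivial g >]].
Proof.
apply/group_setP; split=> [|g g'].
  by rewrite inE; apply/asboolP; exists 0; rewrite model_mx1 mulmx1 subrr scaler0.
move=> /[1!inE]/asboolP[z Dz] /[1!inE]/asboolP[z' Dz']; rewrite inE; apply/asboolP.
exists (z *m mx g' + z'); rewrite scalerDr scalemxAl -Dz -Dz' model_mxM mulmxA mulmxBl.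
by rewrite addrA subrK.
Qed.
Definition disc_kernel := Group disc_trivial_group.

Lemma disc_kernelP g : reflect (disc_trivial g) (g \in disc_kernel).
Proof. by rewrite inE; apply: asboolP. Qed.

(** The product of [chain_row] with the chain matrix is d times a unit vector, so [skew] of it with
    any r is divisible by d, and the reflection moves it by a multiple of d r. *)
Lemma reflection_disc_trivial g : is_reflection g -> disc_trivial g.
Proof.
case=> r _ /(_ (chain_row omega k)) Dx; rewrite /disc_trivial Dx addrC addKr.
exists ((omega ^+ 2 * eis_conj (r 0 ord_max)) *: r).
rewrite /skew chain_row_mul -scalemxAl -rowE !mxE scalerA.
by rewrite mulrCA.
Qed.

Lemma reflection_group_disc : R \subset disc_kernel.
Proof.
rewrite gen_subG; apply/fintype.subsetP => g /[1!inE]/asboolP[].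
  by move/reflection_disc_trivial/disc_kernelP.
by move/reflection_disc_trivial/disc_kernelP; rewrite groupV.
Qed.

Definition scalars : {group M} := <[scalar_elt M (centre_scalar t)]>%G.

Lemma scalarsP g : g \in scalars ->
  exists2 m, g = scalar_elt M (centre_scalar t ^+ m) & (m < scalar_order t)%N.
Proof.
case/cycleP => m ->; exists (m %% scalar_order t)%N; last by rewrite ltn_mod; case: t.
rewrite -scalar_eltX ?centre_scalar_norm //; congr scalar_elt.
rewrite {1}(divn_eq m (scalar_order t)) exprD mulnC exprM.
by rewrite (_ : _ ^+ scalar_order t = 1) ?expr1n ?mul1r //; case: t.
Qed.

Lemma scalars_disc_trivial : scalars :&: disc_kernel = 1%g.
Proof.
apply/trivgP/fintype.subsetP => g /setIP[/scalarsP[m -> ltm] /disc_kernelP[z]].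
rewrite inE -(scalar_elt1 M) scalar_eltE; last first.
  by case: t m ltm {z} => [] [|[|[|m]]].
rewrite mul_mx_scalar => /rowP/(_ ord0); rewrite !mxE mulr1 => eqd.
apply/eqP; congr scalar_elt; have := congr1 eis_norm eqd; rewrite eis_normM.
(* The first entry of [chain_row] is 1, so a scalar c that acts trivially has d dividing c - 1. The
   norm of c - 1 is 4 for c = -1 and 3 for c a nontrivial cube root of unity, against a norm of d
   equal to 3 and 4 respectively. *)
have indivisible (a b n : int) :
    ((a == 4) && (b == 3)) || ((a == 3) && (b == 4)) -> a = b * n -> False by lia.
move: (eis_norm (z 0 ord0)) {eqd} => n; case: t m ltm => [] [|[|[|m]]] // _ eqn;
  by exfalso; apply: indivisible eqn.
Qed.

Lemma coxeter_in_reflection_group : scalar_elt M (coxeter_scalar t) \in R.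
Proof.
pose c := (\prod_(i <- enum 'I_k) triflection_elt M i)%g.
have Dc : mx c = coxeter_mx k.
  rewrite /c /coxeter_mx; elim: (enum 'I_k) => [|i r IH] /=.
    by rewrite big_nil model_mx1.
  by rewrite big_cons model_mxM IH triflection_eltE.
have -> : scalar_elt M (coxeter_scalar t) = (c ^+ coxeter_exponent t)%g.
  apply: (@model_mx_inj k M); rewrite scalar_eltE ?coxeter_scalar_norm //.
  rewrite -coxeter_mx_scalar; elim: (coxeter_exponent t) => [|m IH] /=.
    by rewrite expg0 model_mx1.
  by rewrite expgSr model_mxM -IH Dc.
by apply/groupX/group_prod => i _; apply: triflection_elt_in.
Qed.

Lemma scalars_central : scalars \subset 'C(R)%g.
Proof.
rewrite cycle_subG; apply/centP => g _.
exact/scalar_eltC/centre_scalar_norm.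
Qed.

(** By [model_word] the triflections, -1 and omega generate everything, and both scalars are
    products of powers of the Coxeter scalar and of [centre_scalar t]. *)
Lemma reflection_group_scalars : (R <*> scalars)%g = [set: M]%g.
Proof.
apply/eqP; rewrite finset.eqEsubset finset.subsetT; apply/fintype.subsetP => g _.
have inR g' : g' \in R -> g' \in (R <*> scalars)%g.
  by apply: (fintype.subsetP (joing_subl _ _)).
have inS g' : g' \in scalars -> g' \in (R <*> scalars)%g.
  by apply: (fintype.subsetP (joing_subr _ _)).
have inZ i j : scalar_elt M (coxeter_scalar t ^+ i * centre_scalar t ^+ j) \in (R <*> scalars)%g.
  have nX a n : eis_norm a = 1 -> eis_norm (a ^+ n) = 1.
    by move=> na; elim: n => // n IH; rewrite exprS eis_normM na IH.
  rewrite scalar_eltM ?nX ?coxeter_scalar_norm ?centre_scalar_norm //.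
  rewrite !scalar_eltX ?coxeter_scalar_norm ?centre_scalar_norm //.
  apply: groupM; apply: groupX; first exact/inR/coxeter_in_reflection_group.
  exact/inS/cycle_id.
have in_omega : scalar_elt M omega \in (R <*> scalars)%g.
  have [i [j <-]] := centre_generators_omega t; exact: inZ.
have in_neg1 : scalar_elt M (-1) \in (R <*> scalars)%g.
  have [i [j <-]] := centre_generators_neg1 t; exact: inZ.
have [ls [m Dg]] := model_word g; rewrite -(mulgK (word_elt M ls) g) Dg.
rewrite groupM ?groupV //; first by rewrite scalar_eltX ?groupX.
elim: ls {Dg} => [|l ls IH] //=; rewrite groupM // /letter_elt.
by case: insub => [i|] //=; apply/inR/triflection_elt_in.
Qed.

Lemma reflection_scalars_dprod : (R \x scalars)%g = [set: M]%g.
Proof.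
rewrite dprodEY ?reflection_group_scalars ?scalars_central //.
apply/trivgP; rewrite -scalars_disc_trivial finset.setIC.
exact: (finset.setSI _ reflection_group_disc).
Qed.

(** The kernel contains R and meets the complement of R trivially, which leaves no room between the
    two. *)
Lemma reflection_group_eq : R = disc_kernel.
Proof.
apply: val_inj => /=; apply/eqP; rewrite finset.eqEsubset reflection_group_disc.
apply/fintype.subsetP => g gN; have /dprodP[_ defM _ _] := reflection_scalars_dprod.
have /mulsgP[r c rR cS Dg] : g \in (R * scalars)%g by rewrite defM inE.
suff /set1P c1 : c \in [1 M]%g by rewrite Dg c1 mulg1.
rewrite -scalars_disc_trivial inE cS.
by rewrite -(groupMl _ (fintype.subsetP reflection_group_disc _ rR)) -Dg.
Qed.

Lemma order_scalars : #|scalars| = scalar_order t.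
Proof.
have na := centre_scalar_norm t; set x := scalar_elt M (centre_scalar t).
have xn1 : centre_scalar t != 1 -> x != 1%g.
  by apply: contra => /eqP; rewrite -(scalar_elt1 M) => /scalar_elt_inj -> //.
have xX n : centre_scalar t ^+ n = 1 -> (x ^+ n = 1)%g.
  by rewrite -scalar_eltX // => ->; apply: scalar_elt1.
change (#[x]%g = scalar_order t); have [c1|cn1] := eqVneq (centre_scalar t) 1.
  have /eqP x1 := xX 1%N c1; rewrite expg1 -order_eq1 in x1; rewrite (eqP x1).
  by move: c1; case: t.
apply: nt_prime_order; [by move: cn1; case: t | by apply: xX; case: t | exact: xn1].
Qed.
End Decomposition.

(** * Identification of the reflection groups *)

Lemma det2E (K : comNzRingType) (A : 'M[K]_2) :
  \det A = A 0 0 * A 1 1 - A 0 1 * A 1 0.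
Proof.
rewrite (expand_det_row _ ord0) !big_ord_recl big_ord0 /cofactor !det_mx11 !mxE /=.
rewrite expr0 expr1 mul1r addr0 mulN1r mulrN.
by congr (_ * A _ _ - A _ _ * A _ _); apply: val_inj.
Qed.

(** The alternating forms in rank 2 form a line, on which a matrix acts through its determinant. *)
Lemma isometry3_mx2 (K : comNzRingType) (A : 'M[K]_2) : 3%:R = 0 :> K ->
  A *m chain_mx 1 2 *m A^T = \det A *: chain_mx 1 2.
Proof.
move=> char3; have e0 : 0 = ord0 :> 'I_2 by []. 
have e1 : lift ord0 ord0 = 1 :> 'I_2 by apply: val_inj.
rewrite det2E; apply/matrixP => i j; rewrite !mxE !big_ord_recl !big_ord0 !mxE.
rewrite !big_ord_recl !big_ord0 !mxE !(theta1 char3) !e1 /=.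
have [-> | ->] : i = 0 \/ i = 1.
- by case: i => [[|[|]]] // ?; [left | right]; apply: val_inj.
- by have [-> | ->] : j = 0 \/ j = 1; [
    case: j => [[|[|]]] // ?; [left | right]; apply: val_inj | rewrite /=; ring | rewrite /=; ring].
by have [-> | ->] : j = 0 \/ j = 1; [
    case: j => [[|[|]]] // ?; [left | right]; apply: val_inj | rewrite /=; ring | rewrite /=; ring].
Qed.

Section GLMorphism.
Variables (gT : finGroupType) (F : finFieldType) (n : nat) (X : gT -> 'M[F]_n.+1).
Hypotheses (X1 : X 1%g = 1%:M) (XM : forall g g', X (g * g')%g = X g *m X g').

Fact gl_of_unit g : X g \in unitmx.
Proof. by apply: (@unitmx_rinv _ _ _ (X g^-1%g)); rewrite -XM mulgV. Qed.

Definition gl_of g : {'GL_n.+1[F]} := FinRing.Unit (gl_of_unit g).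

Lemma val_gl_of g : val (gl_of g) = X g. Proof. by []. Qed.

Lemma gl_ofM : {morph gl_of : g g' / (g * g')%g}.
Proof. by move=> g g'; apply: val_inj; rewrite GL_mulE val_gl_of XM. Qed.

Definition gl_morphism (D : {group gT}) : {morphism D >-> {'GL_n.+1[F]}} :=
  @Morphism _ _ D gl_of (in2W gl_ofM).

Lemma gl_morphism_im (D : {group gT}) (P : pred 'M[F]_n.+1) :
    (forall g, g \in D -> P (X g)) ->
    (forall A, A \in unitmx -> P A -> exists2 g, g \in D & X g = A) ->
  (gl_morphism D @* D)%g = [set g : {'GL_n.+1[F]} | P (val g)].
Proof.
move=> imP imS; apply/finset.setP => y; rewrite inE; apply/morphimP/idP => [[g _ Dg ->]|Py].
  exact: imP.
have [g Dg Xg] := imS (val y) (valP y) Py.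
by exists g => //; apply: val_inj.
Qed.

Lemma gl_morphism_inj (D : {group gT}) :
  (forall g, g \in D -> X g = 1%:M -> g = 1%g) -> ('injm (gl_morphism D))%g.
Proof.
move=> inj1; apply/fintype.subsetP => g; rewrite inE => /andP[Dg].
rewrite inE => /set1P g1; apply/set1P; apply: inj1 => //.
by have -> : X g = val (gl_morphism D g); [by [] | rewrite g1].
Qed.

Lemma gl_card (D : {group gT}) (P : pred 'M[F]_n.+1) :
    (forall g, g \in D -> X g = 1%:M -> g = 1%g) ->
    (forall g, g \in D -> P (X g)) ->
    (forall A, A \in unitmx -> P A -> exists2 g, g \in D & X g = A) ->
  #|[set g : {'GL_n.+1[F]} | P (val g)]| = #|D|.
Proof.
move=> inj1 imP imS; rewrite -(gl_morphism_im imP imS).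
by apply: card_injm => //; apply: gl_morphism_inj.
Qed.

Lemma gl_isog (D : {group gT}) (P : pred 'M[F]_n.+1) :
    (forall g, g \in D -> X g = 1%:M -> g = 1%g) ->
    (forall g, g \in D -> P (X g)) ->
    (forall A, A \in unitmx -> P A -> exists2 g, g \in D & X g = A) ->
  D \isog [set g : {'GL_n.+1[F]} | P (val g)].
Proof.
move=> inj1 imP imS; rewrite -(gl_morphism_im imP imS).
by apply: sub_isog => //; apply: gl_morphism_inj.
Qed.
End GLMorphism.

Lemma isog_Zp_order (gT : finGroupType) (x : gT) n : #[x]%g = n -> <[x]>%g \isog Zp n.
Proof. by move=> <-; rewrite isog_sym Zp_isog. Qed.

Lemma isog_Zp_prime (gT : finGroupType) (G : {group gT}) p :
  prime p -> #|G| = p -> G \isog Zp p.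
Proof.
move=> pr_p oG; have /cyclicP[x Gx] : cyclic G by rewrite prime_cyclic // oG.
by rewrite Gx; apply: isog_Zp_order; rewrite -oG Gx.
Qed.

Section Types.
Variables (t : root_type) (M : unitary_model (chain_len t).+1).
Local Notation k := (chain_len t).+1.
Local Notation mx := (@model_mx k M).

Lemma card_reflection_group : (#|reflection_group M| * scalar_order t)%N = #|M|.
Proof.
by rewrite -(order_scalars M) (dprod_card (reflection_scalars_dprod M)) cardsT.
Qed.

Lemma scalars_isog : scalars M \isog Zp (scalar_order t).
Proof. by apply: isog_Zp_order; apply: order_scalars. Qed.
Lemma red3_model1 : red3 (mx 1%g) = 1%:M.
Proof. by rewrite model_mx1 /red3 map_mx1. Qed.
End Types.

Lemma A2_reflection_group (M : unitary_model (chain_len A2).+1) :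
  reflection_group M \isog Zp 3.
Proof.
apply: isog_Zp_prime => //; apply/eqP.
by rewrite -(eqn_pmul2r (isT : (0 < scalar_order A2)%N)) card_reflection_group card_model.
Qed.

Lemma isometry3_det2 (K : comNzRingType) (A : 'M[K]_2) : 3%:R = 0 :> K ->
  isometry3 A <-> \det A = 1.
Proof.
move=> char3; rewrite /isometry3 isometry3_mx2 //; split=> [|->]; last by rewrite scale1r.
by move/matrixP/(_ 0 1); rewrite !mxE (theta1 char3) /= mul0r !subr0 mulr1.
Qed.

(** * D4 and SL_2(3) *)

Section D4Group.
Variable M : unitary_model (chain_len D4).+1.

Lemma D4_red3_scalars g : g \in scalars M -> red3 (model_mx g) = 1%:M.
Proof. by case/scalarsP => m -> _; apply: (red3_omega M). Qed.

Lemma D4_red3_inj g : g \in reflection_group M -> red3 (model_mx g) = 1%:M -> g = 1%g.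
Proof.
move=> Rg r1; have [m Dg _] := @red3_model_ker _ M g r1.
have /dprodP[_ _ _ trivRS] := reflection_scalars_dprod M.
suff : g \in [1 M]%g by move/set1P.
rewrite -trivRS inE Rg Dg scalar_eltX //.
exact: groupX (cycle_id _).
Qed.

Lemma D4_red3_det g : g \in reflection_group M -> \det (red3 (model_mx g)) == 1.
Proof. by move=> _; apply/eqP/(isometry3_det2 _ char_F3)/(@red3_model_isometry _ M). Qed.

Lemma D4_red3_surj (A : 'M['F_3]_2) : A \in unitmx -> \det A == 1 ->
  exists2 g, g \in reflection_group M & red3 (model_mx g) = A.
Proof.
move=> uA /eqP/(isometry3_det2 _ char_F3) isoA.
have [g Dg] := @red3_surj _ M A isoA uA.
have /dprodP[_ defM _ _] := reflection_scalars_dprod M.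
have /mulsgP[r c rR cS Dgrc] : g \in (reflection_group M * scalars M)%g by rewrite defM inE.
exists r => //; rewrite -Dg Dgrc.
by rewrite (@red3_modelM _ M) (D4_red3_scalars cS) mulmx1.
Qed.

(** For D4 the scalar factor consists of the cube roots of unity, which is the kernel of reduction
    modulo theta. Hence R maps isomorphically onto all isometries, which in rank 2 are the matrices
    of determinant 1. *)
Lemma D4_reflection_group : reflection_group M \isog SL2_3.
Proof.
exact: (gl_isog (red3_model1 M) (@red3_modelM _ M) D4_red3_inj D4_red3_det D4_red3_surj).
Qed.

Lemma card_SL2_3_reflection_group : #|SL2_3| = #|reflection_group M|.
Proof.
exact: (gl_card (red3_model1 M) (@red3_modelM _ M) D4_red3_inj D4_red3_det D4_red3_surj).
Qed.
End D4Group.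

(** Read off from the isomorphism with the reflection group of D4, of order 72 / 3. It serves to
    find the order of the normal subgroup in the E6 case. *)
Lemma card_SL2_3 : #|SL2_3| = 24%N.
Proof.
rewrite (card_SL2_3_reflection_group (host_model D4)); apply/eqP.
rewrite -(eqn_pmul2r (isT : (0 < scalar_order D4)%N)) card_reflection_group.
by rewrite (card_model (host_model D4)).
Qed.

(** * E8 and the symplectic group *)

Section SymplecticBasis.
Variable K : comNzRingType.
Hypothesis char3 : 3%:R = 0 :> K.
Local Notation J := (block_mx 0 1%:M (- 1%:M) 0 : 'M[K]_(2 + 2)).
Local Notation H := (chain_mx (1 : K) 4).

(* Rows e0, e0 + e2, e1, e3: a symplectic basis for the reduced chain form. *)
Definition symplectic_basis : 'M[K]_4 := \matrix_(i, j)
  nth 0 (nth [::] [:: [:: 1; 0; 0; 0]; [:: 1; 0; 1; 0]; [:: 0; 1; 0; 0]; [:: 0; 0; 0; 1]] i) j.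

Definition symplectic_basis_inv : 'M[K]_4 := \matrix_(i, j)
  nth 0 (nth [::] [:: [:: 1; 0; 0; 0]; [:: 0; 0; 1; 0]; [:: -1; 1; 0; 0]; [:: 0; 0; 0; 1]] i) j.

Local Notation S := symplectic_basis.
Local Notation S' := symplectic_basis_inv.

Lemma symplectic_basisK : S *m S' = 1%:M.
Proof.
apply/matrixP => i j; rewrite !mxE !big_ord_recl big_ord0 !mxE.
case: i => [[|[|[|[|]]]]] // ?; case: j => [[|[|[|[|]]]]] // ?; rewrite /= ?mulr1n ?mulr0n; ring.
Qed.

Lemma symplectic_basisVK : S' *m S = 1%:M.
Proof. exact: mulmx1C symplectic_basisK. Qed.

Lemma symplectic_basis_gram : S *m H *m S^T = J.
Proof.
apply: (proj1 (@matrixP K (2 + 2) (2 + 2) (S *m H *m S^T) J)) => i j.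
case: (fintype.split_ordP i) => {}i ->; case: (fintype.split_ordP j) => {}j ->;
  rewrite ?block_mxEul ?block_mxEur ?block_mxEdl ?block_mxEdr;
  rewrite !mxE !big_ord_recl !big_ord0 !mxE !big_ord_recl !big_ord0 !mxE (theta1 char3);
  case: i => [[|[|]]] // ?; case: j => [[|[|]]] // ?; rewrite /= ?mulr1n ?mulr0n; ring.
Qed.

Lemma symplectic_basis_inv_gram : S' *m J *m S'^T = H.
Proof.
rewrite -symplectic_basis_gram !mulmxA symplectic_basisVK mul1mx -mulmxA -trmx_mul.
by rewrite symplectic_basisVK trmx1 mulmx1.
Qed.

Lemma symplectic_conj (A : 'M[K]_4) :
  isometry3 A <-> (S *m A *m S') *m J *m (S *m A *m S')^T = J.
Proof.
have eqJ : (S *m A *m S') *m J *m (S *m A *m S')^T = S *m (A *m H *m A^T) *m S^T.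
  by rewrite !trmx_mul -symplectic_basis_inv_gram !mulmxA.
rewrite eqJ; split=> [->|]; first exact: symplectic_basis_gram.
move=> eqA; rewrite /isometry3 -[RHS]symplectic_basis_inv_gram -eqA !mulmxA.
rewrite symplectic_basisVK mul1mx -!mulmxA -trmx_mul symplectic_basisVK trmx1.
by rewrite mulmx1.
Qed.
End SymplecticBasis.

(** Squaring absorbs the sign of a unit. In this form the lemma says which cube root of unity brings
    a determinant to 1 or -1. *)
Lemma eis_units u : eis_norm u = 1 -> exists2 m, (u * omega ^+ m) ^+ 2 = 1 & (m < 3)%N.
Proof.
case: u => a b; rewrite /eis_norm /= => n1.
have e4 : (2 * a - b) ^+ 2 + 3 * b ^+ 2 = 4.
  by transitivity (4%:Z * (a ^+ 2 - a * b + b ^+ 2)); [ring | rewrite n1].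
have small (x : int) : 3 * x ^+ 2 <= 4 -> [\/ x = -1, x = 0 | x = 1].
  case: x => [[|[|n]]|[|n]] // ; rewrite ?NegzE; try by [constructor 1 | constructor 2 | constructor 3].
    by rewrite -rmorphXn /= => h; exfalso; nia.
  by rewrite sqrrN -rmorphXn /= => h; exfalso; nia.
have b_small := small b; have a_small := small a.
have e4' : (2 * b - a) ^+ 2 + 3 * a ^+ 2 = 4.
  by transitivity (4%:Z * (a ^+ 2 - a * b + b ^+ 2)); [ring | rewrite n1].
have {}b_small : [\/ b = -1, b = 0 | b = 1].
  by apply: b_small; rewrite -e4 lerDr sqr_ge0.
have {}a_small : [\/ a = -1, a = 0 | a = 1].
  by apply: a_small; rewrite -e4' lerDr sqr_ge0.
by case: a_small b_small n1 {e4 e4' small} => -> [] -> // _;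
   [exists 1%N | exists 0%N | exists 2 | exists 2 | exists 0%N | exists 1%N].
Qed.

Section E8Group.
Variable M : unitary_model (chain_len E8).+1.
Local Notation mx := (@model_mx _ M).

(** The elements of determinant 1 or -1. In rank 4 the scalar omega has determinant omega^4 = omega,
    so this subgroup is a complement to the kernel of reduction modulo theta and maps isomorphically
    onto Sp_4(3). *)
Definition det_sqr1 : {set M} := [set g : M | (\det (mx g)) ^+ 2 == 1].

Lemma det_model_norm g : eis_norm (\det (mx g)) = 1.
Proof.
have: \det (mx g) * \det (mx g^-1%g) = 1 by rewrite -det_mulmx model_mxV det1.
move/(congr1 eis_norm); rewrite eis_normM.
move: (eis_norm_ge0 (\det (mx g))) (eis_norm_ge0 (\det (mx g^-1%g))).
case: (eis_norm _) => // m _; case: (eis_norm _) => // n _ /eqP.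
by rewrite -PoszM eqz_nat muln_eq1 => /andP[/eqP-> _].
Qed.

Lemma det_sqr1_group : group_set det_sqr1.
Proof.
apply/group_setP; split=> [|g g']; first by rewrite inE model_mx1 det1 expr1n.
rewrite !inE model_mxM det_mulmx exprMn => /eqP-> /eqP->.
by rewrite mul1r.
Qed.
Canonical det_sqr1_kernel := Group det_sqr1_group.

Definition omega_group : {group M} := <[scalar_elt M omega]>%G.

Lemma order_omega : #[scalar_elt M omega]%g = 3%N.
Proof.
apply: nt_prime_order => //; first by rewrite -scalar_eltX // scalar_elt1.
by apply/eqP; rewrite -(scalar_elt1 M) => /scalar_elt_inj; case/(_ erefl erefl).
Qed.

Lemma det_scalar m : \det (mx (scalar_elt M (omega ^+ m))) = omega ^+ m.
Proof.
rewrite scalar_eltE ?eis_norm_omegaX // det_scalar -exprM mulnC exprM.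
by rewrite (_ : omega ^+ (chain_len E8).+1 = omega) .
Qed.

Lemma det_sqr1_dprod : (omega_group \x det_sqr1)%g = [set: M].
Proof.
have cent : det_sqr1 \subset 'C(omega_group)%g.
  by rewrite centsC cycle_subG; apply/centP => g _; apply: scalar_eltC.
rewrite -[det_sqr1]/(det_sqr1_kernel : {set M}) dprodE //; last first.
  apply/trivgP/fintype.subsetP => g /setIP[/cycleP[m ->]].
  have x3 : (scalar_elt M omega ^+ 3 = 1)%g by rewrite -order_omega expg_order.
  rewrite -(expg_mod m x3).
  rewrite inE -scalar_eltX // det_scalar inE -(scalar_elt1 M).
  have : (m %% 3 < 3)%N by rewrite ltn_mod.
  by case: (m %% 3)%N => [|[|[|]]].
apply/eqP; rewrite finset.eqEsubset finset.subsetT; apply/fintype.subsetP => g _.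
have [m um _] := eis_units (det_model_norm g).
rewrite -(mulKg (scalar_elt M (omega ^+ m)) g); apply: mem_mulg.
  by rewrite groupV scalar_eltX // groupX ?cycle_id.
by rewrite inE model_mxM det_mulmx det_scalar mulrC um.
Qed.

Definition symplectic_mx (g : M) : 'M['F_3]_4 :=
  symplectic_basis _ *m red3 (mx g) *m symplectic_basis_inv _.

Lemma symplectic_mx1 : symplectic_mx 1%g = 1%:M.
Proof. by rewrite /symplectic_mx (red3_model1 M) mulmx1 symplectic_basisK. Qed.

Lemma symplectic_mxM g g' : symplectic_mx (g * g')%g = symplectic_mx g *m symplectic_mx g'.
Proof.
rewrite /symplectic_mx (red3_modelM g) -!mulmxA (mulmxA (symplectic_basis_inv _)).
by rewrite symplectic_basisVK mul1mx.
Qed.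

Lemma symplectic_mx_inj g : g \in det_sqr1 -> symplectic_mx g = 1%:M -> g = 1%g.
Proof.
move=> Kg g1; have r1 : red3 (mx g) = 1%:M.
  move/(congr1 (fun A => symplectic_basis_inv _ *m A *m symplectic_basis _)): g1.
  rewrite mulmx1 symplectic_basisVK !mulmxA symplectic_basisVK mul1mx -mulmxA.
  by rewrite symplectic_basisVK mulmx1.
have [m Dg _] := red3_model_ker r1; suff: g \in [1 M]%g by move/set1P.
have /dprodP[_ _ _ <-] := det_sqr1_dprod; rewrite inE Kg andbT Dg scalar_eltX //.
exact: groupX (cycle_id _).
Qed.

Lemma symplectic_mx_im g : g \in det_sqr1 ->
  symplectic_mx g *m (block_mx 0 1%:M (- 1%:M) 0 : 'M_(2 + 2)) *m (symplectic_mx g)^T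
  == (block_mx 0 1%:M (- 1%:M) 0 : 'M_(2 + 2)).
Proof.
by move=> _; apply/eqP/(symplectic_conj char_F3)/(@red3_model_isometry _ M).
Qed.

Lemma symplectic_mx_surj (A : 'M['F_3]_4) : A \in unitmx ->
    A *m (block_mx 0 1%:M (- 1%:M) 0 : 'M_(2 + 2)) *m A^T
    == (block_mx 0 1%:M (- 1%:M) 0 : 'M_(2 + 2)) ->
  exists2 g, g \in det_sqr1 & symplectic_mx g = A.
Proof.
move=> uA /eqP spA; pose B := symplectic_basis_inv _ *m A *m symplectic_basis _.
have DA : symplectic_basis _ *m B *m symplectic_basis_inv _ = A.
  rewrite /B !mulmxA symplectic_basisK mul1mx -mulmxA symplectic_basisK.
  by rewrite mulmx1.
have isoB : isometry3 B by apply/(symplectic_conj char_F3); rewrite DA.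
have uB : B \in unitmx.
  rewrite !unitmx_mul uA andbT.
  rewrite (unitmx_rinv (symplectic_basisVK _)) /=.
  exact: unitmx_rinv (symplectic_basisK _).
have [g Dg] := @red3_surj _ M B isoB uB.
have /dprodP[_ defM _ _] := det_sqr1_dprod.
have /mulsgP[z h /cycleP[m Dz] hK Dzh] : g \in (omega_group * det_sqr1)%g by rewrite defM inE.
exists h; first exact: hK.
rewrite -DA -Dg Dzh (red3_modelM z) Dz -(@scalar_eltX _ M omega m erefl).
by rewrite (red3_omega M) mul1mx.
Qed.

(** The scalar factor is trivial for E8, so R is the whole group, and the two direct factors come
    from splitting off the cube roots of unity by the determinant. *)
Lemma E8_reflection_group : reflection_group M \isog finset.setX (Zp 3) Sp4_3.
Proof.
have defR : reflection_group M = [set: M]%G.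
  apply: val_inj => /=; have := reflection_scalars_dprod M.
  have -> : scalars M = 1%G by apply/val_inj/card1_trivg/order_scalars.
  by rewrite dprodg1.
pose f := gl_morphism symplectic_mx1 symplectic_mxM det_sqr1_kernel.
have imf : (f @* det_sqr1_kernel)%g = Sp4_3.
  exact: (gl_morphism_im symplectic_mx1 symplectic_mxM symplectic_mx_im symplectic_mx_surj).
have injf : ('injm f)%g by apply: gl_morphism_inj; exact: symplectic_mx_inj.
rewrite defR -imf.
apply: isog_dprod det_sqr1_dprod (setX_dprod (Zp 3) (f @* det_sqr1_kernel)%G) _ _.
  rewrite -morphim_pairg1; apply: (isog_trans (isog_Zp_order order_omega)).
  by apply: sub_isog; rewrite ?finset.subsetT ?injm_pairg1.
rewrite -morphim_pair1g; apply: (@isog_trans _ _ _ _ (f @* det_sqr1_kernel)%G).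
  by apply: sub_isog.
by apply: sub_isog; rewrite ?finset.subsetT ?injm_pair1g.
Qed.
End E8Group.

(** * E6 and the extraspecial group *)

Section RadicalQuotient.
Variable K : comNzRingType.
Hypothesis char3 : 3%:R = 0 :> K.
Local Notation H3 := (chain_mx (1 : K) 3).
Local Notation H2 := (chain_mx (1 : K) 2).
Local Notation rho := (chain_row (1 : K) 3).

(* The quotient of F_3^3 by the radical, spanned by rho = (1, 0, 1), and the
   splitting of the projection by the span of the first two basis vectors. *)
Definition quo_incl : 'M[K]_(2, 3) := \matrix_(i, j)
  nth 0 (nth [::] [:: [:: 1; 0; 0]; [:: 0; 1; 0]] i) j.
Definition quo_proj : 'M[K]_(3, 2) := \matrix_(i, j)
  nth 0 (nth [::] [:: [:: 1; 0]; [:: 0; 1]; [:: -1; 0]] i) j.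

Local Notation A := quo_incl.
Local Notation B := quo_proj.

Lemma quo_inclK : A *m B = 1%:M.
Proof.
apply/matrixP => i j; rewrite !mxE !big_ord_recl big_ord0 !mxE.
by case: i => [[|[|]]] // ?; case: j => [[|[|]]] // ?; rewrite /= ?mulr1n ?mulr0n; ring.
Qed.

Lemma quo_projK : B *m A = 1%:M - delta_mx ord_max 0 *m rho.
Proof.
have th := theta1 char3.
apply/matrixP => i j; rewrite !mxE !big_ord_recl !big_ord0 !mxE.
case: i => [[|[|[|]]]] // ?; case: j => [[|[|[|]]]] // ?;
  rewrite /= -?val_eqE /= ?th ?mulr1n ?mulr0n; ring.
Qed.

Lemma rho_proj : rho *m B = 0.
Proof.
have th := theta1 char3.
apply/rowP => j; rewrite !mxE !big_ord_recl !big_ord0 !mxE.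
by case: j => [[|[|]]] // ?; rewrite /= ?th; ring.
Qed.

Lemma quo_incl_gram : A *m H3 *m A^T = H2.
Proof.
have th := theta1 char3.
apply/matrixP => i j; rewrite !mxE !big_ord_recl !big_ord0 !mxE !big_ord_recl !big_ord0 !mxE.
by case: i => [[|[|]]] // ?; case: j => [[|[|]]] // ?; rewrite /= ?th ?mulr1n ?mulr0n; ring.
Qed.

Lemma quo_proj_gram : B *m H2 *m B^T = H3.
Proof.
have th := theta1 char3.
apply/matrixP => i j; rewrite !mxE !big_ord_recl !big_ord0 !mxE !big_ord_recl !big_ord0 !mxE.
by case: i => [[|[|[|]]]] // ?; case: j => [[|[|[|]]]] // ?;
  rewrite /= ?th ?mulr1n ?mulr0n; ring.
Qed.

Lemma quo_isometry X : isometry3 X -> isometry3 (A *m X *m B).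
Proof.
move=> isoX; rewrite /isometry3 !trmx_mul.
transitivity (A *m (X *m (B *m H2 *m B^T) *m X^T) *m A^T); first by rewrite !mulmxA.
by rewrite quo_proj_gram isoX quo_incl_gram.
Qed.

Definition quo_row (s : seq nat) : seq nat :=
  [:: (nth 0 s 0 + 2 * nth 0 s 2) %% 3; nth 0 s 1]%N.

Lemma list_row_quo s : list_row K 3 s *m B = list_row K 2 (quo_row s).
Proof.
apply/rowP => j; rewrite !mxE !big_ord_recl big_ord0 !mxE.
case: j => [[|[|]]] // ?; rewrite /= ?(natr_mod3 char3); last by ring.
by rewrite natrD natrM (two_char3 char3); ring.
Qed.

(** Turns the comparison of a word in rank 3 with a word in rank 2 into an evaluation on lists. *)
Lemma quo_word ls3 ls2 :
    all (fun i => quo_row (foldl (fun s l => letter_act 3 l s) (unit_vector 3 i) ls3)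
                  == foldl (fun s l => letter_act 2 l s) (unit_vector 2 i) ls2) (iota 0 2) ->
  A *m word_mx K 3 ls3 *m B = word_mx K 2 ls2.
Proof.
move/allP=> eq_ls; apply/row_matrixP => i; rewrite !row_mul.
have -> : row i A = list_row K 3 (unit_vector 3 i).
  apply/rowP => j; rewrite !mxE nth_mkseq //.
  by case: i => [[|[|]]] // ?; case: j => [[|[|[|]]]] // ?; rewrite /= ?mulr1n ?mulr0n.
rewrite -(list_row_word char3) ?size_mkseq // list_row_quo (eqP (eq_ls i _)); last first.
  by rewrite mem_iota ltn_ord.
rewrite (list_row_word char3) ?size_mkseq // [RHS]rowE; congr (_ *m _).
by apply/rowP => j; rewrite !mxE nth_mkseq // eqxx -val_eqE /=; case: (_ == _).
Qed.

(* The entry condition says that A *m X has its rows in the span of the first two vectors. *)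
Lemma quo_fix X : A *m X *m B = 1%:M -> rho *m X = rho ->
  A *m X *m (delta_mx ord_max 0 : 'cV_3) = 0 -> X = 1%:M.
Proof.
move=> X1 rX Xe; have e1 : B *m A + delta_mx ord_max 0 *m rho = 1%:M.
  by rewrite quo_projK subrK.
have AX : A *m X = A.
  by rewrite -[LHS]mulmx1 -e1 mulmxDr !mulmxA X1 Xe mul1mx mul0mx addr0.
by rewrite -[LHS]mul1mx -{1}e1 mulmxDl -!mulmxA AX rX e1.
Qed.
End RadicalQuotient.

(** An invertible isometry preserves the radical, and by [chain_mx_ker] the radical is the line
    through [chain_row]. *)
Lemma radical_isometry (F : fieldType) n (X : 'M[F]_n.+1) :
    isometry3 X -> X \in unitmx -> chain_row (1 : F) n.+1 *m chain_mx 1 n.+1 = 0 ->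
  exists c, chain_row (1 : F) n.+1 *m X = c *: chain_row 1 n.+1.
Proof.
move=> isoX uX rH; have rXH : chain_row (1 : F) n.+1 *m X *m chain_mx 1 n.+1 = 0.
  rewrite -[LHS](mulmxK (_ : X^T \in unitmx)) ?unitmx_tr // -!mulmxA.
  by rewrite (mulmxA X) (mulmxA _ X^T) isoX mulmxA rH mul0mx.
by have [-> _] := chain_mx_ker (etrans rXH (esym (scale0r _))); eexists.
Qed.

Lemma chain_coef3 (K : comNzRingType) : 3%:R = 0 :> K -> chain_coef (1 : K) 3 = 0.
Proof. by move=> char3; rewrite !chain_coefSS /= (theta1 char3); ring. Qed.

Lemma seq_mx_row_word t (M : unitary_model (chain_len t).+1) s ls :
    size s = (chain_len t).+1 -> all (fun l => l < (chain_len t).+1)%N ls ->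
  seq_mx_row _ (foldl (fun s l => triflection_act (chain_len t).+1 l s) s ls)
  = seq_mx_row _ s *m model_mx (word_elt M ls).
Proof.
elim: ls s => [|l ls IH] s sz /=; first by rewrite model_mx1 mulmx1.
case/andP=> ltl ltls; rewrite IH ?size_mkseq // model_mxM mulmxA.
rewrite /letter_elt insubT /= triflection_eltE.
by rewrite (seq_mx_row_triflection (Ordinal ltl)).
Qed.

Section E6Group.
Variable M : unitary_model (chain_len E6).+1.
Local Notation mx := (@model_mx _ M).
Local Notation R := (reflection_group M).
Local Notation x0 := (chain_row omega 3).

Definition quo_mx (g : M) : 'M['F_3]_2 := quo_incl _ *m red3 (mx g) *m quo_proj _.

Lemma quo_mx1 : quo_mx 1%g = 1%:M.
Proof. by rewrite /quo_mx (red3_model1 M) mulmx1 quo_inclK. Qed.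

Lemma red3_radical g : exists c, chain_row 1 3 *m red3 (mx g) = c *: chain_row 1 3.
Proof.
apply: radical_isometry; first exact: (@red3_model_isometry _ M).
  exact: unitmx_rinv (@red3_modelV _ M g).
by rewrite chain_row_mul (chain_coef3 char_F3) scale0r.
Qed.

(** The product of [quo_proj] and [quo_incl] is the identity only up to the radical; isometries
    preserve the radical and [quo_proj] kills it, so the error term disappears. *)
Lemma quo_mxM g g' : quo_mx (g * g')%g = quo_mx g *m quo_mx g'.
Proof.
rewrite /quo_mx (@red3_modelM _ M) -!mulmxA (mulmxA (quo_proj _)) (quo_projK char_F3).
have [c rg'] := red3_radical g'; rewrite mulmxBl mul1mx -!mulmxA (mulmxA (chain_row _ _)).
by rewrite rg' -scalemxAl (rho_proj char_F3) scaler0 mulmx0 subr0.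
Qed.

Lemma quo_mx_det g : \det (quo_mx g) == 1.
Proof.
apply/eqP/(isometry3_det2 _ char_F3)/(quo_isometry char_F3).
exact: (@red3_model_isometry _ M).
Qed.

Lemma quo_mx_word ls3 ls2 :
    all (fun i => quo_row (foldl (fun s l => letter_act 3 l s) (unit_vector 3 i) ls3)
                  == foldl (fun s l => letter_act 2 l s) (unit_vector 2 i) ls2) (iota 0 2) ->
  quo_mx (word_elt M ls3) = word_mx 'F_3 2 ls2.
Proof. by move=> eq_ls; rewrite /quo_mx (red3_word M) (quo_word char_F3 eq_ls). Qed.

(** The vector [x0] is theta times the glue vector and is orthogonal to the first two chain roots.
    Its stabiliser therefore contains their triflections, and it is the complement SL_2(3), a copy
    of the reflection group of D4. *)
Definition E6_stab_set : {set M} := [set g : M | x0 *m mx g == x0].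

Lemma E6_stab_group_set : group_set E6_stab_set.
Proof.
apply/group_setP; split=> [|g g']; first by rewrite inE model_mx1 mulmx1.
by rewrite !inE model_mxM mulmxA => /eqP-> /eqP->.
Qed.
Canonical E6_stab := Group E6_stab_group_set.

Lemma E6_stabP g : reflect (x0 *m mx g = x0) (g \in E6_stab).
Proof. by rewrite inE; apply: eqP. Qed.

Lemma E6_stab_sub : E6_stab \subset R.
Proof.
rewrite reflection_group_eq; apply/fintype.subsetP => g /E6_stabP gx.
by apply/disc_kernelP; exists 0; rewrite gx subrr scaler0.
Qed.

(** Products with [x0] see only the last coordinate, so an automorphism that fixes [x0] preserves
    the span of the first two chain roots. *)
Lemma E6_stab_col g i : g \in E6_stab -> i != ord_max -> mx g i ord_max = 0.
Proof.
move=> /E6_stabP gx neqi.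
have skx (x : 'rV_3) : skew x0 x = theta_of omega * eis_conj (x 0 ord_max).
  by rewrite /skew chain_row_mul -scalemxAl -rowE !mxE.
have := unitary_skew x0 (delta_mx 0 i) (model_mx_unitary g).
rewrite gx !skx -rowE [row _ _ _ _]mxE [delta_mx _ _ _ _]mxE eqxx eq_sym (negbTE neqi) /=.
rewrite mulr0 mulrC => /eis_mulf_eq0/(_ isT) /(congr1 eis_conj).
by rewrite eis_conjK.
Qed.

Lemma red3_chain_row g : g \in E6_stab -> chain_row 1 3 *m red3 (mx g) = chain_row 1 3.
Proof.
move/E6_stabP/(congr1 (@red3 _ _)); rewrite /red3 map_mxM.
have -> : map_mx (eis_ev (cube_root1 char_F3)) x0 = chain_row 1 3.
  by apply/rowP => j; rewrite !mxE map_chain_coef /= eis_ev_omega.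
by [].
Qed.

(** Modulo theta such a g fixes the radical, acts trivially on the quotient and preserves the chosen
    complement, so it reduces to 1 and is a scalar; a scalar that fixes [x0] is 1. *)
Lemma quo_mx_inj g : g \in E6_stab -> quo_mx g = 1%:M -> g = 1%g.
Proof.
move=> Hg g1; have r1 : red3 (mx g) = 1%:M.
  apply: (quo_fix char_F3 g1); first exact: red3_chain_row.
  rewrite -mulmxA -colE; apply/colP => i; rewrite !mxE !big_ord_recl big_ord0 !mxE.
  have ev0 : eis_ev (cube_root1 char_F3) 0 = 0 by apply: rmorph0.
  rewrite (E6_stab_col (i := ord0) Hg) // (E6_stab_col (i := lift ord0 ord0) Hg) // ev0.
  by case: i => [[|[|]]] // ?; rewrite /= !mul0r !addr0 ?mulr0 ?add0r.
have [m Dg ltm] := red3_model_ker r1.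
have /E6_stabP := Hg; rewrite Dg scalar_eltE ?eis_norm_omegaX // mul_mx_scalar.
move/rowP/(_ ord0); rewrite !mxE mulr1 => om1.
by rewrite om1 (scalar_elt1 M).
Qed.

Lemma triflection_elt_stab (i : 'I_3) : i != ord_max -> triflection_elt M i \in E6_stab.
Proof.
move=> neqi; apply/E6_stabP; rewrite triflection_eltE mul_triflection_mx chain_row_mul.
by rewrite !mxE eqxx (negbTE neqi) !mulr0 scale0r addr0.
Qed.

Lemma letter_elt_stab l : (l < 2)%N -> letter_elt M l \in E6_stab.
Proof.
move=> ltl; rewrite /letter_elt insubT /=; first by apply: ltn_trans ltl _.
by move=> ltl3; apply: triflection_elt_stab; rewrite -val_eqE /= ltn_eqF.
Qed.

Lemma word_elt_stab ls : all (fun l => l < 2)%N ls -> word_elt M ls \in E6_stab.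
Proof.
elim: ls => [|l ls IH] /=; first by rewrite group1.
by case/andP=> ltl /IH Hls; apply: groupM; first exact: letter_elt_stab.
Qed.

Lemma quo_mx_surj (A : 'M['F_3]_2) : A \in unitmx -> \det A == 1 ->
  exists2 g, g \in E6_stab & quo_mx g = A.
Proof.
move=> uA /eqP/(isometry3_det2 _ char_F3) isoA.
have [|ls Dls] := isometry_word (isT : (0 < 2 <= 4)%N) isoA.
  by exists (invmx A); rewrite mulmxV.
suff [g Hg Dg] : exists2 g, g \in E6_stab & quo_mx g = word_mx 'F_3 2 ls.
  exists g^-1%g; first by rewrite groupV.
  have : quo_mx g *m quo_mx g^-1%g = 1%:M by rewrite -quo_mxM mulgV quo_mx1.
  by rewrite Dg => eq1; rewrite -[LHS]mul1mx -Dls -mulmxA eq1 mulmx1.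
elim: ls {Dls} => [|l ls [g Hg Dg]]; first by exists 1%g; rewrite ?group1 ?quo_mx1.
suff [h Hh Dh] : exists2 h, h \in E6_stab & quo_mx h = letter_mx 'F_3 2 l.
  by exists (h * g)%g; rewrite ?groupM // quo_mxM Dh Dg.
have word1 l' : word_mx 'F_3 2 [:: l'] = letter_mx 'F_3 2 l' by rewrite /= mulmx1.
have [ltl|gel] := ltnP l 2.
  exists (word_elt M [:: l]); first by apply: word_elt_stab; rewrite /= ltl.
  by rewrite (@quo_mx_word _ [:: l]) ?word1 //; case: l ltl => [|[|]].
(* The cube of the Coxeter element of the subchain of type D4 acts as -1 on the quotient. *)
exists (word_elt M [:: 0; 1; 0; 1; 0; 1]%N); first exact: word_elt_stab.
have -> : letter_mx 'F_3 2 l = letter_mx 'F_3 2 2.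
  by rewrite /letter_mx !insubF // ltnNge gel.
by rewrite (@quo_mx_word _ [:: 2]%N) ?word1.
Qed.

Lemma E6_stab_isog : E6_stab \isog SL2_3.
Proof.
apply: (gl_isog quo_mx1 quo_mxM quo_mx_inj _ quo_mx_surj).
by move=> g _; apply: quo_mx_det.
Qed.

Lemma E6_reflection_group : is_3_1_2_SL2_3 R.
Proof.
pose f := gl_morphism quo_mx1 quo_mxM R.
pose P := ('ker f)%G.
have nPH : E6_stab \subset 'N(P)%g.
  apply: fintype.subset_trans E6_stab_sub _; exact: normal_norm (ker_normal f).
have PP g : reflect (g \in R /\ quo_mx g = 1%:M) (g \in P).
  apply: (iffP idP) => [|[Rg g1]].
    rewrite inE => /andP[Rg]; rewrite inE => /set1P g1; split=> //.
    by have -> : quo_mx g = val (f g); [by [] | rewrite g1].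
  by rewrite inE Rg inE; apply/set1P/val_inj.
have trivPH : P :&: E6_stab = 1%g.
  apply/trivgP/fintype.subsetP => g /setIP[/PP[_ g1] Hg]; apply/set1P.
  exact: quo_mx_inj.
have defR : (P ><| E6_stab)%g = R.
  rewrite sdprodE //; apply/eqP; rewrite finset.eqEsubset mul_subG ?E6_stab_sub //=; last first.
    exact: normal_sub (ker_normal f).
  apply/fintype.subsetP => g Rg.
  have uqg : quo_mx g \in unitmx.
    by apply: (@unitmx_rinv _ _ _ (quo_mx g^-1%g)); rewrite -quo_mxM mulgV quo_mx1.
  have [h Hh Dh] := quo_mx_surj uqg (quo_mx_det g).
  rewrite -(mulgKV h g); apply: mem_mulg => //; apply/PP; split.
    by rewrite groupM // groupV (fintype.subsetP E6_stab_sub).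
  by rewrite quo_mxM -Dh -quo_mxM mulgV quo_mx1.
have cardH : #|E6_stab| = 24%N.
  rewrite -card_SL2_3; apply/esym.
  apply: (gl_card quo_mx1 quo_mxM quo_mx_inj _ quo_mx_surj).
  by move=> g _; apply: quo_mx_det.
have cardP : #|P| = 27%N.
  have cardR : (#|R| * 2 = 3 * 432)%N.
    exact: etrans (card_reflection_group M) (card_model M).
  have := sdprod_card defR; rewrite cardH => cardPH.
  have : (#|P| * 24 * 2 = 3 * 432)%N by rewrite cardPH.
  by move: #|_| => p; lia.
exists P, E6_stab; split=> //; last exact: E6_stab_isog.
apply: (@p3group_extraspecial 3); rewrite ?cardP //; first by rewrite /pgroup cardP.
(* Modulo the radical the outer roots b_0 and b_2 are opposite, so their triflections agree there
   and a = s_0 s_2^(-1) lies in P; b is the conjugate of a by s_1. That they do not commute is seen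
   in one matrix entry. *)
pose a := word_elt M [:: 0; 2; 2]%N; pose b := word_elt M [:: 1; 0; 2; 2; 1; 1]%N.
have wordR ls : all (fun l => l < 3)%N ls -> word_elt M ls \in R.
  elim: ls => [|l ls IH] /=; first by rewrite group1.
  case/andP=> ltl /IH Rls; apply: groupM => //; rewrite /letter_elt.
  by case: insubP => [i _ _|/negP[]]; first exact: (triflection_elt_in M).
have Pa : a \in P.
  by apply/PP; split; [exact: wordR | rewrite (@quo_mx_word _ [::])].
have Pb : b \in P.
  by apply/PP; split; [exact: wordR | rewrite (@quo_mx_word _ [::])].
apply/negP => /centsP/(_ a Pa b Pb).
move/(congr1 (fun g => seq_mx_row 3 [:: 1; 0; 0] *m mx g)).
have word_cat ls ls' : (word_elt M ls * word_elt M ls')%g = word_elt M (ls ++ ls').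
  elim: ls => [|l ls IH]; first exact: mul1g.
  by rewrite /= -IH; apply/esym/mulgA.
rewrite !word_cat -!(@seq_mx_row_word _ M) //.
move/rowP/(_ ord_max); rewrite !mxE => /eqP; apply/negP.
by vm_compute.
Qed.
End E6Group.

(** * Chains in Hermitian spaces *)

Section HermitianForm.
Variables (C : numClosedFieldType) (V : vectType C) (h : {hermitian_sym V for conjC}).

Lemma herm_addl x y z : h (x + y) z = h x z + h y z. Proof. exact: linearDl. Qed.
Lemma herm_scalel a x z : h (a *: x) z = a * h x z. Proof. exact: linearZl_LR. Qed.
Lemma herm_conj x y : h x y = (h y x)^*.
Proof. by have := hermC h x y; rewrite expr0 mul1r. Qed.
Lemma herm_addr x y z : h z (x + y) = h z x + h z y. Proof. exact: linearDr. Qed.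
Lemma herm_scaler a x z : h z (a *: x) = a^* * h z x.
Proof. by rewrite herm_conj herm_scalel rmorphM /= -herm_conj. Qed.
Lemma herm_oppl x z : h (- x) z = - h x z. Proof. exact: linearNl. Qed.
Lemma herm_0l z : h 0 z = 0. Proof. exact: linear0l. Qed.
Lemma herm_0r z : h z 0 = 0. Proof. exact: linear0r. Qed.
Lemma herm_suml I r (P : pred I) (F : I -> V) z :
  h (\sum_(i <- r | P i) F i) z = \sum_(i <- r | P i) h (F i) z.
Proof. exact: linear_sumlz. Qed.
Lemma herm_sumr I r (P : pred I) (F : I -> V) z :
  h z (\sum_(i <- r | P i) F i) = \sum_(i <- r | P i) h z (F i).
Proof. exact: linear_sumr. Qed.
End HermitianForm.

Section ComplexEvaluation.
Variables (C : numClosedFieldType) (w : C).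
Hypothesis hw : 3.-primitive_root w.

Lemma primitive_cube_root : cube_root_eq w.
Proof.
have w1 : w - 1 != 0.
  rewrite subr_eq0; apply/negP => /eqP w1; have := eq_prim_root_expr hw 0 1.
  by rewrite w1 !expr1n eqxx.
apply: (mulfI w1); rewrite mulr0; have := prim_expr_order hw => w3.
by transitivity (w ^+ 3 - 1); [ring | rewrite w3 subrr].
Qed.
Local Notation w_root := primitive_cube_root.

Lemma conj_cube_root : w^* = w ^+ 2.
Proof.
have w3 := prim_expr_order hw.
have nw : `|w| = 1.
  have /eqP := congr1 Num.norm w3; rewrite normrX normr1 pexprn_eq1 //.
  by move/eqP.
have w0 : w != 0 by rewrite -normr_eq0 nw oner_eq0.
apply: (mulfI w0); rewrite -normCK nw expr1n -w3.
by ring.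
Qed.

Definition ev : eisint -> C := eis_ev w_root.
HB.instance Definition _ := GRing.RMorphism.on ev.

Lemma ev_omega : ev omega = w. Proof. exact: eis_ev_omega. Qed.

Lemma eis_theta_ev : eis_theta w = theta_of w.
Proof.
rewrite /eis_theta /theta_of conj_cube_root (cube_root_sqr w_root).
by ring.
Qed.

Lemma ev_theta : ev (theta_of omega) = theta_of w.
Proof. by rewrite [LHS](map_theta ev) /= ev_omega. Qed.

Lemma eisP z : eis w z <-> exists x, z = ev x.
Proof.
by split=> [[a [b ->]]|[[a b] ->]]; [exists (Eisint a b) | exists a, b].
Qed.

Lemma eis_ev_in x : eis w (ev x). Proof. by apply/eisP; exists x. Qed.

Lemma ev_conj x : ev (eis_conj x) = (ev x)^*.
Proof.
case: x => a b; rewrite /ev /eis_ev /= [RHS]rmorphD [X in _ = _ + X]rmorphM !rmorph_int /=.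
by rewrite conj_cube_root (cube_root_sqr w_root) rmorphB rmorphN /=; ring.
Qed.

Lemma ev_int n : ev (Eisint n 0) = n%:~R. Proof. by rewrite /ev /eis_ev mul0r addr0. Qed.

Lemma ev_norm x : ev x * (ev x)^* = (eis_norm x)%:~R.
Proof. by rewrite -ev_conj -rmorphM /= -eis_normE ev_int. Qed.

Lemma ev_eq0 x : ev x = 0 -> x = 0.
Proof.
move=> x0; have := ev_norm x; rewrite x0 mul0r => /esym/eqP.
by rewrite intr_eq0 eis_norm_eq0 => /eqP.
Qed.

Lemma ev_inj : injective ev.
Proof. by move=> x y /eqP; rewrite -subr_eq0 -rmorphB /= => /eqP/ev_eq0/eqP; rewrite subr_eq0 => /eqP. Qed.

Lemma theta_neq0 : theta_of w != 0.
Proof. by rewrite -ev_theta; apply/eqP => /ev_eq0. Qed.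

Lemma conj_theta_of : (theta_of w)^* = - theta_of w.
Proof. exact: (conj_theta w_root (c := conjC) conj_cube_root). Qed.

Lemma theta_sqr : theta_of w * theta_of w = - 3.
Proof.
rewrite /theta_of; transitivity (4 * (w ^+ 2 + w + 1) - 3); first by ring.
by rewrite w_root mulr0 add0r.
Qed.
End ComplexEvaluation.

Section Chain.
Variables (C : numClosedFieldType) (w : C).
Hypothesis hw : 3.-primitive_root w.
Variables (V : vectType C) (h : {hermitian_sym V for conjC}) (t : root_type).
Local Notation k := (chain_len t).+1.
Local Notation theta := (theta_of w).
Local Notation H := (chain_mx w k).
Local Notation evm := (map_mx (ev hw)).

(** Roots are indexed by all natural numbers, with only the first k constrained, so that lengthening
    a chain does not change its type. *)
Definition chain (b : nat -> V) :=
  forall i j : 'I_k, h (b i) (b j) = theta * H i j.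

Definition comb (b : nat -> V) (x : 'rV[C]_k) : V := \sum_(i < k) x 0 i *: b i.

Definition chain_lattice (b : nat -> V) : set V :=
  fun v => exists x : 'rV[eisint]_k, v = comb b (evm x).

Lemma combD b x y : comb b (x + y) = comb b x + comb b y.
Proof. by rewrite -big_split; apply: eq_bigr => i _; rewrite mxE scalerDl. Qed.

Lemma combZ b a x : comb b (a *: x) = a *: comb b x.
Proof. by rewrite scaler_sumr; apply: eq_bigr => i _; rewrite mxE scalerA. Qed.

Lemma combN b x : comb b (- x) = - comb b x.
Proof. by rewrite -scaleN1r combZ scaleN1r. Qed.

Lemma combB b x y : comb b (x - y) = comb b x - comb b y.
Proof. by rewrite combD combN. Qed.

Lemma comb0 b : comb b 0 = 0.
Proof. by rewrite -(subrr 0) combB subrr. Qed.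

Lemma comb_delta (b : nat -> V) (i : 'I_k) : comb b (delta_mx 0 i) = b i.
Proof.
rewrite /comb (bigD1 i) //= mxE !eqxx scale1r big1 ?addr0 // => j nji.
by rewrite mxE (negbTE nji) andbF scale0r.
Qed.

Lemma evm_delta (i : 'I_k) : evm (delta_mx 0 i) = delta_mx 0 i :> 'rV_k.
Proof. exact: map_delta_mx. Qed.

Lemma evm_chain : evm (chain_mx omega k) = H.
Proof. by rewrite map_chain_mx /= ev_omega. Qed.

Lemma evm_chain_row : evm (chain_row omega k) = chain_row w k.
Proof. by apply/rowP => j; rewrite !mxE map_chain_coef /= ev_omega. Qed.

Lemma ev_chain_coef n : ev hw (chain_coef omega n) = chain_coef w n.
Proof. by rewrite [LHS](map_chain_coef (ev hw)) /= ev_omega. Qed.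

Lemma evm_inj m n : injective (map_mx (ev hw) : 'M_(m, n) -> 'M_(m, n)).
Proof.
move=> A B /matrixP eqAB; apply/matrixP => i j; have := eqAB i j.
by rewrite !mxE => /ev_inj.
Qed.

Lemma chain_coef_ev_neq0 : chain_coef w k != 0.
Proof.
rewrite -ev_chain_coef; apply/eqP => /ev_eq0/eqP.
by rewrite (negbTE (chain_coef_neq0 t)).
Qed.

Lemma chain_mx_ev_unit : H \in unitmx.
Proof. exact/chain_mx_unit/chain_coef_ev_neq0. Qed.

Lemma chain_latticeD b x y : chain_lattice b x -> chain_lattice b y -> chain_lattice b (x + y).
Proof. by case=> x' -> [y' ->]; exists (x' + y'); rewrite map_mxD combD. Qed.

Lemma chain_latticeZ b a x : chain_lattice b x -> chain_lattice b (ev hw a *: x).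
Proof. by case=> x' ->; exists (a *: x'); rewrite map_mxZ combZ. Qed.

Lemma chain_latticeN b x : chain_lattice b x -> chain_lattice b (- x).
Proof. by case=> x' ->; exists (- x'); rewrite map_mxN combN. Qed.

Lemma chain_latticeB b x y : chain_lattice b x -> chain_lattice b y -> chain_lattice b (x - y).
Proof. by move=> Lx Ly; apply/chain_latticeD/chain_latticeN. Qed.

Lemma chain_lattice0 b : chain_lattice b 0.
Proof. by exists 0; rewrite map_mx0 comb0. Qed.

Lemma chain_lattice_basis (b : nat -> V) (i : 'I_k) : chain_lattice b (b i).
Proof. by exists (delta_mx 0 i); rewrite evm_delta comb_delta. Qed.

Lemma chain_lattice_span b (S : set V) : (S `<=` chain_lattice b)%classic ->
  (span_over (eis w) S `<=` chain_lattice b)%classic.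
Proof.
move=> subS _ [n [a [v [aE vS ->]]]]; elim/big_ind: _ => [|x y|i _].
- exact: chain_lattice0.
- exact: chain_latticeD.
by have /eisP[a' ->] := aE i; apply/chain_latticeZ/subS.
Qed.

Lemma sub_chain_lattice_span (b : nat -> V) (S : set V) : (forall i : 'I_k, S (b i)) ->
  (chain_lattice b `<=` span_over (eis w) S)%classic.
Proof.
move=> Sb _ [x ->]; exists k, (fun i => evm x 0 i), b; split=> // i.
by rewrite mxE; apply: eis_ev_in.
Qed.

Section WithChain.
Variable b : nat -> V.
Hypothesis chain_b : chain b.

Lemma herm_comb x y : h (comb b x) (comb b y) = theta * (x *m H *m (map_mx conjC y)^T) 0 0.
Proof.
rewrite herm_suml mxE mulr_sumr.
under eq_bigr => i _ do rewrite herm_scalel herm_sumr mulr_sumr.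
rewrite exchange_big; apply: eq_bigr => j _ /=; rewrite !mxE mulr_suml mulr_sumr.
apply: eq_bigr => i _; rewrite herm_scaler chain_b.
by ring.
Qed.

Lemma herm_comb_basis x (j : 'I_k) : h (comb b x) (b j) = theta * (x *m H) 0 j.
Proof.
rewrite -comb_delta herm_comb; congr (_ * _).
by rewrite map_delta_mx trmx_delta -colE mxE.
Qed.

(** Coordinates are computed from the products with the chain roots. They are thus defined on all of
    V, and [comb b] of them is the orthogonal projection to the span of the chain. *)
Definition coord v : 'rV[C]_k := (\row_j (theta^-1 * h v (b j))) *m invmx H.

Lemma combK : cancel (comb b) coord.
Proof.
move=> x; rewrite /coord (_ : \row_j _ = x *m H) ?mulmxK ?chain_mx_ev_unit //.
by apply/rowP => j; rewrite mxE herm_comb_basis mulKf // theta_neq0.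
Qed.

Lemma comb_inj : injective (comb b). Proof. exact: can_inj combK. Qed.

Lemma coord_chain v j : theta * (coord v *m H) 0 j = h v (b j).
Proof. by rewrite mulmxKV ?chain_mx_ev_unit // mxE mulVKf // theta_neq0. Qed.

Lemma coordD x y : coord (x + y) = coord x + coord y.
Proof.
rewrite /coord -mulmxDl; congr (_ *m _); apply/rowP => j.
by rewrite !mxE herm_addl mulrDr.
Qed.

Lemma coordZ a x : coord (a *: x) = a *: coord x.
Proof.
rewrite /coord scalemxAl; congr (_ *m _); apply/rowP => j.
by rewrite !mxE herm_scalel mulrCA.
Qed.

Definition chain_proj v := comb b (coord v).

Lemma chain_proj_orth v (j : 'I_k) : h (v - chain_proj v) (b j) = 0.
Proof. by rewrite herm_addl herm_oppl herm_comb_basis coord_chain subrr. Qed.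

Lemma chain_free : free (mkseq b k).
Proof.
have szE : size (mkseq b k) = k by apply: size_mkseq.
rewrite -[X in free X]in_tupleE; apply/freeP => c; rewrite /= => c0.
pose x : 'rV[C]_k := \row_j c (cast_ord (esym szE) j).
suff x0 : x = 0.
  move=> i; have /rowP/(_ (cast_ord szE i)) := x0; rewrite !mxE => <-.
  by congr c; apply: val_inj.
apply: comb_inj; rewrite comb0 -[RHS]c0 (reindex (cast_ord (esym szE))) /=; last first.
  by exists (cast_ord szE) => i _; apply: val_inj.
by apply: eq_bigr => i _; rewrite mxE nth_mkseq.
Qed.

Lemma chain_lattice_herm x y : chain_lattice b x -> chain_lattice b y ->
  exists a, h x y = theta * ev hw a.
Proof.
case=> x' -> [y' ->]; exists (skew x' y'); rewrite herm_comb; congr (_ * _).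
rewrite /skew; have -> : ev hw ((x' *m chain_mx omega k *m (map_mx eis_conj y')^T) 0 0)
    = (evm (x' *m chain_mx omega k *m (map_mx eis_conj y')^T)) 0 0 by rewrite [RHS]mxE.
rewrite !map_mxM evm_chain; congr ((_ *m _) 0 0).
by apply/matrixP => i j; rewrite !mxE /= ev_conj.
Qed.

Lemma chain_lattice_norm x : chain_lattice b x -> exists n : int, h x x = (3 * n)%:~R.
Proof.
case=> x' ->; exists (third_norm x'); rewrite herm_comb -(ev_int hw) -third_normE.
rewrite rmorphM /= ev_theta; congr (_ * _); rewrite /skew.
have -> : ev hw ((x' *m chain_mx omega k *m (map_mx eis_conj x')^T) 0 0)
    = (evm (x' *m chain_mx omega k *m (map_mx eis_conj x')^T)) 0 0 by rewrite [RHS]mxE.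
rewrite !map_mxM evm_chain; congr ((_ *m _) 0 0).
by apply/matrixP => i j; rewrite !mxE /= ev_conj.
Qed.
End WithChain.
End Chain.

(** Up to units d is theta, 2, theta, 1. The nonzero classes modulo theta are those of 1 and -1,
    modulo 2 those of 1, omega and omega^2, and modulo 1 there are none. *)
Lemma discriminant_unit t (be : eisint) : ~ (exists y, be = chain_coef omega (chain_len t).+1 * y) ->
  exists2 u, eis_norm u = 1 & exists y, be = u + chain_coef omega (chain_len t).+1 * y.
Proof.
have modtheta x : (exists2 u, eis_norm u = 1 & exists y, x = u + theta_of omega * y)
    \/ exists y, x = theta_of omega * y.
  have ev3_val : [\/ eis_ev (cube_root1 char_F3) x = 0, eis_ev (cube_root1 char_F3) (x - 1) = 0
                   | eis_ev (cube_root1 char_F3) (x - -1) = 0].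
    rewrite !rmorphB !rmorphN !rmorph1 /=; move: (eis_ev _ x) => z.
    by case: z => [[|[|[|]]]] // ?; [constructor 1 | constructor 2 | constructor 3];
      apply: val_inj.
  case: ev3_val => /eis_ev3_eq0[y Dy]; [by right; exists y | left; exists 1 | left; exists (-1)] => //.
    by exists y; rewrite -Dy addrC subrK.
  by exists y; rewrite -Dy addrC subrK.
case: t => /= ndvd.
- case: (modtheta be) => [[u nu [y ->]]|[y Dy]].
    by exists u => //; exists (- y); rewrite mulrN mulNr opprK.
  by case: ndvd; exists (- y); rewrite mulrN mulNr opprK.
- have d2 : 1 - theta_of omega * - theta_of omega = -2 by [].
  rewrite d2 in ndvd *; case: be ndvd => a b ndvd.
  pose qa := (a %/ 2)%Z; pose qb := (b %/ 2)%Z; pose ra := (a %% 2)%Z; pose rb := (b %% 2)%Z.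
  have Da : a = qa * 2 + ra := divz_eq a 2; have Db : b = qb * 2 + rb := divz_eq b 2.
  have : 0 <= ra < 2 by rewrite modz_ge0 ?ltz_pmod.
  have : 0 <= rb < 2 by rewrite modz_ge0 ?ltz_pmod.
  move: qa qb ra rb Da Db => qa qb ra rb Da Db rb2 ra2; rewrite Da Db in ndvd *.
  have dec : Eisint (qa * 2 + ra) (qb * 2 + rb) = Eisint ra rb + -2 * Eisint (- qa) (- qb).
    change (Eisint (qa * 2 + ra) (qb * 2 + rb) =
      Eisint (ra + (- (2) * - qa - 0 * - qb)) (rb + (- (2) * - qb + 0 * - qa - 0 * - qb))).
    by congr Eisint; lia.
  have [ra0 | ra1] : ra = 0 \/ ra = 1 by lia.
    have [rb0 | rb1] : rb = 0 \/ rb = 1 by lia.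
      by case: ndvd; exists (Eisint (- qa) (- qb)); rewrite dec ra0 rb0 [LHS]add0r.
    by exists (Eisint ra rb); [rewrite ra0 rb1 | exists (Eisint (- qa) (- qb)); apply: dec].
  have [rb0 | rb1] : rb = 0 \/ rb = 1 by lia.
    by exists (Eisint ra rb); [rewrite ra1 rb0 | exists (Eisint (- qa) (- qb)); apply: dec].
  by exists (Eisint ra rb); [rewrite ra1 rb1 | exists (Eisint (- qa) (- qb)); apply: dec].
- have d3 : - theta_of omega - theta_of omega * (1 - theta_of omega * - theta_of omega)
    = theta_of omega by [].
  rewrite d3 in ndvd *.
  by case: (modtheta be) => // -[y Dy]; case: ndvd; exists y.
have d4 : chain_coef omega 4 = 1 by [].
by case: ndvd; exists be; rewrite -[X in X * _]/(chain_coef omega 4) d4 mul1r.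
Qed.

(** The norm of the glue vector. For E8 the glue vector lies in the lattice itself and is a root. *)
Definition discriminant_value (C : numClosedFieldType) t : C :=
  match t with A2 => 1 | D4 => 3 / 2 | E6 => 2 | E8 => 3 end.

(** * The discriminant *)

Section ThetaDual.
Variables (C : numClosedFieldType) (w : C).
Hypothesis hw : 3.-primitive_root w.
Variables (V : vectType C) (h : {hermitian_sym V for conjC}) (t : root_type).
Local Notation k := (chain_len t).+1.
Local Notation theta := (theta_of w).
Local Notation H := (chain_mx w k).
Local Notation evm := (map_mx (ev hw)).
Local Notation d := (chain_coef omega k).
Variable b : nat -> V.
Hypothesis chain_b : chain w h t b.
Local Notation L := (chain_lattice hw t b).
Let theta0 : theta != 0 := theta_neq0 hw.

Lemma chain_lattice_eis_herm x y : L x -> L y -> eis w (h x y).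
Proof.
move=> Lx Ly; have [a ->] := chain_lattice_herm chain_b Lx Ly.
by rewrite -(ev_theta hw) -rmorphM; apply: eis_ev_in.
Qed.

Lemma chain_lattice_theta_dual : (L `<=` theta_dual w h L)%classic.
Proof.
move=> v Lv; exists (theta^-1 *: v); last first.
  by rewrite (eis_theta_ev hw) scalerA divff ?scale1r.
split=> [|x Lx].
  by exists 1%N, (fun=> theta^-1), (fun=> v); split=> //; rewrite big_ord1.
have [a Da] := chain_lattice_herm chain_b Lx Lv.
rewrite herm_scaler Da fmorphV /= (conj_theta_of hw) invrN mulNr mulKf //.
by rewrite -rmorphN; apply: eis_ev_in.
Qed.

(** Membership in theta L' means that the products with the chain roots lie in theta E, and the
    inverse chain matrix recovers a vector of the span from these products divided by theta. *)
Lemma theta_dualP v : theta_dual w h L v <->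
  exists al : 'rV[eisint]_k, v = comb b (evm al *m invmx H).
Proof.
split=> [[u [[n [a [x [_ Lx Du]]]] dualu] Dv]|[al Dv]].
  have [c Dc] : exists c, v = comb b (c : 'rV_k).
    rewrite Dv {}Du; elim/big_ind: _ {Dv dualu} => [|x1 x2 [c1 D1] [c2 D2]|i _].
    - by exists 0; rewrite comb0 scaler0.
    - by exists (c1 + c2); rewrite scalerDr combD D1 D2.
    have [y ->] := Lx i.
    by exists (eis_theta w *: (a i *: evm y)); rewrite !combZ.
  have /(_ _)/cid Dal (j : 'I_k) : exists al, (c *m H) 0 j = ev hw al.
    have /eisP[al Dal] : eis w (h u (b j)).
      rewrite herm_conj; have /eisP[al ->] := dualu _ (chain_lattice_basis hw b j).
      by rewrite -ev_conj; apply: eis_ev_in.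
    exists al; apply: (mulfI theta0); rewrite -(herm_comb_basis chain_b) -Dc Dv.
    by rewrite herm_scalel (eis_theta_ev hw) Dal.
  exists (\row_j sval (Dal j)); rewrite Dc; congr comb.
  rewrite -[LHS](mulmxK (chain_mx_ev_unit hw t)); congr (_ *m _).
  by apply/rowP => j; rewrite [RHS]mxE mxE; apply: svalP (Dal j).
exists (theta^-1 *: v); last by rewrite (eis_theta_ev hw) scalerA divff ?scale1r.
split.
  exists k, (fun i => theta^-1 * (evm al *m invmx H) 0 i), b; split=> // [i|].
    exact: chain_lattice_basis.
  by rewrite Dv scaler_sumr; apply: eq_bigr => i _; rewrite scalerA.
move=> _ [y ->]; rewrite herm_scaler fmorphV /= (conj_theta_of hw) invrN herm_conj Dv.
rewrite (herm_comb chain_b) mulmxKV ?chain_mx_ev_unit // rmorphM /= (conj_theta_of hw).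
rewrite mulNr [- theta * _]mulNr mulrN opprK mulKf //.
have -> : (evm al *m (map_mx conjC (evm y))^T) 0 0
  = ev hw ((al *m (map_mx eis_conj y)^T) 0 0).
  rewrite !mxE rmorph_sum; apply: eq_bigr => i _.
  by rewrite !mxE rmorphM /= ev_conj.
by rewrite -ev_conj; apply: eis_ev_in.
Qed.

(** The last row of the inverse chain matrix: the vector with product theta with the last root and 0
    with the others. *)
Definition glue_vector : V := comb b ((chain_coef w k)^-1 *: chain_row w k).

Let d0 : chain_coef w k != 0 := chain_coef_ev_neq0 hw t.

Lemma glue_vectorE : glue_vector = comb b (delta_mx 0 ord_max *m invmx H).
Proof.
congr comb; apply: (canRL (mulmxK (chain_mx_ev_unit hw t))).
by rewrite -scalemxAl chain_row_mul scalerA mulVf ?scale1r.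
Qed.

(** This is [chain_elim] multiplied by the inverse chain matrix: the last unit vector becomes the
    glue vector. *)
Lemma theta_dual_decomp v : theta_dual w h L v <->
  exists (x : 'rV[eisint]_k) be, v = comb b (evm x) + ev hw be *: glue_vector.
Proof.
have eq_comb (x : 'rV[eisint]_k) be : comb b (evm (x *m chain_mx omega k + be *: delta_mx 0 ord_max) *m invmx H)
    = comb b (evm x) + ev hw be *: glue_vector.
  rewrite map_mxD map_mxM map_mxZ evm_chain evm_delta mulmxDl mulmxK ?chain_mx_ev_unit //.
  by rewrite combD -scalemxAl combZ glue_vectorE.
split=> [/theta_dualP[al ->]|[x [be ->]]].
  by have [x [be ->]] := chain_elim omega al; exists x, be; apply: eq_comb.
by apply/theta_dualP; eexists; rewrite -eq_comb.
Qed.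

Lemma glue_vector_mul : ev hw d *: glue_vector = comb b (evm (chain_row omega k)).
Proof.
by rewrite -combZ scalerA ev_chain_coef divff // scale1r evm_chain_row.
Qed.

Lemma glue_in_lattice be : L (ev hw be *: glue_vector) <-> exists y, be = d * y.
Proof.
split=> [[x]|[y ->]]; last first.
  rewrite mulrC rmorphM /= -scalerA glue_vector_mul.
  by exists (y *: chain_row omega k); rewrite map_mxZ combZ.
rewrite glue_vectorE -combZ => /(comb_inj hw chain_b) /(congr1 (mulmx^~ H)).
rewrite scalemxAl mulmxKV ?chain_mx_ev_unit // -(evm_chain hw) -map_mxM -(evm_delta hw) -map_mxZ.
move/evm_inj/esym => /chain_mx_ker[_ ->]; exists (x 0 0).
by rewrite mulrC.
Qed.

Lemma theta_dual_in_lattice (x : 'rV[eisint]_k) be :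
  L (comb b (evm x) + ev hw be *: glue_vector) <-> exists y, be = d * y.
Proof.
rewrite -glue_in_lattice; have Lx : L (comb b (evm x)) by exists x.
split=> Lv; last exact: chain_latticeD.
rewrite -(addKr (comb b (evm x)) (_ *: _)).
by apply: chain_latticeD => //; apply: chain_latticeN.
Qed.

Lemma herm_glue_comb (x : 'rV[eisint]_k) : h glue_vector (comb b (evm x)) = theta * (ev hw (x 0 ord_max))^*.
Proof.
rewrite glue_vectorE (herm_comb chain_b) mulmxKV ?chain_mx_ev_unit //.
by rewrite -rowE !mxE.
Qed.

(** The norm is theta times the conjugate of a quotient of consecutive determinants,
    [chain_coef w (chain_len t)] by [chain_coef w k]. *)
Lemma herm_glue : h glue_vector glue_vector = discriminant_value C t.
Proof.
rewrite {1}glue_vectorE (herm_comb chain_b) mulmxKV ?chain_mx_ev_unit //.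
have conj_coef m : (chain_coef w m)^* = ev hw (eis_conj (chain_coef omega m)).
  by rewrite ev_conj ev_chain_coef.
have conj_quo : ((chain_coef w k)^-1 * chain_coef w (chain_len t))^*
    = (ev hw (eis_conj d))^-1 * ev hw (eis_conj (chain_coef omega (chain_len t))).
  by rewrite rmorphM fmorphV -!conj_coef.
rewrite -rowE !mxE conj_quo -(ev_theta hw).
have [n1 n2] : (3%:R : C) != 0 /\ (2%:R : C) != 0 by rewrite !pnatr_eq0.
have th0 : ev hw (theta_of omega) != 0 by rewrite ev_theta.
case: t.
- rewrite (_ : eis_conj (chain_coef omega _) = theta_of omega) //.
  rewrite (_ : eis_conj (chain_coef omega _) = 1) //.
  by rewrite rmorph1 mulr1 divff.
- rewrite (_ : eis_conj (chain_coef omega (chain_len D4).+1) = Eisint (-2) 0) //.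
  rewrite (_ : eis_conj (chain_coef omega _) = theta_of omega) //.
  rewrite mulrCA [_^-1 * _]mulrC ev_int (ev_theta hw) (theta_sqr hw).
  by rewrite rmorphN /= invrN mulrN mulNr opprK.
- rewrite (_ : eis_conj (chain_coef omega (chain_len E6).+1) = - theta_of omega) //.
  rewrite (_ : eis_conj (chain_coef omega _) = Eisint (-2) 0) //.
  by rewrite rmorphN invrN mulNr mulrN mulVKf // ev_int rmorphN opprK.
rewrite (_ : eis_conj (chain_coef omega (chain_len E8).+1) = 1) //.
rewrite (_ : eis_conj (chain_coef omega _) = - theta_of omega) //.
by rewrite rmorph1 invr1 mul1r rmorphN mulrN /= (ev_theta hw) (theta_sqr hw) opprK.
Qed.
End ThetaDual.

Lemma discriminant_value_bound (C : numClosedFieldType) t :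
  t <> E8 -> 0 <= discriminant_value C t < 3.
Proof.
case: t => // _ /=.
- by rewrite ler01 ltr1n.
- by rewrite divr_ge0 ?ler0n //= ltr_pdivrMr ?ltr0n // -natrM ltr_nat.
- by rewrite ler0n ltr_nat.
Qed.

(** * Minimal norms in the discriminant classes *)

Section DiscriminantNorm.
Variables (C : numClosedFieldType) (w : C).
Hypothesis hw : 3.-primitive_root w.
Variables (V : vectType C) (h : {hermitian_sym V for conjC}) (t : root_type).
Local Notation k := (chain_len t).+1.
Local Notation evm := (map_mx (ev hw)).
Local Notation d := (chain_coef omega k).
Variable b : nat -> V.
Hypothesis chain_b : chain w h t b.
Local Notation L := (chain_lattice hw t b).
Local Notation p0 := (glue_vector w t b).
Hypothesis pos : forall x, L x -> x != 0 -> 0 < h x x.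

(** Multiplication by d carries the theta dual into L, where the form is positive. *)
Lemma theta_dual_norm_ge0 v : theta_dual w h L v -> 0 <= h v v.
Proof.
case/(theta_dual_decomp hw chain_b) => x [be Dv].
have Ldv : L (ev hw d *: v).
  rewrite Dv scalerDr -combZ -map_mxZ scalerA -rmorphM.
  by apply/(theta_dual_in_lattice hw chain_b); exists be.
have : 0 <= h (ev hw d *: v) (ev hw d *: v).
  have [->|nz] := eqVneq (ev hw d *: v) 0; first by rewrite herm_0l.
  exact/ltW/pos.
rewrite herm_scalel herm_scaler mulrA ev_norm pmulr_rge0 // ltr0z.
rewrite lt_neqAle eis_norm_ge0 andbT eq_sym eis_norm_eq0.
exact: chain_coef_neq0.
Qed.

(** Elements of theta E have trace in 3Z. This is why adding a lattice vector to a glue vector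
    changes the norm by a multiple of 3. *)
Lemma theta_ev_trace a :
  theta_of w * ev hw a + (theta_of w * ev hw a)^* = (3 * - eis_im a)%:~R.
Proof.
rewrite rmorphM /= (conj_theta_of hw) -ev_conj mulNr -mulrBr -rmorphB /=.
have -> : a - eis_conj a = theta_of omega * Eisint (eis_im a) 0.
  have -> : theta_of omega = Eisint 1 2 by [].
  case: a => x y; change (Eisint (x - (x - y)) (y - - y) =
    Eisint (1 * y - 2 * 0) (1 * 0 + 2 * y - 2 * 0)).
  by congr Eisint => /=; ring.
rewrite rmorphM /= (ev_theta hw) mulrA (theta_sqr hw) ev_int.
by rewrite !(rmorphM, rmorphN) /=; ring.
Qed.

Lemma glue_class_norm (x : 'rV[eisint]_k) u : eis_norm u = 1 ->
  exists m : int, h (comb b (evm x) + ev hw u *: p0) (comb b (evm x) + ev hw u *: p0)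
                  = discriminant_value C t + (3 * m)%:~R.
Proof.
move=> nu; have Lx : L (comb b (evm x)) by exists x.
have [n Dn] := chain_lattice_norm chain_b Lx.
rewrite !(herm_addl, herm_addr) Dn !(herm_scalel, herm_scaler) mulrA ev_norm nu mul1r.
rewrite (herm_glue hw chain_b) [h (comb _ _) _]herm_conj (herm_glue_comb hw chain_b).
have [a Da] : exists a, ev hw a = ev hw u * (ev hw (x 0 ord_max))^*.
  by exists (u * eis_conj (x 0 ord_max)); rewrite -ev_conj -rmorphM.
exists (n - eis_im a); rewrite mulrDr [(_ + 3 * - _)%:~R]rmorphD /= -theta_ev_trace Da.
by rewrite (mulrCA _ (ev hw u)) !rmorphM /=; ring.
Qed.

(** The norm of v is nonnegative and congruent to the discriminant value modulo 3, and this value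
    lies in [0, 3), so it is a lower bound. E8 does not occur, as d = 1 leaves no nonzero class. *)
Lemma theta_dual_class v : theta_dual w h L v -> ~ L v ->
  exists (x : 'rV[eisint]_k) u, [/\ eis_norm u = 1, v = comb b (evm x) + ev hw u *: p0
    & discriminant_value C t <= h v v
      /\ exists m : nat, h v v = discriminant_value C t + (3 * m)%:R].
Proof.
move=> dv nLv; have := dv; case/(theta_dual_decomp hw chain_b) => x [be Dv].
have ndvd : ~ exists y, be = d * y by move/(theta_dual_in_lattice hw chain_b x); rewrite -Dv.
have [u nu [y Dbe]] := discriminant_unit ndvd.
have Dv' : v = comb b (evm (x + y *: chain_row omega k)) + ev hw u *: p0.
  rewrite map_mxD map_mxZ combD combZ -glue_vector_mul scalerA -rmorphM /= Dv Dbe.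
  by rewrite rmorphD /= scalerDl -addrA [y * d]mulrC [X in _ + X]addrC.
exists (x + y *: chain_row omega k), u.
have [m Dm] := glue_class_norm (x + y *: chain_row omega k) nu; rewrite -Dv' in Dm.
have /andP[dge0 dlt3] : 0 <= discriminant_value C t < 3.
  apply: discriminant_value_bound => tE; apply: ndvd; exists be.
  by rewrite tE (_ : chain_coef omega _ = 1) ?mul1r.
have m0 : 0 <= m.
  rewrite leNgt; apply/negP => mneg; have := theta_dual_norm_ge0 dv.
  rewrite Dm lt_geF //; apply: (lt_le_trans (y := 3 + (3 * m)%:~R)); first by rewrite ltrD2r.
  have -> : 3 + (3 * m)%:~R = (3 + 3 * m)%:~R :> C by rewrite rmorphD.
  by rewrite lerz0; lia.
case: m m0 Dm => // m _ Dm; split=> //; split; last by exists m.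
by rewrite Dm lerDl ler0z.
Qed.

Lemma chain_discriminant_norm : discriminant_norm w h L (discriminant_value C t).
Proof.
move=> v dv nLv; have [x [u [nu Dv _]]] := theta_dual_class dv nLv.
have Lx : L (comb b (evm x)) by exists x.
have np : h (ev hw u *: p0) (ev hw u *: p0) = discriminant_value C t.
  by rewrite herm_scalel herm_scaler mulrA ev_norm nu mul1r (herm_glue hw chain_b).
exists (ev hw u *: p0); last exact: np.
split; first by rewrite Dv opprD addrCA subrr addr0; apply: chain_latticeN.
move=> u' Luv; rewrite np.
have Du' : u' = v + (u' - v) by rewrite addrC subrK.
have [y Dy] := Luv.
have du' : theta_dual w h L u'.
  apply/(theta_dual_decomp hw chain_b); exists (x + y), u.
  transitivity (v + (u' - v)); first by [].
  by rewrite Dy Dv map_mxD combD addrAC.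
have nLu' : ~ L u'.
  move=> Lu'; apply: nLv; have -> : v = u' - (u' - v) by rewrite subKr.
  exact: chain_latticeB.
by have [? [? [_ _ []]]] := theta_dual_class du' nLu'.
Qed.
End DiscriminantNorm.

(** * The discriminant as a space over the residue field *)

Definition residue_order t : nat := match t with D4 => 4 | _ => 3 end.

Lemma field4 : exists (F : finFieldType) (z : F),
  [/\ #|F| = 4%N, cube_root_eq z, 2%:R = 0 :> F
    & forall x : F, [\/ x = 0, x = 1, x = z | x = - 1 - z]].
Proof.
have [F charF oF] := PrimePowerField (isT : prime 2) (isT : (0 < 2)%N).
have [z nz01] : exists z : F, z \notin [:: 0; 1].
  apply: contrapT => no_z; have : (size (enum F) <= size [:: 0%R; 1%R : F])%N.
    apply: uniq_leq_size; first exact: enum_uniq.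
    by move=> x _; apply: contrapT => /negP nx; apply: no_z; exists x.
  by rewrite -cardE oF.
(* Every element satisfies x^4 = x, and x^4 - x has this factorisation. *)
have fact (x : F) : x * (x - 1) * (x ^+ 2 + x + 1) = 0.
  have /eqP := expf_card x; rewrite oF -subr_eq0 => /eqP x4.
  by transitivity (x ^+ 4 - x); [ring | exact: x4].
move: nz01; rewrite !inE negb_or => /andP[nz0 nz1].
have z_root : cube_root_eq z.
  by apply/eqP; have /eqP := fact z; rewrite !mulf_eq0 subr_eq0 (negbTE nz0) (negbTE nz1).
exists F, z; split=> //; first exact: pcharf0 charF.
move=> x; have /eqP := fact x; rewrite !mulf_eq0 subr_eq0 -orbA.
case/or3P => [/eqP->|/eqP->|/eqP x_root]; [by constructor 1 | by constructor 2 |].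
have /eqP : (x - z) * (x + 1 + z) = 0.
  transitivity ((x ^+ 2 + x + 1) - (z ^+ 2 + z + 1)); first by ring.
  by rewrite x_root z_root subrr.
rewrite mulf_eq0 subr_eq0 => /orP[/eqP->|]; first by constructor 3.
by rewrite -addrA addr_eq0 => /eqP->; constructor 4; rewrite opprD.
Qed.

Lemma residue_field t : t <> E8 -> exists (F : finFieldType) (z : F) (hz : cube_root_eq z),
  [/\ #|F| = residue_order t, eis_ev hz (chain_coef omega (chain_len t).+1) = 0
    & forall x, exists a, eis_ev hz a = x].
Proof.
have F3 t' : eis_ev (cube_root1 char_F3) (chain_coef omega (chain_len t').+1) = 0 ->
    exists (F : finFieldType) (z : F) (hz : cube_root_eq z),
  [/\ #|F| = 3%N, eis_ev hz (chain_coef omega (chain_len t').+1) = 0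
    & forall x, exists a, eis_ev hz a = x].
  move=> ev0; exists 'F_3, 1, (cube_root1 char_F3); split=> //; first by rewrite card_Fp.
  move=> x; exists (Eisint (x : nat) 0).
  by rewrite /eis_ev /= mul0r addr0 -pmulrn natr_Zp.
case: t => // _.
- by apply: (F3 A2); apply/eis_ev3_eq0; exists (-1).
- have [F [z [oF hz char2 allF]]] := field4; exists F, z, hz; split=> //.
    rewrite (_ : chain_coef omega _ = Eisint (-2) 0) //.
    by rewrite /eis_ev mul0r addr0 rmorphN -[X in - X]/(2%:R : F) char2 oppr0.
  move=> x; case: (allF x) => ->.
  + by exists 0; apply: rmorph0.
  + by exists 1; apply: rmorph1.
  + by exists omega; apply: eis_ev_omega.
  by exists (- 1 - omega); rewrite rmorphB rmorphN rmorph1 /= eis_ev_omega.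
- by apply: (F3 E6); apply/eis_ev3_eq0; exists 1.
Qed.

(** An element outside d E is a unit plus a multiple of d, and a unit cannot map to 0. *)
Lemma residue_eq0 t (F : finFieldType) (z : F) (hz : cube_root_eq z) a :
    eis_ev hz (chain_coef omega (chain_len t).+1) = 0 ->
  eis_ev hz a = 0 <-> exists y, a = chain_coef omega (chain_len t).+1 * y.
Proof.
move=> d0; split=> [a0|[y ->]]; last by rewrite rmorphM /= d0 mul0r.
apply: contrapT => /discriminant_unit[u nu [y Da]].
move: a0; rewrite Da rmorphD rmorphM /= d0 mul0r addr0 => u0.
have : eis_ev hz (u * eis_conj u) = 1.
  by rewrite -eis_normE nu; apply: rmorph1.
by rewrite rmorphM /= u0 mul0r => /eqP; rewrite eq_sym oner_eq0.
Qed.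

Section DiscriminantSpace.
Variables (C : numClosedFieldType) (w : C).
Hypothesis hw : 3.-primitive_root w.
Variables (V : vectType C) (h : {hermitian_sym V for conjC}) (t : root_type).
Local Notation k := (chain_len t).+1.
Local Notation evm := (map_mx (ev hw)).
Local Notation d := (chain_coef omega k).
Variable b : nat -> V.
Hypothesis chain_b : chain w h t b.
Local Notation L := (chain_lattice hw t b).
Local Notation p0 := (glue_vector w t b).

Definition class_rep v be := exists x : 'rV[eisint]_k, v = comb b (evm x) + ev hw be *: p0.

Lemma class_rep_uniq v be be' : class_rep v be -> class_rep v be' -> exists y, be - be' = d * y.
Proof.
case=> x Dv [x' Dv']; apply/(theta_dual_in_lattice hw chain_b (x - x')).
rewrite map_mxB combB rmorphB /= scalerBl addrACA -opprD -Dv -Dv' subrr.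
exact: chain_lattice0.
Qed.

Lemma class_repD v v' be be' : class_rep v be -> class_rep v' be' -> class_rep (v + v') (be + be').
Proof.
case=> x -> [x' ->]; exists (x + x').
have -> : ev hw (be + be') *: p0 = ev hw be *: p0 + ev hw be' *: p0.
  by rewrite -scalerDl -rmorphD.
by rewrite map_mxD combD addrACA.
Qed.

Lemma class_repZ a v be : class_rep v be -> class_rep (ev hw a *: v) (a * be).
Proof.
by case=> x ->; exists (a *: x); rewrite map_mxZ combZ rmorphM /= -scalerA scalerDr.
Qed.

Definition eis_inv (z : C) : eisint :=
  if pselect (exists x, z = ev hw x) is left e then sval (cid e) else 0.

Lemma eis_invK z : eis w z -> ev hw (eis_inv z) = z.
Proof.
move/(eisP hw) => ez; rewrite /eis_inv.
by case: pselect => // e; rewrite -(svalP (cid e)).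
Qed.

Lemma ev_invK a : eis_inv (ev hw a) = a.
Proof. by apply: (@ev_inj _ _ hw); rewrite eis_invK //; apply: eis_ev_in. Qed.

Lemma chain_discriminant_space p : t <> E8 -> p = ev hw d \/ p = - ev hw d ->
  discriminant_space w h L p (residue_order t) 1.
Proof.
move=> tE Dp; split; first exact: chain_lattice_theta_dual.
have [F [z [hz [oF d0 surj]]]] := residue_field tE.
pose f v : F := if pselect (exists be, class_rep v be) is left e
                then eis_ev hz (sval (cid e)) else 0.
have fE v be : class_rep v be -> f v = eis_ev hz be.
  move=> vbe; rewrite /f; case: pselect => [e|[]]; last by exists be.
  have /(residue_eq0 _ d0) := class_rep_uniq (svalP (cid e)) vbe.
  by rewrite rmorphB /= => /eqP; rewrite subr_eq0 => /eqP.
have repP v : theta_dual w h L v -> exists be, class_rep v be.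
  by case/(theta_dual_decomp hw chain_b) => x [be Dv]; exists be, x.
exists F, (fun a => eis_ev hz (eis_inv a)), (fun v => const_mx (f v)); split=> //.
- split.
  + by rewrite -(rmorph1 (ev hw)) ev_invK; apply: rmorph1.
  + move=> _ _ /(eisP hw)[a ->] /(eisP hw)[a' ->].
    by rewrite -rmorphD /= !ev_invK rmorphD.
  + move=> _ _ /(eisP hw)[a ->] /(eisP hw)[a' ->].
    by rewrite -rmorphM /= !ev_invK rmorphM.
  + move=> _ /(eisP hw)[a ->]; rewrite ev_invK.
    apply: (iff_trans (residue_eq0 _ d0)); split=> [[y ->]|[_ /(eisP hw)[y ->]]].
      case: Dp => ->; first by exists (ev hw y); [exact: eis_ev_in | rewrite rmorphM].
      exists (ev hw (- y)); first exact: eis_ev_in.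
      by rewrite rmorphM rmorphN /= mulrNN.
    case: Dp => ->; rewrite -?rmorphN -rmorphM => /ev_inj->; first by exists y.
    by exists (- y); rewrite mulrN mulNr.
  + move=> c; have [a <-] := surj c; exists (ev hw a); first exact: eis_ev_in.
    by rewrite ev_invK.
- move=> x y /repP[be xbe] /repP[be' ybe']; apply/matrixP => i j; rewrite !mxE.
  by rewrite (fE _ _ xbe) (fE _ _ ybe') (fE _ _ (class_repD xbe ybe')) rmorphD.
- move=> _ x /(eisP hw)[a ->] /repP[be xbe]; apply/matrixP => i j; rewrite !mxE ev_invK.
  by rewrite (fE _ _ xbe) (fE _ _ (class_repZ a xbe)) rmorphM.
split=> [x dx|c].
  have [be [y Dx]] := repP x dx; have xbe : class_rep x be by exists y.
  rewrite {2}Dx; apply: iff_trans (iff_sym (theta_dual_in_lattice hw chain_b y be)).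
  apply: iff_trans (residue_eq0 be d0); rewrite (fE _ _ xbe); split=> [/matrixP/(_ 0 0)|->].
    by rewrite !mxE.
  by apply/matrixP => i j; rewrite !mxE.
have [a Da] := surj (c 0 0); exists (ev hw a *: p0).
  by apply/(theta_dual_decomp hw chain_b); exists 0, a; rewrite map_mx0 comb0 add0r.
have xa : class_rep (ev hw a *: p0) a by exists 0; rewrite map_mx0 comb0 add0r.
by apply/matrixP => i j; rewrite !mxE (fE _ _ xa) Da !ord1.
Qed.
End DiscriminantSpace.

(** * The standard lattices *)

Section StandardBasis.
Variables (C : numClosedFieldType) (w : C).
Hypothesis hw : 3.-primitive_root w.
Variable t : root_type.
Local Notation k := (chain_len t).+1.
Local Notation evm := (map_mx (ev hw)).
Local Notation h := (std_form (std_dim t) : {hermitian_sym 'rV[C]_(std_dim t) for conjC}).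

Definition std_chain (i : nat) : 'rV[C]_(std_dim t) :=
  oapp (fun j : 'I_k => row j (evm (std_basis t))) 0 (insub i).

Lemma std_formE n (x y : 'rV[C]_n) : std_form n x y = (x *m (map_mx conjC y)^T) 0 0.
Proof. by rewrite /std_form /= dotmxE map_trmx. Qed.

Lemma std_form_gt0 n (x : 'rV[C]_n) : x != 0 -> 0 < std_form n x x.
Proof. by move=> nx; rewrite /std_form dnorm_gt0. Qed.

Lemma comb_std_chain (x : 'rV[C]_k) : comb std_chain x = x *m evm (std_basis t).
Proof.
rewrite mulmx_sum_row; apply: eq_bigr => i _.
by rewrite /std_chain valK.
Qed.

Lemma std_chainP : chain w h t std_chain.
Proof.
move=> i j; rewrite /std_chain !valK /= std_formE.
have := congr1 evm (std_basis_gram t); rewrite map_mxM map_mxZ evm_chain => /matrixP/(_ i j).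
rewrite [RHS]mxE /= ev_theta => <-; rewrite !mxE; apply: eq_bigr => l _.
by rewrite !mxE /= ev_conj.
Qed.

Lemma std_chain_pos x : chain_lattice hw t std_chain x -> x != 0 -> 0 < h x x.
Proof. by move=> _; apply: std_form_gt0. Qed.
Lemma std_chain_latticeP v : chain_lattice hw t std_chain v <->
  exists x : 'rV[eisint]_k, v = evm (x *m std_basis t).
Proof. by split=> -[x ->]; exists x; rewrite ?comb_std_chain map_mxM ?comb_std_chain. Qed.
End StandardBasis.

Section StandardLattices.
Variables (C : numClosedFieldType) (w : C).
Hypothesis hw : 3.-primitive_root w.
Local Notation evm := (map_mx (ev hw)).
Local Notation th := (theta_of omega).

Lemma eis_dvd_thetaP z : eis_dvd w (eis_theta w) z <-> exists e, z = ev hw (th * e).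
Proof.
split=> [[_ /(eisP hw)[e ->] ->]|[e ->]].
  by exists e; rewrite rmorphM /= ev_theta (eis_theta_ev hw).
exists (ev hw e); first exact: eis_ev_in.
by rewrite rmorphM /= ev_theta (eis_theta_ev hw).
Qed.

Lemma seq_row_ev n (y : 'rV[eisint]_n) s : (forall j : 'I_n, s`_j = ev hw (y 0 j)) ->
  seq_row n s = evm y.
Proof. by move=> eqs; apply/rowP => j; rewrite !mxE eqs. Qed.

Lemma mul_seq_std_basis t (s : seq eisint) j :
  ((\row_(i < (chain_len t).+1) nth 0 s i) *m std_basis t) 0 j
  = \sum_(i < (chain_len t).+1) nth 0 s i * nth 0 (nth [::] (std_basis_entries t) i) j.
Proof. by rewrite mxE; apply: eq_bigr => i _; rewrite !mxE. Qed.

Lemma std_lattice_A2 : A2_lattice w = chain_lattice hw A2 (std_chain hw A2).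
Proof.
apply/seteqP; split=> v; rewrite std_chain_latticeP => -[].
  move=> _ /(eisP hw)[e ->] ->; exists (\row_(i < 1) nth 0 [:: e] i).
  apply: seq_row_ev => j; rewrite (mul_seq_std_basis (t := A2)) big_ord_recl big_ord0 addr0.
  by case: j => [[|]] //= _; rewrite rmorphM /= ev_theta (eis_theta_ev hw) mulrC.
move=> x ->; exists (ev hw (x 0 0)); first exact: eis_ev_in.
apply/esym/seq_row_ev => j; rewrite mxE big_ord_recl big_ord0 addr0 mxE /=.
by case: j => [[|]] //= _; rewrite rmorphM /= ev_theta (eis_theta_ev hw) mulrC.
Qed.

Lemma std_lattice_D4 : D4_lattice w = chain_lattice hw D4 (std_chain hw D4).
Proof.
apply/seteqP; split=> v; rewrite std_chain_latticeP.
  case=> _ [_ [/(eisP hw)[x ->] /(eisP hw)[y ->]]]; rewrite -rmorphB /=.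
  case/eis_dvd_thetaP => e /ev_inj Dxy ->; exists (\row_(i < 2) nth 0 [:: - e; x] i).
  apply: seq_row_ev => j; rewrite (mul_seq_std_basis (t := D4)) !big_ord_recl big_ord0.
  have Dy : y = x - th * e by rewrite -Dxy subKr.
  by case: j => [[|[|[|]]]] //= _; congr ev; rewrite ?Dy; ring.
case=> x ->; exists (ev hw (x 0 1)), (ev hw (x 0 0 * th + x 0 1)).
split; try exact: eis_ev_in.
  by rewrite -rmorphB /=; apply/eis_dvd_thetaP; exists (- x 0 0); congr ev; ring.
apply/esym/seq_row_ev => j; rewrite mxE !big_ord_recl big_ord0 !mxE.
have -> : lift ord0 ord0 = 1 :> 'I_2 by apply: val_inj.
by case: j => [[|[|[|]]]] //= _; congr ev; ring.
Qed.

Lemma std_lattice_E6 : E6_lattice w = chain_lattice hw E6 (std_chain hw E6).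
Proof.
apply/seteqP; split=> v; rewrite std_chain_latticeP.
  case=> _ [_ [_ [[/(eisP hw)[x ->] [/(eisP hw)[y ->] /(eisP hw)[z ->]]]]]].
  rewrite -!rmorphB /= => /eis_dvd_thetaP[e1 /ev_inj D1] /eis_dvd_thetaP[e2 /ev_inj D2] ->.
  exists (\row_(i < 3) nth 0 [:: - e2; y; - e1] i).
  apply: seq_row_ev => j; rewrite (mul_seq_std_basis (t := E6)) !big_ord_recl big_ord0.
  have Dx : x = y + th * e1 by rewrite -D1 addrC subrK.
  have Dz : z = y - th * e2 by rewrite -D2 subKr.
  by case: j => [[|[|[|]]]] //= _; congr ev; rewrite ?Dx ?Dz; ring.
case=> x ->; pose i2 : 'I_3 := lift ord0 (lift ord0 ord0).
exists (ev hw (x 0 (lift ord0 ord0) - th * x 0 i2)), (ev hw (x 0 (lift ord0 ord0))),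
  (ev hw (x 0 (lift ord0 ord0) + th * x 0 ord0)).
split; first by split; [|split]; apply: eis_ev_in.
- by rewrite -rmorphB /=; apply/eis_dvd_thetaP; exists (- x 0 i2); congr ev; ring.
- by rewrite -rmorphB /=; apply/eis_dvd_thetaP; exists (- x 0 ord0); congr ev; ring.
apply/esym/seq_row_ev => j; rewrite mxE !big_ord_recl big_ord0 !mxE.
by case: j => [[|[|[|]]]] //= _; congr ev; rewrite /i2; ring.
Qed.

Lemma tetracode_row (a b : 'F_3) :
  (\row_(i < 2) nth 0 [:: a; b] i) *m tetracode = \row_(j < 4) nth 0 [:: b; a; a + b; a - b] j.
Proof.
apply/rowP => j; rewrite !mxE !big_ord_recl big_ord0 !mxE.
by case: j => [[|[|[|[|]]]]] //= _; ring.
Qed.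

Lemma ev3_dvd y (c : 'F_3) :
  eis_dvd w (eis_theta w) (ev hw y - (c : nat)%:R) <-> eis_ev (cube_root1 char_F3) y = c.
Proof.
have Dc : (c : nat)%:R = ev hw (Eisint (c : nat) 0) by rewrite ev_int -pmulrn.
have D3 : eis_ev (cube_root1 char_F3) (Eisint (c : nat) 0) = c.
  by rewrite /eis_ev /= mul0r addr0 -pmulrn natr_Zp.
rewrite Dc -rmorphB /=; apply: (iff_trans (eis_dvd_thetaP _)).
split=> [[e /ev_inj De]|ey].
  apply/eqP; rewrite -subr_eq0 -[X in _ - X]D3 -rmorphB /=.
  by apply/eqP/eis_ev3_eq0; exists e.
have /eis_ev3_eq0[e De] : eis_ev (cube_root1 char_F3) (y - Eisint (c : nat) 0) = 0.
  by rewrite rmorphB /= D3 ey subrr.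
by exists e; rewrite De.
Qed.

Lemma std_lattice_E8 : E8_lattice w = chain_lattice hw E8 (std_chain hw E8).
Proof.
have th2 : th * th = - 3 by [].
apply/seteqP; split=> v; rewrite std_chain_latticeP.
  case=> eis_v [c /submxP[D Dc] red_c].
  have /(_ _)/cid Dv : forall j, exists y, v 0 j = ev hw y by move=> j; apply/(eisP hw).
  pose y j := sval (Dv j); have Ev j : v 0 j = ev hw (y j) := svalP (Dv j).
  have ey j : eis_ev (cube_root1 char_F3) (y j) = c 0 j by apply/ev3_dvd; rewrite -Ev.
  have Dcr : c = \row_(j < 4) nth 0 [:: D 0 1; D 0 0; D 0 0 + D 0 1; D 0 0 - D 0 1] j.
    rewrite Dc -tetracode_row; congr (_ *m _); apply/rowP => i; rewrite mxE.
    by case: i => [[|[|]]] //= ?; congr (D 0 _); apply: val_inj.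
  pose j1 : 'I_4 := lift ord0 ord0; pose j2 : 'I_4 := lift ord0 (lift ord0 ord0).
  pose j3 : 'I_4 := lift ord0 (lift ord0 (lift ord0 ord0)).
  (* The codewords are (b, a, a + b, a - b), so the tetracode amounts to two congruences that
     express the last two entries through the first two. *)
  have [e2 De2] : exists e, y j2 - y ord0 - y j1 = th * e.
    apply/eis_ev3_eq0; rewrite !rmorphB /= !ey Dcr !mxE /=; ring.
  have [e3 De3] : exists e, y j3 - y j1 + y ord0 = th * e.
    apply/eis_ev3_eq0; rewrite rmorphD rmorphB /= !ey Dcr !mxE /=; ring.
  (* Solve columns 0, 2, 1, 3 of the basis in this order. The division by theta in the last two is
     possible because 3 = - theta^2. *)
  exists (\row_(i < 4) nth 0 [:: e3 - e2 + th * y ord0; y j2 + y ord0;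
                                 e2 - th * y ord0; - y ord0] i).
  apply/rowP => j; rewrite Ev [RHS]mxE; congr ev.
  rewrite (mul_seq_std_basis (t := E8)) !big_ord_recl big_ord0 /=.
  have D2 : y j2 = y ord0 + y j1 + th * e2 by rewrite -De2; ring.
  have D3 : y j3 = y j1 - y ord0 + th * e3 by rewrite -De3; ring.
  have [->|->|->|->] : [\/ j = ord0, j = j1, j = j2 | j = j3].
    by case: j => [[|[|[|[|]]]]] // ?; [constructor 1 | constructor 2 | constructor 3 |
      constructor 4]; apply: val_inj.
  - by rewrite /=; ring.
  - rewrite D2 /=; apply/eqP; rewrite -subr_eq0; apply/eqP.
    by transitivity ((- 3 - th * th) * y ord0); [ring | rewrite th2 subrr mul0r].
  - by rewrite /=; ring.
  - rewrite D2 D3 /=; apply/eqP; rewrite -subr_eq0; apply/eqP.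
    by transitivity ((- 3 - th * th) * y ord0); [ring | rewrite th2 subrr mul0r].
case=> x ->; split=> [i|]; first by rewrite mxE; apply: eis_ev_in.
pose y := x *m std_basis E8; exists (red3 y); last first.
  by move=> i; rewrite [evm _ _ _]mxE; apply/ev3_dvd; rewrite /red3 [RHS]mxE.
have ev_th : eis_ev (cube_root1 char_F3) th = 0 by apply/eis_ev3_eq0; exists 1; rewrite mulr1.
apply/submxP; exists (\row_(i < 2) nth 0 [:: red3 y 0 (lift ord0 ord0); red3 y 0 ord0] i).
rewrite tetracode_row; apply/rowP => j; rewrite [RHS]mxE /y /red3 ![map_mx _ _ _ _]mxE.
rewrite !mxE !big_ord_recl !big_ord0 !mxE /=.
set e := eis_ev _ in ev_th *.
have eD : {morph e : u v / u + v} by exact: rmorphD.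
have eM : {morph e : u v / u * v} by exact: rmorphM.
have eN : {morph e : u / - u} by exact: rmorphN.
have [e1 e0] : e 1 = 1 /\ e 0 = 0 by split; [exact: rmorph1 | exact: rmorph0].
move: (theta_of omega) ev_th => T ev_th.
case: j => [[|[|[|[|]]]]] //= ?; rewrite !(eD, eM, eN, e1, e0) ?ev_th; try by ring.
apply/eqP; rewrite -subr_eq0; apply/eqP.
by transitivity (3%:R * e (x 0 (lift ord0 (lift ord0 (lift ord0 ord0)))));
  [ring | rewrite char_F3 mul0r].
Qed.

Lemma std_latticeE t : std_lattice w t = chain_lattice hw t (std_chain hw t).
Proof.
case: t; [exact: std_lattice_A2 | exact: std_lattice_D4 | exact: std_lattice_E6 |].
exact: std_lattice_E8.
Qed.
End StandardLattices.

(** * Automorphisms of chain lattices *)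

Section RootLattice.
Variables (C : numClosedFieldType) (w : C).
Hypothesis hw : 3.-primitive_root w.
Variables (V : vectType C) (h : {hermitian_sym V for conjC}) (t : root_type).
Local Notation k := (chain_len t).+1.
Local Notation evm := (map_mx (ev hw)).
Variable b : nat -> V.
Hypothesis chain_b : chain w h t b.
Local Notation L := (chain_lattice hw t b).

Lemma chain_norm (i : 'I_k) : h (b i) (b i) = 3.
Proof.
rewrite chain_b !mxE eqxx subrr sub0r mulr1 mulrN (theta_sqr hw).
exact: opprK.
Qed.

Lemma chain_root_lattice :
  (forall x, L x -> x != 0 -> 0 < h x x) -> eis_root_lattice w h L.
Proof.
move=> pos; split=> //.
- split; last exact: chain_lattice_eis_herm.
  exists (mkseq b k); first exact: (chain_free hw chain_b).
  apply/seteqP; split.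
    by apply: sub_chain_lattice_span => i /=; apply/mapP; exists (i : nat) => //; rewrite mem_iota ltn_ord.
  apply: chain_lattice_span => _ /= /mapP[i /[!mem_iota] /= lti ->].
  exact: (chain_lattice_basis hw b (Ordinal lti)).
- exact: chain_lattice_theta_dual.
apply/seteqP; split.
  apply: sub_chain_lattice_span => i; split; last exact: chain_norm.
  exact: chain_lattice_basis.
by apply: chain_lattice_span => v [].
Qed.

Lemma herm_comb_skew (x y : 'rV[eisint]_k) :
  h (comb b (evm x)) (comb b (evm y)) = theta_of w * ev hw (skew x y).
Proof.
rewrite (herm_comb chain_b); congr (_ * _); rewrite /skew.
rewrite (_ : ev hw ((x *m chain_mx omega k *m (map_mx eis_conj y)^T) 0 0)
    = (evm (x *m chain_mx omega k *m (map_mx eis_conj y)^T)) 0 0); last by rewrite [RHS]mxE.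
rewrite !map_mxM evm_chain; congr ((_ *m _) 0 0).
by apply/matrixP => i j; rewrite !mxE /= ev_conj.
Qed.

Lemma comb_ev_inj (x y : 'rV[eisint]_k) : comb b (evm x) = comb b (evm y) -> x = y.
Proof. by move/(comb_inj hw chain_b)/evm_inj. Qed.

Variable M : unitary_model k.
Local Notation mx := (@model_mx k M).

(** Matrices act on rows from the right, so the inverse is needed to obtain an action from the
    left. *)
Definition lattice_action (g : M) (v : V) : V :=
  comb b (coord w h t b v *m evm (mx g^-1%g)).
Local Notation rho := lattice_action.

Lemma lattice_actionE g (x : 'rV[eisint]_k) :
  rho g (comb b (evm x)) = comb b (evm (x *m mx g^-1%g)).
Proof. by rewrite /rho (combK hw chain_b) map_mxM. Qed.

Lemma lattice_actionM g g' x : L x -> rho (g * g')%g x = rho g (rho g' x).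
Proof. by case=> y ->; rewrite !lattice_actionE invMg model_mxM mulmxA. Qed.

Lemma lattice_action1 x : L x -> rho 1%g x = x.
Proof. by case=> y ->; rewrite lattice_actionE invg1 model_mx1 mulmx1. Qed.

Lemma lattice_action_in g x : L x -> L (rho g x).
Proof. by case=> y ->; rewrite lattice_actionE; eexists. Qed.

Lemma lattice_action_isometry g : lattice_isometry w h L h L (rho g).
Proof.
split.
- split=> [x|x y|x Lx] /=; first exact: lattice_action_in.
    move=> /set_mem Lx /set_mem Ly eqxy; rewrite -(lattice_action1 Lx) -(lattice_action1 Ly).
    by rewrite -(mulVg g) (lattice_actionM _ _ Lx) (lattice_actionM _ _ Ly) eqxy.
  exists (rho g^-1%g x); first exact: lattice_action_in.
  by rewrite -lattice_actionM // mulgV lattice_action1.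
- by move=> x y _ _; rewrite /rho coordD mulmxDl combD.
- by move=> a x _ _; rewrite /rho coordZ -scalemxAl combZ.
move=> _ _ [x ->] [y ->]; rewrite !lattice_actionE !herm_comb_skew unitary_skew //.
exact: model_mx_unitary.
Qed.

Lemma isometry_matrix f : lattice_isometry w h L h L f ->
  exists2 X : 'M[eisint]_k, unitary X &
    forall x : 'rV_k, f (comb b (evm x)) = comb b (evm (x *m X)).
Proof.
case=> [[fL _ _] fD fZ fH].
have /(_ _)/cid Dx (i : 'I_k) : exists x : 'rV[eisint]_k, f (b i) = comb b (evm x).
  exact/fL/chain_lattice_basis.
pose X : 'M[eisint]_k := \matrix_i sval (Dx i).
have f0 : f 0 = 0.
  have L0 := chain_lattice0 hw t b.
  by have := fD 0 0 L0 L0; rewrite addr0 => /eqP; rewrite -subr_eq0 opprD addNKr oppr_eq0 => /eqP.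
have fX (x : 'rV_k) : f (comb b (evm x)) = comb b (evm (x *m X)).
  have f_sum : forall r : seq 'I_k, L (\sum_(i <- r) ev hw (x 0 i) *: b i) /\
     f (\sum_(i <- r) ev hw (x 0 i) *: b i) = \sum_(i <- r) comb b (evm (x 0 i *: row i X)).
    elim=> [|i r [Lr IH]]; first by rewrite !big_nil; split=> //; apply: chain_lattice0.
    have Li : L (ev hw (x 0 i) *: b i) by apply/chain_latticeZ/chain_lattice_basis.
    rewrite !big_cons; split; first exact: chain_latticeD.
    rewrite fD // IH fZ; [|exact: eis_ev_in|exact: chain_lattice_basis].
    congr (_ + _); rewrite map_mxZ combZ rowK; congr (_ *: _).
    exact: svalP (Dx i).
  have -> : comb b (evm x) = \sum_(i <- index_enum 'I_k) ev hw (x 0 i) *: b i.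
    by apply: eq_bigr => i _; rewrite mxE.
  rewrite (f_sum _).2 mulmx_sum_row.
  have comb_sum : forall r : seq 'I_k, comb b (evm (\sum_(i <- r) x 0 i *: row i X))
      = \sum_(i <- r) comb b (evm (x 0 i *: row i X)).
    by elim=> [|i r IH]; rewrite ?big_nil ?map_mx0 ?comb0 // !big_cons map_mxD combD IH.
  by rewrite comb_sum.
exists X => //; apply: unitary_rows => i j; apply: (ev_inj (hw := hw)).
apply: (mulfI (theta_neq0 hw)); rewrite -herm_comb_skew !rowE -!fX fH; last 2 first.
- by eexists.
- by eexists.
by rewrite herm_comb_skew skew_delta.
Qed.

Lemma chain_aut_isomorphism : aut_isomorphism w h L rho.
Proof.
split; [exact: lattice_action_isometry | exact: lattice_actionM |].
move=> f /isometry_matrix[X uX fX].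
have [g Dg] := model_mx_surj M uX; exists g^-1%g; split=> [_ [x ->]|g' eqg'].
  by rewrite lattice_actionE invgK Dg fX.
apply: invg_inj; rewrite invgK; apply: (@model_mx_inj k M); apply/row_matrixP => i.
rewrite !rowE; apply: comb_ev_inj; rewrite Dg -fX -eqg' ?lattice_actionE //.
by eexists.
Qed.

Lemma omega_reflectionE (x r : 'rV[eisint]_k) : third_norm r = 1 ->
  omega_reflection w h (comb b (evm r)) (comb b (evm x))
  = comb b (evm (x + (omega ^+ 2 * skew x r) *: r)).
Proof.
move=> nr; rewrite /omega_reflection map_mxD map_mxZ combD combZ; congr (_ + _ *: _).
have nr3 : theta_of w * ev hw (skew r r) = 3%:~R.
  by rewrite -(ev_theta hw) -rmorphM /= third_normE nr mulr1 ev_int.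
rewrite !herm_comb_skew nr3.
rewrite rmorphM /= (_ : omega ^+ 2 = omega * omega) // rmorphM /= ev_omega.
have n3 : (3%:~R : C) != 0 by rewrite intr_eq0.
apply: (mulIf n3); rewrite mulrA divfK //.
have w2 := cube_root_sqr (primitive_cube_root hw); rewrite -expr2 w2 /theta_of.
transitivity ((2 * w ^+ 2 - w - 1) * ev hw (skew x r)); first by ring.
by rewrite w2; ring.
Qed.

Lemma omega_reflectionP g : is_omega_reflection w h L rho g <-> is_reflection g^-1%g.
Proof.
split=> [[r [[r' Dr] nr] gr]|[r nr gr]].
  have nr' : third_norm r' = 1.
    have := nr; rewrite Dr herm_comb_skew -(ev_theta hw) -rmorphM /= third_normE ev_int.
    move=> e3; have : ((3 * third_norm r')%:~R : C) == 3%:~R by rewrite e3.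
    by rewrite eqr_int => /eqP; lia.
  exists r' => // x; apply: comb_ev_inj; rewrite -lattice_actionE gr; last by eexists.
  by rewrite Dr omega_reflectionE.
exists (comb b (evm r)); last by move=> _ [x ->]; rewrite lattice_actionE gr omega_reflectionE.
split; first by eexists.
by rewrite herm_comb_skew -(ev_theta hw) -rmorphM /= third_normE nr mulr1 ev_int.
Qed.

(** The inverse in [lattice_action] exchanges reflections with their inverses, and the generating
    sets on both sides contain both. *)
Lemma triflection_groupE : triflection_group w h L rho = reflection_group M.
Proof.
rewrite /triflection_group /reflection_group /=; congr <<_>>%g.
apply/finset.setP => g; rewrite !inE; apply: asbool_equiv_eq.
have eq1 := omega_reflectionP g; have eq2 := omega_reflectionP g^-1%g.
rewrite invgK in eq2; split=> -[].
- by move/eq1; right.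
- by move/eq2; left.
- by move/eq2; right.
by move/eq1; left.
Qed.

Lemma chain_scalar_group : scalar_group L rho (scalars M).
Proof.
move=> g; rewrite -groupV => /scalarsP[m Dg _]; exists (ev hw (centre_scalar t ^+ m)).
move=> _ [x ->]; rewrite lattice_actionE Dg scalar_eltE; last first.
  elim: m {Dg} => [|m IH]; first by [].
  by rewrite exprS eis_normM centre_scalar_norm IH.
by rewrite mul_mx_scalar map_mxZ combZ.
Qed.

Lemma chain_aut_structure : aut_structure w h L rho (scalars M).
Proof.
split; [exact: chain_aut_isomorphism | exact: chain_scalar_group | exact: cycle_cyclic |].
by rewrite triflection_groupE reflection_scalars_dprod.
Qed.
End RootLattice.

(** * Decomposition of root lattices *)

Section Classification.
Variables (C : numClosedFieldType) (w : C).
Hypothesis hw : 3.-primitive_root w.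
Variables (V : vectType C) (h : {hermitian_sym V for conjC}).
Local Notation theta := (theta_of w).

Lemma herm_pythagoras z p : h z p = 0 -> h (z + p) (z + p) = h z z + h p p.
Proof.
by move=> zp; rewrite herm_addl !herm_addr zp [h p z]herm_conj zp conjC0 addr0 add0r.
Qed.

(** What the induction retains of a root lattice. No basis is asked for, so the property passes to
    the span of any set of roots of L. *)
Definition root_span (L : set V) : Prop :=
  [/\ L = span_over (eis w) (lattice_root h L),
      forall x, L x -> x != 0 -> 0 < h x x
    & forall x y, L x -> L y -> exists a, h x y = theta * ev hw a].

Lemma span_over0 (S : set V) : span_over (eis w) S 0.
Proof.
exists 0%N, (fun=> 0), (fun=> 0); split; first by case.
  by case.
by rewrite big_ord0.
Qed.

Lemma span_overD (S : set V) x y :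
  span_over (eis w) S x -> span_over (eis w) S y -> span_over (eis w) S (x + y).
Proof.
case=> n [a [v [aE vS ->]]] [n' [a' [v' [aE' vS' ->]]]].
exists (n + n')%N, (fun i => match fintype.split i with inl j => a j | inr j => a' j end),
  (fun i => match fintype.split i with inl j => v j | inr j => v' j end); split.
- by move=> i; case: fintype.split.
- by move=> i; case: fintype.split.
rewrite big_split_ord /=; congr (_ + _); apply: eq_bigr => i _.
  by rewrite (unsplitK (inl i)).
by rewrite (unsplitK (inr i)).
Qed.

Lemma span_overZ (S : set V) a x :
  span_over (eis w) S x -> span_over (eis w) S (ev hw a *: x).
Proof.
case=> n [c [v [cE vS ->]]]; exists n, (fun i => ev hw a * c i), v; split=> // [i|].
  by have /(eisP hw)[c' ->] := cE i; rewrite -rmorphM; apply: eis_ev_in.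
by rewrite scaler_sumr; apply: eq_bigr => i _; rewrite scalerA.
Qed.

Lemma span_over_mem (S : set V) x : S x -> span_over (eis w) S x.
Proof.
move=> Sx; exists 1%N, (fun=> 1), (fun=> x); split=> // [_|].
  by apply/(eisP hw); exists 1; rewrite rmorph1.
by rewrite big_ord1 scale1r.
Qed.

Lemma span_over_ind (S P : set V) : P 0 -> (forall x y, P x -> P y -> P (x + y)) ->
    (forall a x, S x -> P (ev hw a *: x)) ->
  (span_over (eis w) S `<=` P)%classic.
Proof.
move=> P0 PD PS _ [n [a [v [aE vS ->]]]]; elim/big_ind: _ => // i _.
by have /(eisP hw)[a' ->] := aE i; apply/PS/vS.
Qed.

Section RootSpan.
Variable L : set V.
Hypothesis rsL : root_span L.

Lemma root_spanD x y : L x -> L y -> L (x + y).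
Proof. by case: rsL => -> _ _; apply: span_overD. Qed.
Lemma root_spanZ a x : L x -> L (ev hw a *: x).
Proof. by case: rsL => -> _ _; apply: span_overZ. Qed.
Lemma root_span0 : L 0.
Proof. by case: rsL => -> _ _; apply: span_over0. Qed.
Lemma root_spanB x y : L x -> L y -> L (x - y).
Proof.
move=> Lx Ly; apply: root_spanD => //.
by rewrite -scaleN1r -(rmorph1 (ev hw)) -rmorphN; apply: root_spanZ.
Qed.

Variables (t : root_type) (b : nat -> V).
Local Notation k := (chain_len t).+1.
Local Notation evm := (map_mx (ev hw)).
Hypothesis chain_b : chain w h t b.
Hypothesis Lb : forall i : 'I_k, L (b i).
Local Notation Lam := (chain_lattice hw t b).
Local Notation p0 := (glue_vector w t b).

Lemma chain_lattice_sub : (Lam `<=` L)%classic.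
Proof.
move=> x /(sub_chain_lattice_span (S := L) Lb); apply: span_over_ind.
- exact: root_span0.
- exact: root_spanD.
- by move=> a y; apply: root_spanZ.
Qed.

Lemma chain_lattice_pos x : Lam x -> x != 0 -> 0 < h x x.
Proof. by move/chain_lattice_sub; case: rsL => _ pos _; apply: pos. Qed.

Lemma chain_proj_theta_dual r : L r -> theta_dual w h Lam (chain_proj w h t b r).
Proof.
move=> Lr; have /(_ _)/cid Da (j : 'I_k) : exists a, h r (b j) = theta * ev hw a.
  by case: rsL => _ _ hL; apply: hL.
apply/(theta_dualP hw chain_b); exists (\row_j sval (Da j)).
rewrite /chain_proj /coord; congr (comb b (_ *m _)); apply/rowP => j; rewrite !mxE.
apply: (canLR (mulKf (theta_neq0 hw))); exact: svalP (Da j).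
Qed.

Lemma chain_proj_comb_orth r x : h (r - chain_proj w h t b r) (comb b (x : 'rV_k)) = 0.
Proof.
rewrite herm_sumr big1 // => i _.
by rewrite herm_scaler (chain_proj_orth hw chain_b) mulr0.
Qed.

(** The norm 3 of r is the sum of the norms of its projection and of the remainder. Both are
    nonnegative multiples of 3, so one of the two vectors is zero. *)
Lemma root_in_or_orth r : lattice_root h L r -> Lam (chain_proj w h t b r) ->
  Lam r \/ forall i : 'I_k, h r (b i) = 0.
Proof.
case=> Lr nr Lp; set p := chain_proj w h t b r in Lp.
have Lz : L (r - p) by apply: root_spanB => //; apply: chain_lattice_sub.
have [n Dn] := chain_lattice_norm chain_b Lp.
have zp : h (r - p) p = 0 by apply: chain_proj_comb_orth.
have Dz : h (r - p) (r - p) = (3 * (1 - n))%:~R.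
  have := herm_pythagoras zp; rewrite subrK nr Dn => /esym/(canRL (addrK _)) ->.
  by rewrite mulrBr rmorphB.
have n0 : 0 <= n.
  have [p0|np] := eqVneq p 0; last first.
    by have := chain_lattice_pos Lp np; rewrite Dn ltr0z => n3; lia.
  by move: Dn; rewrite p0 herm_0l => /esym/eqP; rewrite intr_eq0 => /eqP; lia.
have [/eqP|nz] := eqVneq (r - p) 0; first by rewrite subr_eq0 => /eqP->; left.
right => i; have [_ pos _] := rsL.
have := pos _ Lz nz; rewrite Dz ltr0z => n1.
have p0 : p = 0.
  apply/eqP; apply: contraT => np; have := chain_lattice_pos Lp np.
  by rewrite Dn ltr0z => n3; lia.
by have := chain_proj_orth hw chain_b r i; rewrite -/p p0 subr0.
Qed.

(** The projection of r is a lattice vector plus a unit times the glue vector. Subtracting the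
    lattice vector lowers the norm from 3 to 3 - 3 m, which must be positive, so m = 0 and the
    result is again a root. *)
Lemma glue_root r : lattice_root h L r -> ~ Lam (chain_proj w h t b r) ->
  exists2 r', lattice_root h L r' &
    forall i : 'I_k, h r' (b i) = - theta * (i == ord_max)%:R.
Proof.
case=> Lr nr nLp; set p := chain_proj w h t b r in nLp.
have dp := chain_proj_theta_dual Lr; rewrite -/p in dp.
have [x [u [nu Dp [_ [m Dm]]]]] := theta_dual_class chain_b chain_lattice_pos dp nLp.
have Lx : Lam (comb b (evm x)) by exists x.
pose r1 := r - comb b (evm x); have Lr1 : L r1.
  by apply: root_spanB => //; apply: chain_lattice_sub.
have Dr1 : r1 = (r - p) + ev hw u *: p0 by rewrite {1}Dp opprD addrA subrK.
have zp0 : h (r - p) p0 = 0 by apply: chain_proj_comb_orth.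
have zp : h (r - p) p = 0 by apply: chain_proj_comb_orth.
have nr1 : h r1 r1 = (3 * (1 - m%:Z))%:~R.
  have nz : h (r - p) (r - p) = 3 - h p p.
    by apply/esym/(canLR (addrK _)); rewrite -(herm_pythagoras zp) subrK.
  have zup : h (r - p) (ev hw u *: p0) = 0 by rewrite herm_scaler zp0 mulr0.
  rewrite Dr1 (herm_pythagoras zup) nz Dm herm_scalel herm_scaler.
  rewrite mulrA ev_norm nu mul1r (herm_glue hw chain_b).
  by rewrite mulrBr rmorphB rmorphM /=; ring.
have r1_neq0 : r1 != 0.
  apply/eqP => r10; apply: nLp; rewrite /p /chain_proj.
  have -> : r = comb b (evm x) by apply/eqP; rewrite -subr_eq0 -/r1 r10.
  by rewrite (combK hw chain_b); exists x.
have [_ pos _] := rsL.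
have m0 : m = 0%N by have := pos _ Lr1 r1_neq0; rewrite nr1 ltr0z; lia.
(* The product of [r1] with the last root is u theta; this factor turns it into - theta, the
   conjugate of the product theta required when the new root stands second. *)
exists (ev hw (- eis_conj u) *: r1); first split; first exact: root_spanZ.
  rewrite herm_scalel herm_scaler mulrA ev_norm nr1 m0.
  have -> : eis_norm (- eis_conj u) = 1.
    by rewrite -nu /eis_norm; case: (u) => a c /=; ring.
  by rewrite mul1r.
move=> i; rewrite herm_scalel Dr1 herm_addl (chain_proj_orth hw chain_b) add0r herm_scalel.
rewrite glue_vectorE // (herm_comb_basis chain_b) mulmxKV ?chain_mx_ev_unit // mxE eqxx /=.
rewrite mulrA -rmorphM /= mulNr [eis_conj u * u]mulrC -eis_normE nu.
by rewrite rmorphN rmorph1 mulN1r mulNr.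
Qed.

Lemma chain_extend r t' : chain_len t' = k -> lattice_root h L r ->
    (forall i : 'I_k, h r (b i) = - theta * (i == ord_max)%:R) ->
  let b' i := if (i < k)%N then b i else r in
  chain w h t' b' /\ forall i : 'I_(chain_len t').+1, L (b' i).
Proof.
move=> Dt' [Lr nr] hr /=; split=> [i j|i]; last first.
  by case: ifP => // lti; apply: (Lb (Ordinal lti)).
have lei : (i <= k)%N by rewrite -ltnS -Dt'.
have lej : (j <= k)%N by rewrite -ltnS -Dt'.
rewrite mxE -val_eqE /=; have [lti|gei] := ltnP i k; have [ltj|gej] := ltnP j k.
- by have := chain_b (Ordinal lti) (Ordinal ltj); rewrite mxE -val_eqE.
- have Dj : j = k :> nat by apply/eqP; rewrite eqn_leq lej.
  rewrite herm_conj (hr (Ordinal lti)) Dj -val_eqE /= rmorphM rmorphN /= (conj_theta_of hw).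
  rewrite opprK rmorph_nat; congr (_ * _).
  rewrite eqSS eq_sym (ltn_eqF (leqW lti)) (ltn_eqF lti) mulr0 !subr0.
  by [].
- have Di : i = k :> nat by apply/eqP; rewrite eqn_leq lei.
  rewrite (hr (Ordinal ltj)) Di -val_eqE /= eqSS mulNr -mulrN; congr (_ * _).
  rewrite (ltn_eqF (leqW ltj)) [k == j]eq_sym (ltn_eqF ltj) mulr0 subr0 sub0r.
  by rewrite eq_sym.
have Di : i = k :> nat by apply/eqP; rewrite eqn_leq lei.
have Dj : j = k :> nat by apply/eqP; rewrite eqn_leq lej.
rewrite Di Dj nr eqxx (ltn_eqF (ltnSn k)) subrr sub0r mulr1 mulrN (theta_sqr hw).
by rewrite opprK.
Qed.
End RootSpan.

Lemma chain_step (L : set V) t b : root_span L -> chain w h t b ->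
    (forall i : 'I_(chain_len t).+1, L (b i)) ->
  (forall r, lattice_root h L r ->
     chain_lattice hw t b r \/ forall i : 'I_(chain_len t).+1, h r (b i) = 0)
  \/ exists t' b', [/\ chain_len t' = (chain_len t).+1, chain w h t' b'
                     & forall i : 'I_(chain_len t').+1, L (b' i)].
Proof.
move=> rsL chain_b Lb.
have [[r [Rr nr]]|all_r] := pselect (exists r, lattice_root h L r /\
    ~ chain_lattice hw t b (chain_proj w h t b r)); last first.
  left=> r Rr; apply: (root_in_or_orth rsL chain_b Lb Rr).
  by apply: contrapT => nr; apply: all_r; exists r.
right; have [r' Rr' hr'] := glue_root rsL chain_b Lb Rr nr.
have [t' Dt'] : exists t', chain_len t' = (chain_len t).+1.
  (* For E8 the theta dual is the lattice itself, so every projection of a root lies in it. *)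
  have tE8 : t <> E8.
    move=> tE; have := chain_proj_theta_dual rsL chain_b Lb Rr.1.
    case/(theta_dual_decomp hw chain_b) => x [be Dp]; apply: nr; rewrite Dp.
    apply/(theta_dual_in_lattice hw chain_b); exists be.
    by rewrite tE (_ : chain_coef omega _ = 1) ?mul1r.
  by case: t tE8 {chain_b Lb Rr nr hr'} => // _; [exists D4 | exists E6 | exists E8].
have [chain_b' Lb'] := chain_extend chain_b Lb Dt' Rr' hr'.
by exists t', (fun i => if (i < (chain_len t).+1)%N then b i else r').
Qed.

Lemma saturated_chain (L : set V) r0 : root_span L -> lattice_root h L r0 ->
  exists t b, [/\ chain w h t b, forall i : 'I_(chain_len t).+1, L (b i)
    & forall r, lattice_root h L r -> chain_lattice hw t b r
        \/ forall i : 'I_(chain_len t).+1, h r (b i) = 0].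
Proof.
move=> rsL [Lr0 nr0].
(* The number n bounds the extensions still to come. As [chain_len] is at most 3, it cannot be
   exhausted. *)
suff: forall n t b, (4 <= chain_len t + n)%N -> chain w h t b ->
    (forall i : 'I_(chain_len t).+1, L (b i)) ->
  exists t b, [/\ chain w h t b, forall i : 'I_(chain_len t).+1, L (b i)
    & forall r, lattice_root h L r -> chain_lattice hw t b r
        \/ forall i : 'I_(chain_len t).+1, h r (b i) = 0].
  move/(_ 4 A2 (fun=> r0) isT); apply=> // i j.
  rewrite !ord1 mxE eqxx subrr sub0r mulr1 mulrN (theta_sqr hw) opprK.
  exact: nr0.
elim=> [|n IHn] t b len_t chain_b Lb; first by case: t len_t {chain_b Lb}.
have [sat|[t' [b' [Dt' chain_b' Lb']]]] := chain_step rsL chain_b Lb; first by exists t, b.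
by apply: (IHn t' b') => //; rewrite Dt' addSnnS.
Qed.
End Classification.

(** * Splitting off chain lattices by induction *)

Section Decomposition.
Variables (C : numClosedFieldType) (w : C).
Hypothesis hw : 3.-primitive_root w.
Variables (V : vectType C) (h : {hermitian_sym V for conjC}).

(** Families over the natural numbers instead of ordinals, so that a further summand can be appended
    at position n. *)
Definition chain_sum (L : set V) : Prop :=
  exists n (t : nat -> root_type) (b : nat -> nat -> V),
  [/\ forall i, (i < n)%N -> chain w h (t i) (b i),
      forall i j x y, (i < n)%N -> (j < n)%N -> i != j ->
        chain_lattice hw (t i) (b i) x -> chain_lattice hw (t j) (b j) y -> h x y = 0
    & forall x, L x <-> exists2 u : nat -> V,
        forall i, (i < n)%N -> chain_lattice hw (t i) (b i) (u i) & x = \sum_(i < n) u i].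

Lemma chain_orth_lattice t (b : nat -> V) y : (forall i : 'I_(chain_len t).+1, h y (b i) = 0) ->
  forall x, chain_lattice hw t b x -> h y x = 0.
Proof.
move=> yb _ [x ->]; rewrite herm_sumr big1 // => i _.
by rewrite herm_scaler yb mulr0.
Qed.

(** A vector in both spans is its own projection to the chain, and that projection vanishes because
    the vector is orthogonal to the chain. *)
Lemma chain_cat_free t (b : nat -> V) s : chain w h t b -> free s ->
    (forall i : 'I_(chain_len t).+1, forall v, v \in s -> h (b i) v = 0) ->
  free (mkseq b (chain_len t).+1 ++ s).
Proof.
move=> chain_b free_s orth_s; set k := _.+1.
rewrite cat_free (chain_free hw chain_b) free_s /=; apply/directv_addP/eqP.
rewrite -subv0; apply/subvP => v; rewrite memv_cap memv0 => /andP[v_b v_s].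
have proj_v : chain_proj w h t b v = v.
  rewrite (coord_span v_b); elim/big_ind: _ => [|x y px py|i _].
  - by rewrite /chain_proj -[in coord _ _ _ _ _](scale0r (0 : V)) coordZ scale0r comb0.
  - by rewrite /chain_proj coordD combD -/(chain_proj _ _ _ _ x) -/(chain_proj _ _ _ _ y) px py.
  have lti : (i < k)%N := ltn_ord i.
  rewrite (nth_mkseq _ _ lti) -(comb_delta b (Ordinal lti)).
  by rewrite /chain_proj coordZ (combK hw chain_b) combZ.
have v_orth i : h v (b (i : 'I_k)) = 0.
  rewrite herm_conj; apply/eqP; rewrite conjC_eq0; apply/eqP.
  rewrite (coord_span (X := in_tuple s) v_s) herm_sumr big1 // => j _.
  by rewrite herm_scaler orth_s ?mulr0 // mem_nth.
rewrite -proj_v /chain_proj /coord (_ : \row_j _ = 0) ?mul0mx ?comb0 //.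
by apply/rowP => j; rewrite !mxE v_orth mulr0.
Qed.

Lemma chain_sum0 (L : set V) : root_span hw h L -> ~ (exists r, lattice_root h L r) ->
  chain_sum L.
Proof.
move=> rsL no_root; exists 0%N, (fun=> A2), (fun _ _ => 0); split=> // x.
split=> [|[u _ ->]]; last by rewrite big_ord0; apply: root_span0 rsL.
have [-> _ _] := rsL; case=> [[|n] [a [v [_ Rv ->]]]].
  by exists (fun=> 0); rewrite // !big_ord0.
by case: no_root; exists (v ord0); apply: Rv.
Qed.

(** The family s collects the roots of the chains already split off; L is orthogonal to it. The
    induction is on the codimension of its span, which avoids speaking of the rank of L. *)
Lemma root_span_chain_sum m (L : set V) (s : seq V) : root_span hw h L -> free s ->
    (forall x v, L x -> v \in s -> h x v = 0) -> (dim V <= size s + m)%N ->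
  chain_sum L.
Proof.
elim: m L s => [|m IHm] L s rsL free_s orth_s dim_s;
  have [[r0 Rr0]|no_root] := pselect (exists r, lattice_root h L r).
(* A root orthogonal to s would extend it to a free family with more than [dim V] members. *)
- have free_r : free (r0 :: s).
    rewrite free_cons free_s andbT; apply/negP => r0s; have [_ nr0] := Rr0.
    have : h r0 r0 = 0.
      rewrite {2}(coord_span (X := in_tuple s) r0s) herm_sumr big1 // => i _.
      by rewrite herm_scaler (orth_s _ _ Rr0.1) ?mulr0 // mem_nth.
    by rewrite nr0 => /eqP; rewrite pnatr_eq0.
  have := dimvS (subvf <<r0 :: s>>); rewrite dimvf (eqnP free_r) /= => dim_le.
  by move: dim_s; rewrite addn0 leqNgt dim_le.
- by apply: chain_sum0.
- have [t [b [chain_b Lb sat]]] := saturated_chain rsL Rr0.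
  pose k := (chain_len t).+1.
  pose S1 : set V := fun r => lattice_root h L r /\ forall i : 'I_k, h r (b i) = 0.
  pose L1 := span_over (eis w) S1.
  have subL1 : (L1 `<=` L)%classic.
    apply: (@span_over_ind _ _ hw _ S1 L) => [|x y|a x [[Lx _] _]].
    - exact: root_span0 rsL.
    - by move=> L1x L1y; apply: (@root_spanD _ _ _ _ _ _ rsL).
    - exact: (@root_spanZ _ _ _ _ _ _ rsL _ _ Lx).
  have orthL1 x : L1 x -> forall i : 'I_k, h x (b i) = 0.
    have : (L1 `<=` fun x => forall i : 'I_k, h x (b i) = 0)%classic.
      apply: (@span_over_ind _ _ hw) => [i|x1 y1 hx hy i|a x1 [_ hx] i].
      - by rewrite herm_0l.
      - by rewrite herm_addl hx hy addr0.
      - by rewrite herm_scalel hx mulr0.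
    by apply.
  have rsL1 : root_span hw h L1.
    have [_ pos hL] := rsL; split=> [|x /subL1|x y /subL1 Lx /subL1 Ly]; [|exact: pos|exact: hL].
    apply/seteqP; split.
      apply: (@span_over_ind _ _ hw) => [|x y|a x S1x].
      - exact: span_over0.
      - exact: span_overD.
      apply/span_overZ/span_over_mem => //; split; first exact: span_over_mem.
      by case: S1x => [[_ ->]].
    apply: (@span_over_ind _ _ hw) => [|x y|a x [L1x _]].
    - exact: span_over0.
    - exact: span_overD.
    - exact: span_overZ.
  have [n [t' [b' [chain_b' orth_b' L1P]]]] : chain_sum L1.
    apply: (IHm L1 (mkseq b k ++ s)) => //.
    - apply: chain_cat_free => // i v v_s.
      by apply: orth_s v_s; apply: Lb.
    - move=> x v L1x; rewrite mem_cat => /orP[v_b|v_s]; last exact: orth_s (subL1 x L1x) v_s.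
      have /mapP[i /[!mem_iota] /= lti ->] : v \in [seq b i | i <- iota 0 k] by [].
      exact: (orthL1 x L1x (Ordinal lti)).
    by rewrite size_cat size_mkseq /k addSn addSnnS -addnA (leq_trans dim_s) ?leq_addl.
  have LamL : (chain_lattice hw t b `<=` L)%classic by apply: chain_lattice_sub rsL _ _ Lb.
  have orth0 x y : L1 x -> chain_lattice hw t b y -> h x y = 0.
    by move=> L1x; apply: chain_orth_lattice; apply: orthL1.
  exists n.+1, (fun i => if (i < n)%N then t' i else t),
    (fun i => if (i < n)%N then b' i else b).
  have sub1 i x : (i < n)%N -> chain_lattice hw (t' i) (b' i) x -> L1 x.
    move=> lti Lx; apply/L1P; exists (fun j => if j == i then x else 0).
      by move=> j ltj; case: eqP => [->|_] //; apply: chain_lattice0.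
    rewrite (bigD1 (Ordinal lti)) //= eqxx big1 ?addr0 // => j nji.
    by rewrite -val_eqE /= in nji; rewrite (negbTE nji).
  split.
  - move=> i; rewrite ltnS leq_eqVlt; case: ltnP => [lti _|_ _]; first exact: chain_b'.
    exact: chain_b.
  - move=> i j x y; rewrite !ltnS => lei lej nij.
    case: ltnP => [lti|gei]; case: ltnP => [ltj|gej] Lx Ly.
    + exact: orth_b' Lx Ly.
    + exact: (orth0 _ _ (sub1 i x lti Lx) Ly).
    + by rewrite herm_conj (orth0 _ _ (sub1 j y ltj Ly) Lx) conjC0.
    + by case/eqP: nij; apply/eqP; rewrite eqn_leq (leq_trans lei gej) (leq_trans lej gei).
  move=> x; have -> : L x <-> exists c y, [/\ chain_lattice hw t b c, L1 y & x = c + y].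
    split=> [|[c [y [Lc L1y ->]]]]; last by apply: (root_spanD rsL); [exact: LamL | exact: subL1].
    have [-> _ _] := rsL; move: x.
    apply: (@span_over_ind _ _ hw _ _ (fun x => exists c y,
      [/\ chain_lattice hw t b c, L1 y & x = c + y])) => [|x1 x2|a r Rr].
    - by exists 0, 0; rewrite addr0; split=> //; [exact: chain_lattice0 | exact: span_over0].
    - case=> c1 [y1 [Lc1 Ly1 ->]] [c2 [y2 [Lc2 Ly2 ->]]]; exists (c1 + c2), (y1 + y2).
      by rewrite addrACA; split=> //; [exact: chain_latticeD | exact: span_overD].
    - have [Lr|hr] := sat r Rr.
        exists (ev hw a *: r), 0; rewrite addr0; split=> //; first exact: chain_latticeZ.
        exact: span_over0.
      exists 0, (ev hw a *: r); rewrite add0r; split=> //; first exact: chain_lattice0.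
      exact/span_overZ/span_over_mem.
  split=> [[c [y [Lc /L1P[u Lu ->] ->]]]|[u Lu ->]].
    exists (fun i => if (i < n)%N then u i else c).
      by move=> i lti; case: ltnP => // ltn; apply: Lu.
    rewrite big_ord_recr /= ltnn addrC; congr (_ + _).
    by apply: eq_bigr => i _; rewrite ltn_ord.
  exists (u n), (\sum_(i < n) u i); split.
  - by have := Lu n (ltnSn n); rewrite ltnn.
  - by apply/L1P; exists u => // i lti; have := Lu i (ltnW lti); rewrite lti.
  by rewrite big_ord_recr /= addrC.
- by apply: chain_sum0.
Qed.
End Decomposition.

Section ChainIsometry.
Variables (C : numClosedFieldType) (w : C).
Hypothesis hw : 3.-primitive_root w.
Variables (V W : vectType C) (h : {hermitian_sym V for conjC}) (h' : {hermitian_sym W for conjC}).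
Variables (t : root_type) (b : nat -> V) (b' : nat -> W).
Hypotheses (chain_b : chain w h t b) (chain_b' : chain w h' t b').

Lemma chain_isometry :
  lattice_isometry w h (chain_lattice hw t b) h' (chain_lattice hw t b')
    (fun v => comb b' (coord w h t b v)).
Proof.
have fE (x : 'rV_(chain_len t).+1) : comb b' (coord w h t b (comb b x)) = comb b' x by rewrite (combK hw chain_b).
split.
- split=> [_ [x ->]|x y|_ [x ->]] /=; first by rewrite fE; exists x.
    move=> /set_mem[x' ->] /set_mem[y' ->]; rewrite !fE => /(comb_inj hw chain_b').
    by move->.
  by exists (comb b (map_mx (ev hw) x)); [exists x | rewrite fE].
- by move=> x y _ _; rewrite coordD combD.
- by move=> a x _ _; rewrite coordZ combZ.
move=> _ _ [x ->] [y ->]; rewrite !fE.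
by rewrite (herm_comb chain_b) (herm_comb chain_b').
Qed.
End ChainIsometry.

Section Classify.
Variables (C : numClosedFieldType) (w : C).
Hypothesis hw : 3.-primitive_root w.
Variables (V : vectType C) (h : {hermitian_sym V for conjC}).

Lemma eis_root_lattice_span L : eis_root_lattice w h L -> root_span hw h L.
Proof.
case=> _ pos theta_L defL; split=> // x y Lx /theta_L[u [_ Lu] ->].
have /(eisP hw)[a Da] := Lu x Lx; exists (- a).
rewrite herm_scaler Da (eis_theta_ev hw) (conj_theta_of hw) rmorphN /= mulrN.
exact: mulNr.
Qed.

(** Uniqueness of the components: the differences between two decompositions are mutually orthogonal
    and add up to 0, so each has norm 0 and vanishes by positivity. *)
Lemma chain_sum_orthogonal (L : set V) :
  (forall x, L x -> x != 0 -> 0 < h x x) -> chain_sum hw h L -> orthogonal_sum_of_std w h L.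
Proof.
move=> pos [n [t [b [chain_b orth_b LP]]]].
exists n, (fun i => t i), (fun i => chain_lattice hw (t i) (b i)).
have subL (i : 'I_n) x : chain_lattice hw (t i) (b i) x -> L x.
  move=> Lx; apply/LP; exists (fun j : nat => if j == i :> nat then x else 0).
    by move=> j ltj; case: eqP => [->|_] //; apply: chain_lattice0.
  rewrite (bigD1 i) //= eqxx big1 ?addr0 // => j nji.
  by rewrite -val_eqE /= in nji; rewrite (negbTE nji).
split.
- move=> i; exists (fun v => comb (b i) (coord w (std_form _) (t i) (std_chain hw (t i)) v)).
  by rewrite (std_latticeE hw); apply: chain_isometry; [exact: std_chainP | exact: chain_b].
- by move=> i j x y nij; apply: orth_b.
- move=> u Lu; apply/LP; exists (fun i => oapp u 0 (insub i)).
    by move=> i lti; rewrite insubT; apply: (Lu (Ordinal lti)).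
  by apply: eq_bigr => i _; rewrite valK.
move=> x /LP[u Lu Dx]; exists [ffun i : 'I_n => u i]; split.
  split=> [i|]; first by rewrite ffunE; apply: Lu.
  by rewrite Dx; apply: eq_bigr => i _; rewrite ffunE.
move=> u' [Lu' Dx']; apply/ffunP => i; rewrite ffunE; apply/eqP; rewrite -subr_eq0.
have Lz (j : 'I_n) : chain_lattice hw (t j) (b j) (u j - u' j).
  by apply: chain_latticeB; [exact: Lu | exact: Lu'].
apply: contraT => /(pos _ (subL i _ (Lz i))).
suff -> : h (u i - u' i) (u i - u' i) = 0 by rewrite ltxx.
have: h (u i - u' i) (\sum_(j < n) (u j - u' j)) = 0.
  by rewrite sumrB -Dx -Dx' subrr herm_0r.
rewrite herm_sumr (bigD1 i) //= big1 ?addr0 // => j nji.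
by apply: (orth_b i j) => //; rewrite eq_sym.
Qed.

Lemma root_lattice_classification (L : set V) :
  eis_root_lattice w h L -> orthogonal_sum_of_std w h L.
Proof.
move=> rL; have rsL := eis_root_lattice_span rL.
apply: chain_sum_orthogonal; first by case: rL.
by apply: (root_span_chain_sum rsL (nil_free V)) => //; apply: leqnn.
Qed.
End Classify.

Lemma std_root_lattice (C : numClosedFieldType) (w : C) t : 3.-primitive_root w ->
  eis_root_lattice w (std_form (std_dim t)) (std_lattice w t).
Proof.
move=> hw; rewrite (std_latticeE hw).
by apply: (chain_root_lattice (@std_chainP _ _ hw t)); apply: std_chain_pos.
Qed.

Theorem theorem3 (R : realType) (w : R[i]) (hw : 3.-primitive_root w) :
  (forall (V : vectType R[i]) (h : {hermitian_sym V for conjC}) (L : set V),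
     eis_root_lattice w h L -> orthogonal_sum_of_std w h L) /\
  (forall t : root_type,
     eis_root_lattice w (std_form (std_dim t)) (std_lattice w t)) /\
  (let h := std_form 1 in let L := A2_lattice w in
   [/\ exists (gT : finGroupType) (rho : gT -> 'rV[R[i]]_1 -> 'rV[R[i]]_1)
              (S : {group gT}),
         [/\ aut_structure w h L rho S, triflection_group w h L rho \isog Zp 3,
             S \isog Zp 2 & #|gT| = 6%N],
       discriminant_space w h L (eis_theta w) 3 1
     & discriminant_norm w h L 1]) /\
  (let h := std_form 3 in let L := D4_lattice w in
   [/\ exists (gT : finGroupType) (rho : gT -> 'rV[R[i]]_3 -> 'rV[R[i]]_3)
              (S : {group gT}),
         [/\ aut_structure w h L rho S, triflection_group w h L rho \isog SL2_3,
             S \isog Zp 3 & #|gT| = 72%N],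
       discriminant_space w h L 2 4 1
     & discriminant_norm w h L (3 / 2)]) /\
  (let h := std_form 3 in let L := E6_lattice w in
   [/\ exists (gT : finGroupType) (rho : gT -> 'rV[R[i]]_3 -> 'rV[R[i]]_3)
              (S : {group gT}),
         [/\ aut_structure w h L rho S,
             is_3_1_2_SL2_3 (triflection_group w h L rho),
             S \isog Zp 2 & #|gT| = 1296%N],
       discriminant_space w h L (eis_theta w) 3 1
     & discriminant_norm w h L 2]) /\
  (let h := std_form 4 in let L := E8_lattice w in
   (exists (gT : finGroupType) (rho : gT -> 'rV[R[i]]_4 -> 'rV[R[i]]_4)
           (S : {group gT}),
      [/\ aut_structure w h L rho S,
          triflection_group w h L rho \isog finset.setX (Zp 3) Sp4_3,
          S :=: 1%g & #|gT| = (155 * 1000 + 520)%N]) /\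
   theta_dual w h L = L).
Proof.
have std_aut t := chain_aut_structure hw (@std_chainP _ _ hw t) (host_model t).
have std_norm t := chain_discriminant_norm (@std_chainP _ _ hw t) (@std_chain_pos _ _ hw t).
have std_space t p := @chain_discriminant_space _ _ hw _ _ _ _ (@std_chainP _ _ hw t) p.
have std_triflection t := triflection_groupE hw (@std_chainP _ _ hw t) (host_model t).
have dE t : ev hw (chain_coef omega (chain_len t).+1)
    = match t with A2 => - eis_theta w | D4 => - 2 | E6 => eis_theta w | E8 => 1 end.
  rewrite (eis_theta_ev hw) -(ev_theta hw); case: t.
  - exact: rmorphN.
  - by rewrite (_ : chain_coef omega _ = Eisint (-2) 0) // ev_int rmorphN.
  - by congr ev.
  - exact: rmorph1.
split; first by move=> V h L; apply: root_lattice_classification.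
split; first by move=> t; apply: std_root_lattice.
split; [|split; [|split]].
- rewrite /= (std_lattice_A2 hw); split; last exact: std_norm A2.
    exists (host_model A2), (lattice_action hw (std_form 1) (std_chain hw A2) (M := host_model A2)).
    exists (scalars (host_model A2)); split; first exact: std_aut A2.
    + rewrite (std_triflection A2); exact: A2_reflection_group.
    + exact: scalars_isog (host_model A2).
    + by rewrite card_model.
  by apply: (std_space A2) => //; right; rewrite (dE A2) opprK.
- rewrite /= (std_lattice_D4 hw); split; last exact: std_norm D4.
    exists (host_model D4), (lattice_action hw (std_form 3) (std_chain hw D4) (M := host_model D4)).
    exists (scalars (host_model D4)); split; first exact: std_aut D4.
    + rewrite (std_triflection D4); exact: D4_reflection_group.
    + exact: scalars_isog (host_model D4).
    + by rewrite card_model.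
  by apply: (std_space D4) => //; right; rewrite (dE D4) opprK.
- rewrite /= (std_lattice_E6 hw); split; last exact: std_norm E6.
    exists (host_model E6), (lattice_action hw (std_form 3) (std_chain hw E6) (M := host_model E6)).
    exists (scalars (host_model E6)); split; first exact: std_aut E6.
    + rewrite (std_triflection E6); exact: E6_reflection_group.
    + exact: scalars_isog (host_model E6).
    + by rewrite card_model.
  by apply: (std_space E6) => //; left; rewrite (dE E6).
rewrite /= (std_lattice_E8 hw); split.
  exists (host_model E8), (lattice_action hw (std_form 4) (std_chain hw E8) (M := host_model E8)).
  exists (scalars (host_model E8)); split; first exact: std_aut E8.
  + rewrite (std_triflection E8); exact: E8_reflection_group.
  + exact/card1_trivg/order_scalars.
  + by rewrite card_model.
apply/seteqP; split; last exact: chain_lattice_theta_dual (@std_chainP _ _ hw E8).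
move=> v /(theta_dual_decomp hw (@std_chainP _ _ hw E8))[x [be ->]].
apply/(theta_dual_in_lattice hw (@std_chainP _ _ hw E8)); exists be.
by rewrite (_ : chain_coef omega _ = 1) ?mul1r.
Qed.
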